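(* (i) The functional $$L(f)=\int_0^\infty f(\rho^{-1})\,\delta(\rho)\,d^*\rho\;+\;W_\infty(f)$$ is positive on the convolution algebra $C_c^\infty(\mathbb{R}_+^* )$, i.e. $L(g*g^* )\ge0$ for all $g\in C_c^\infty(\mathbb{R}_+^* )$. (ii) The function $2\theta'(t)+\widehat\delta(t)$ of $t\in\mathbb{R}$ is non-negative, where $\widehat\delta(t):=\int_{\mathbb{R}_+^*}\delta(\rho)\rho^{-it}\,d^*\rho$.
   Context: $\mathbb{R}_+^*=(0,\infty)$ with Haar measure $d^*u=du/u$; $(f*g)(u)=\int_0^\infty f(v)g(u/v)\,d^*v$, $g^*(u)=\overline{g(u^{-1})}$. $\delta$ is the trace-remainder function on $\mathbb{R}_+^*$; it satisfies $\delta(\rho^{-1})=\delta(\rho)$ and, for $\rho\ge1$, $$\delta(\rho)=4\rho^{\frac12}\int_0^1\!\!\int_0^1\cos(2\pi\rho xy)\cos(2\pi xy)\,dy\,dx=2\rho^{\frac12}\left(\frac{\mathrm{Si}(2\pi(1+\rho))}{2\pi(1+\rho)}+\frac{\mathrm{Si}(2\pi(\rho-1))}{2\pi(\rho-1)}\right),$$ where $\mathrm{Si}(z)=\int_0^z\frac{\sin t}{t}dt$ (and $\mathrm{Si}(z)/z$ is taken to be $1$ at $z=0$). $W_\infty=-W_{\mathbb R}$ with $W_{\mathbb R}(f):=\mathcal W_{\mathbb R}(x\mapsto x^{-1/2}f(x))$, where, with $k^\sharp(x)=x^{-1}k(x^{-1})$ and $\gamma_E$ Euler's constant, $\mathcal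 W_{\mathbb R}(k)=(\log4\pi+\gamma_E)k(1)+\int_1^\infty\big(k(x)+k^\sharp(x)-\frac2xk(1)\big)\frac{dx}{x-x^{-1}}$. (In the paper $W_\infty(f)$ is also written $-\int f(\rho^{-1})\tau(\rho)d^*\rho$ with $\tau$ the distribution representing $W_{\mathbb R}$.) $\theta(t)=-\frac t2\log\pi+\mathrm{Im}\log\Gamma(\frac14+i\frac t2)$ is the Riemann–Siegel angular function, with $\log\Gamma$ the branch on $\mathrm{Re}>0$ that is real on the positive reals. *)

(* Defs.v *)
From mathcomp Require Import all_boot all_order all_algebra.
From mathcomp Require Import complex.
From mathcomp Require Import all_classical all_reals all_analysis.

Set Implicit Arguments.
Unset Strict Implicit.
Unset Printing Implicit Defensive.

Import Order.TTheory GRing.Theory Num.Theory.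
Import numFieldNormedType.Exports.

Local Open Scope classical_set_scope.
Local Open Scope ring_scope.
Local Open Scope complex_scope.

(* Conventions. The group (0, oo) is represented by the positive elements of a
   realType [R]: functions on (0, oo) are functions on [R] whose values at
   nonpositive arguments are never used. Integrals are Lebesgue integrals (all
   of those below converge absolutely), taken componentwise for values in
   [R[i]]. The order of [R[i]] is such that [0 <= z] means that z is real and
   nonnegative. *)

Definition Cintegral (R : realType) (D : set R) (f : R -> R[i]) : R[i] :=
  (\int[lebesgue_measure]_(x in D) complex.Re (f x)) +i*
  (\int[lebesgue_measure]_(x in D) complex.Im (f x)).

(* integral against the Haar measure du/u *)
Definition haar_integral (R : realType) (f : R -> R[i]) : R[i] :=
  Cintegral `]0, +oo[ (fun u => f u / u%:C).

Definition cexp (R : realType) (z : R[i]) : R[i] :=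
  (expR (complex.Re z))%:C * (cos (complex.Im z) +i* sin (complex.Im z)).

(* x ^ z for x > 0 *)
Definition cpow (R : realType) (x : R) (z : R[i]) : R[i] :=
  cexp (z * (ln x)%:C).

Definition smooth_pos (R : realType) (h : R -> R) : Prop :=
  forall (n : nat) (x : R), 0 < x -> derivable (derive1n n h) x 1.

(* g is in C_c^oo((0, oo)) with complex values; a subset of (0, oo) has compact
   closure in (0, oo) iff it lies in some [a, b] with a > 0 *)
Definition Ccoo (R : realType) (g : R -> R[i]) : Prop :=
  [/\ smooth_pos (fun x => complex.Re (g x)),
      smooth_pos (fun x => complex.Im (g x)) &
      exists a b : R, 0 < a /\
        forall x : R, 0 < x -> (x < a) || (b < x) -> g x = 0].

Definition haar_conv (R : realType) (f g : R -> R[i]) (u : R) : R[i] :=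
  haar_integral (fun v => f v * g (u / v)).

Definition haar_star (R : realType) (g : R -> R[i]) (u : R) : R[i] :=
  conjc (g u^-1).

Definition tr_delta_ge1 (R : realType) (rho : R) : R :=
  4 * rho `^ 2^-1 *
  \int[lebesgue_measure]_(x in `[0, 1])
    \int[lebesgue_measure]_(y in `[0, 1])
      (cos (2 * pi * rho * x * y) * cos (2 * pi * x * y)).

(* extended to (0, 1) by tr_delta rho^-1 = tr_delta rho *)
Definition tr_delta (R : realType) (rho : R) : R :=
  if 1 <= rho then tr_delta_ge1 rho else tr_delta_ge1 rho^-1.

Definition euler_gamma (R : realType) : R :=
  lim ((fun n : nat => \sum_(1 <= k < n.+1) k%:R^-1 - ln (n%:R : R)) @ \oo).

Definition ksharp (R : realType) (k : R -> R[i]) (x : R) : R[i] :=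
  x^-1%:C * k x^-1.

Definition calW_R (R : realType) (k : R -> R[i]) : R[i] :=
  (ln (4 * pi) + euler_gamma R)%:C * k 1 +
  Cintegral `]1, +oo[ (fun x =>
    (k x + ksharp k x - (2 / x)%:C * k 1) / (x - x^-1)%:C).

Definition W_R (R : realType) (f : R -> R[i]) : R[i] :=
  calW_R (fun x => (x `^ (- 2^-1))%:C * f x).

Definition W_infty (R : realType) (f : R -> R[i]) : R[i] := - W_R f.

Definition trace_L (R : realType) (f : R -> R[i]) : R[i] :=
  haar_integral (fun rho => f rho^-1 * (tr_delta rho)%:C) + W_infty f.

(* Euler's integral, for Re z > 0 *)
Definition cGamma (R : realType) (z : R[i]) : R[i] :=
  Cintegral `]0, +oo[ (fun t => cpow t (z - 1) * (expR (- t))%:C).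

(* lg is the branch of log Gamma on Re z > 0 that is real on the positive
   reals: a continuous logarithm of Gamma there. Such a branch is unique on
   Re z > 0; its values elsewhere are irrelevant. Continuity is stated for the
   components, as functions of (Re z, Im z) in the product topology. *)
Definition is_log_Gamma (R : realType) (lg : R[i] -> R[i]) : Prop :=
  [/\ forall z : R[i], 0 < complex.Re z -> cexp (lg z) = cGamma z,
      forall p : R * R, 0 < p.1 ->
        continuous_at p (fun q : R * R => complex.Re (lg (q.1 +i* q.2))),
      forall p : R * R, 0 < p.1 ->
        continuous_at p (fun q : R * R => complex.Im (lg (q.1 +i* q.2))) &
      forall x : R, 0 < x -> complex.Im (lg x%:C) = 0].

(* the Riemann-Siegel angular function, for lg = log Gamma *)
Definition RS_theta (R : realType) (lg : R[i] -> R[i]) (t : R) : R :=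
  - (t / 2) * ln pi + complex.Im (lg (4^-1 +i* (t / 2))).

Definition tr_delta_hat (R : realType) (t : R) : R[i] :=
  haar_integral (fun rho => (tr_delta rho)%:C * cpow rho (0 -i* t)).

(* Main.v *)
Require Import Defs.
From HB Require Import structures.
From mathcomp Require Import all_boot all_order all_algebra.
From mathcomp Require Import complex ring lra.
From mathcomp Require Import all_classical all_reals all_analysis.
From mathcomp Require Import measurable_realfun.

(** Both parts assert that one linear functional is nonnegative on functions
    of positive type. For F on (0, oo) with F(1/r) = F(r), let trace_form F be
      2 int_1^oo F(r) delta(r) dr/r - (ln (4 pi) + gamma) F(1)
        - 2 int_1^oo (F(r) r^(-1/2) - F(1)/r) / (r - 1/r) dr.
    If f(1/r) is the conjugate of f(r), the trace functional takes the value
    trace_form (Re f) at f (trace_L_hermitian), because the inversion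
    r -> 1/r folds the integrals over (0, oo) onto (1, oo). On the other side,
    2 theta'(t) + hat delta(t) is the value of trace_form at cos (t ln r)
    (RS_theta_trace). In both cases F(x/y) is a sum, or an average, of products
    xi(x) xi(y).

    The positivity (trace_form_ge0) is Bessel's inequality. Let band_kernel be
    the kernel of the orthogonal projection of the even square integrable
    functions onto those with spectrum in [-1, 1]; then for xi supported in
    x > 1 the form of band_kernel at xi is at most the square norm of xi
    (band_energy_le). Insert xi(x) = x^(-1/2) e^(-e x) times cos or sin of
    t ln x, or times the real or imaginary part of a dilate g(x z), and average
    over z. This bounds
      int int_(x, y > 1) (x y)^(-1/2) e^(-e (x + y)) F(x/y) band_kernel(x, y)
    by F(1) int_1^oo e^(-2 e x) dx/x. In the coordinates x = r y the double
    integral becomes 2 int_1^oo F(r) r^(-1/2) G(r) dr, where G(r) is an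
    integral over y > 1 (cutoff_form_fold). Write G as the integral over y > 0
    minus the one over 0 < y < 1 (radial_kernelE). The first is a sum of arc
    tangents, which tends to 1/(r - 1/r) as e -> 0, and the second tends to
    r^(-1/2) delta(r). So the three terms of trace_form appear in the limit:
    the integrals against delta and against 1/(r - 1/r) by dominated
    convergence, and the multiple of F(1) as the finite part left when the
    logarithmic divergences of both sides of the inequality cancel
    (int_atan_kernel_cvg). That constant is found from
      gamma = int_0^oo (1/(1+v) - e^(-v)) dv/v   (int_gamma_integrand)
    and from the symmetry v -> 1/v of the integral of atan v / v.

    It remains to compute theta'. Along Re z = 1/4 the derivative of the
    argument of Gamma is (X Y' - Y X') / (X^2 + Y^2) with Gamma = X + i Y.
    Differentiate Euler's integral, replace the factor ln x by Frullani's
    integral and rescale x: the square X^2 + Y^2 factors out (log_derivative)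
    and the integral of (e^(-v) - (1+v)^(-1/4) cos (t/2 ln (1+v))) / v remains,
    which the substitution 1 + v = r^2 turns into the archimedean terms
    (RS_theta_integral).

    For g = h + i k with h and k real, the real part of g convolved with its
    adjoint is the sum of the autocorrelations of h and of k, and the Lipschitz
    bounds required in the limit follow from those of h and k, extended by zero
    to the real line. *)

Set Implicit Arguments.
Unset Strict Implicit.
Unset Printing Implicit Defensive.

Import Order.TTheory GRing.Theory Num.Theory.
Import numFieldNormedType.Exports.

Local Open Scope classical_set_scope.
Local Open Scope ring_scope.
Local Open Scope complex_scope.

(** * Integration toolbox *)

Notation L1 m D f := (m.-integrable D (EFin \o f)).

Section IntegrationToolbox.
Context d (T : measurableType d) (R : realType) (m : {measure set T -> \bar R}).

Lemma dominated_L1 (D : set T) (f g : T -> R) : measurable D ->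
  measurable_fun D f -> L1 m D g -> (forall x, D x -> `|f x| <= g x) ->
  L1 m D f.
Proof.
move=> mD mf ig fg; apply: le_integrable ig => //; first exact/measurable_EFinP.
move=> x Dx; rewrite /= lee_fin (le_trans (fg _ Dx))//; exact: ler_norm.
Qed.

Lemma L1_measurable (D : set T) (f : T -> R) : L1 m D f -> measurable_fun D f.
Proof. by move=> /(measurable_int m) /measurable_EFinP. Qed.

Lemma L1D (D : set T) (f g : T -> R) : measurable D -> L1 m D f -> L1 m D g ->
  L1 m D (fun x => f x + g x).
Proof. by move=> mD fi gi; apply: (integrableD mD fi gi). Qed.

Lemma L1N (D : set T) (f : T -> R) : measurable D -> L1 m D f ->
  L1 m D (fun x => - f x).
Proof. by move=> mD fi; apply: (integrableN fi). Qed.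

Lemma L1B (D : set T) (f g : T -> R) : measurable D -> L1 m D f -> L1 m D g ->
  L1 m D (fun x => f x - g x).
Proof. by move=> mD fi gi; apply: L1D => //; exact: L1N. Qed.

Lemma L1Z (D : set T) (c : R) (f : T -> R) : measurable D -> L1 m D f ->
  L1 m D (fun x => c * f x).
Proof. by move=> mD fi; apply: (integrableZl mD c fi). Qed.

Lemma eq_L1 (D : set T) (f g : T -> R) : measurable D ->
  (forall x, D x -> f x = g x) -> L1 m D f -> L1 m D g.
Proof.
move=> mD fg; apply: eq_integrable => // x; rewrite inE => Dx /=.
by rewrite fg.
Qed.

Lemma eq_Rint (D : set T) (f g : T -> R) : (forall x, D x -> f x = g x) ->
  \int[m]_(x in D) f x = \int[m]_(x in D) g x.
Proof. by move=> fg; apply: eq_Rintegral => x; rewrite inE; exact: fg. Qed.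

Lemma EFin_Rint (D : set T) (f : T -> R) : measurable D -> L1 m D f ->
  (\int[m]_(x in D) f x)%:E = (\int[m]_(x in D) (f x)%:E)%E.
Proof. by move=> mD fi; rewrite /Rintegral fineK//; exact: integrable_fin_num. Qed.

Lemma RintN (D : set T) (f : T -> R) : measurable D -> L1 m D f ->
  \int[m]_(x in D) (- f x) = - \int[m]_(x in D) f x.
Proof.
move=> mD fi; under eq_Rintegral do rewrite -mulN1r.
by rewrite RintegralZl// mulN1r.
Qed.

(** Dominated convergence, for real-valued integrals along a sequence. *)
Lemma Rdominated_cvg (D : set T) (f_ : nat -> T -> R) (f g : T -> R) :
  measurable D -> (forall n, measurable_fun D (f_ n)) ->
  (forall x, D x -> f_ ^~ x @ \oo --> f x) -> L1 m D g ->
  (forall n x, D x -> `|f_ n x| <= g x) ->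
  L1 m D f /\ \int[m]_(x in D) f_ n x @[n --> \oo] --> \int[m]_(x in D) f x.
Proof.
move=> mD mf_ cf ig fg.
have mf : measurable_fun D f by apply: (measurable_fun_cvg mf_).
have fi : L1 m D f.
  apply: dominated_L1 ig _ => // x Dx.
  apply: (@ler_cvg_to _ \oo _ _ (fun n => `|f_ n x|) (fun=> g x)).
  - by apply: cvg_norm; exact: cf.
  - exact: cvg_cst.
  - by apply: nearW => n; exact: fg.
split=> //.
apply: fine_cvg; rewrite EFin_Rint//.
apply: (@dominated_cvg _ _ _ m D mD (fun n x => (f_ n x)%:E) (EFin \o f) (EFin \o g)) => //.
- by move=> n; exact/measurable_EFinP.
- by move=> x Dx; apply: cvg_EFin; [exact: nearW|exact: cf].
Qed.

(** Dominated convergence for the truncations of an integrable function to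
    an increasing sequence of sets. *)
Lemma cvg_Rint_bigcup (D_ : nat -> set T) (f : T -> R) :
  nondecreasing_seq D_ -> (forall n, measurable (D_ n)) ->
  L1 m (\bigcup_n D_ n) f ->
  \int[m]_(x in D_ n) f x @[n --> \oo] --> \int[m]_(x in \bigcup_n D_ n) f x.
Proof.
move=> nd mD fi; have mU : measurable (\bigcup_n D_ n) by exact: bigcup_measurable.
have subU n : D_ n `<=` \bigcup_n D_ n by exact: bigcup_sup.
have -> : (fun n => \int[m]_(x in D_ n) f x) =
    (fun n => \int[m]_(x in \bigcup_n D_ n) (f \_ (D_ n)) x).
  by apply/funext => n; rewrite -Rintegral_mkcondr setIidr.
have [] // := @Rdominated_cvg (\bigcup_n D_ n) (fun n => f \_ (D_ n)) f
  (fun x => `|f x|) mU.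
- move=> n; apply/(measurable_restrict f) => //; rewrite setIidr//.
  by apply: measurable_funS (L1_measurable fi).
- move=> x [N _ DN]; apply: cvg_near_cst; near=> n; rewrite patchE mem_set//.
  have /nd : (N <= n)%N by near: n; exact: nbhs_infty_ge.
  by move=> /subsetPset; apply.
- exact: integrable_abse fi.
- by move=> n x _; rewrite patchE; case: ifP => // _; rewrite normr0.
Unshelve. all: end_near. Qed.

End IntegrationToolbox.

Section ProductSigmaFinite.
Context d1 d2 (T1 : measurableType d1) (T2 : measurableType d2) (R : realType).
Variable m1 : {sigma_finite_measure set T1 -> \bar R}.
Variable m2 : {sigma_finite_measure set T2 -> \bar R}.

Lemma sigma_finite_product : sigma_finite setT (m1 \x m2)%E.
Proof.
have /sigma_finiteP[F [TF ndF Foo]] := sigma_finiteT m1.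
have /sigma_finiteP[G [TG ndG Goo]] := sigma_finiteT m2.
exists (fun n => F n `*` G n) => [|n].
  apply/seteqP; split=> // -[x y] _.
  have : setT x by []. have : setT y by [].
  rewrite [in X in X y -> _]TG [in X in X x -> _]TF => -[n _ Gy] [k _ Fx].
  exists (maxn k n) => //; split=> /=.
    by have /subsetPset := ndF _ _ (leq_maxl k n); apply.
  by have /subsetPset := ndG _ _ (leq_maxr k n); apply.
have [mF fF] := Foo n; have [mG fG] := Goo n; split; first exact: measurableX.
by rewrite product_measure1E// lte_mul_pinfty// ge0_fin_numE.
Qed.

(** Fubini between a product measure and a third one needs the former as a
    sigma-finite measure. *)
Definition product_sigma_finite : {sigma_finite_measure set (T1 * T2)%type -> \bar R} :=
  HB.pack (m1 \x m2)%E (Measure_isSigmaFinite.Build _ _ _ (m1 \x m2)%E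
    sigma_finite_product).

End ProductSigmaFinite.

Section DominatedFubini.
Context d1 d2 (T1 : measurableType d1) (T2 : measurableType d2) (R : realType).
Variable m1 : {sigma_finite_measure set T1 -> \bar R}.
Variable m2 : {sigma_finite_measure set T2 -> \bar R}.

(** Fubini's theorem for integrands dominated by a product of two integrable
    functions, which makes all the integrability side conditions automatic. *)
Lemma dominated_Fubini (D1 : set T1) (D2 : set T2) (f : T1 -> T2 -> R)
    (u : T1 -> R) (v : T2 -> R) :
  measurable D1 -> measurable D2 ->
  measurable_fun (D1 `*` D2) (fun z => f z.1 z.2) ->
  L1 m1 D1 u -> L1 m2 D2 v ->
  (forall x y, D1 x -> D2 y -> `|f x y| <= u x * v y) ->
  [/\ L1 (m1 \x m2)%E (D1 `*` D2) (fun z => f z.1 z.2),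
      L1 m1 D1 (fun x => \int[m2]_(y in D2) f x y),
      L1 m2 D2 (fun y => \int[m1]_(x in D1) f x y),
      \int[(m1 \x m2)%E]_(z in D1 `*` D2) f z.1 z.2 =
        \int[m1]_(x in D1) \int[m2]_(y in D2) f x y &
      \int[(m1 \x m2)%E]_(z in D1 `*` D2) f z.1 z.2 =
        \int[m2]_(y in D2) \int[m1]_(x in D1) f x y].
Proof.
move=> mD1 mD2 mf iu iv fuv.
have mD : measurable (D1 `*` D2) by exact: measurableX.
pose F := (fun z => f z.1 z.2) \_ (D1 `*` D2).
have mF : measurable_fun setT F.
  by apply/(measurable_restrictT (fun z => f z.1 z.2)).
have F12 x : D1 x -> (fun y => F (x, y)) = (f x) \_ D2.
  move=> Dx; apply/funext => y; rewrite /F !patchE in_setX/=.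
  by rewrite (mem_set Dx).
have F12' x : ~ D1 x -> (fun y => F (x, y)) = cst 0.
  move=> Dx; apply/funext => y; rewrite /F !patchE in_setX/=.
  by rewrite memNset.
have F21 y : D2 y -> (fun x => F (x, y)) = (f ^~ y) \_ D1.
  move=> Dx; apply/funext => x; rewrite /F !patchE in_setX/=.
  by rewrite (mem_set Dx) andbT.
have F21' y : ~ D2 y -> (fun x => F (x, y)) = cst 0.
  move=> Dx; apply/funext => x; rewrite /F !patchE in_setX/= andbC.
  by rewrite memNset.
have iF : L1 (m1 \x m2)%E setT F.
  apply/integrable12ltyP; first exact/measurable_EFinP.
  have iv' : L1 m2 setT ((fun y => `|v y|) \_ D2).
    have /(integrable_mkcond _ mD2) := integrable_abse iv.
    by apply: eq_integrable => // y _; rewrite /= !patchE; case: ifP.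
  have iu' : L1 m1 setT ((fun x => `|u x|) \_ D1).
    have /(integrable_mkcond _ mD1) := integrable_abse iu.
    by apply: eq_integrable => // y _; rewrite /= !patchE; case: ifP.
  pose V := \int[m2]_(y in setT) (((fun y => `|v y|) \_ D2) y).
  have bound x : (\int[m2]_y `|(EFin \o F) (x, y)| <= (((fun x => `|u x|) \_ D1) x * V)%:E)%E.
    have [Dx|Dx] := pselect (D1 x); last first.
      rewrite patchE memNset// mul0r integral0_eq// => y _ /=.
      by move/(congr1 (@^~ y)): (F12' _ Dx) => /= ->; rewrite normr0.
    rewrite patchE mem_set// EFinM /V EFin_Rint// -ge0_integralZl//; last 2 first.
    - by case/integrableP: iv'.
    - by move=> y _; rewrite lee_fin patchE; case: ifP.
    apply: ge0_le_integral => //.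
    - apply/measurable_EFinP; apply: measurableT_comp => //=.
      by apply: measurableT_comp => //; exact: measurable_pair1.
    - apply/measurable_EFinP; apply: measurable_funM => //.
      exact: L1_measurable iv'.
    move=> y _; rewrite lee_fin.
    move/(congr1 (@^~ y)): (F12 _ Dx) => /= ->.
    rewrite !patchE; case: ifP => [|_]; last by rewrite normr0 mulr0.
    rewrite inE => Dy; apply: (le_trans (fuv _ _ Dx Dy)).
    by rewrite -normrM ler_norm.
  apply: (@le_lt_trans _ _ (\int[m1]_x (((fun x => `|u x|) \_ D1) x * V)%:E)%E).
    apply: ge0_le_integral => //.
    - by move=> x _; exact: integral_ge0.
    - apply: (measurable_fun_fubini_tonelli_F (abse \o (EFin \o F))) => //.
      by apply: measurableT_comp => //; exact/measurable_EFinP.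
    - by move=> x; exact: abse_ge0.
    - apply/measurable_EFinP; apply: measurable_funM => //.
      exact: L1_measurable iu'.
  under eq_integral do rewrite mulrC.
  rewrite -EFin_Rint//; first exact: ltry.
  by apply: L1Z.
have i1 x : D1 x -> L1 m2 D2 (f x).
  move=> Dx; apply: (@dominated_L1 _ _ _ m2 D2 _ (fun y => u x * v y)) => //.
  - apply/(measurable_restrictT (f x)) => //; rewrite -(F12 _ Dx).
    by apply: measurableT_comp => //; exact: measurable_pair1.
  - exact: L1Z.
  - by move=> y Dy; exact: fuv.
have i2 y : D2 y -> L1 m1 D1 (f ^~ y).
  move=> Dy; apply: (@dominated_L1 _ _ _ m1 D1 _ (fun x => v y * u x)) => //.
  - apply/(measurable_restrictT (f ^~ y)) => //; rewrite -(F21 _ Dy).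
    by apply: measurableT_comp => //; exact: measurable_pair2.
  - exact: L1Z.
  - by move=> x Dx; rewrite mulrC; exact: fuv.
have E1 : fubini_F m2 (EFin \o F) =
    EFin \o ((fun x => \int[m2]_(y in D2) f x y) \_ D1).
  apply/funext => x; rewrite /fubini_F/= patchE; case: ifPn; rewrite ?inE ?notin_setE => Dx.
    rewrite EFin_Rint//; last exact: i1.
    rewrite [RHS]integral_mkcond; apply: eq_integral => y _.
    move/(congr1 (@^~ y)): (F12 _ Dx) => /= ->.
    by rewrite !patchE; case: ifP.
  rewrite integral0_eq// => y _.
  by move/(congr1 (@^~ y)): (F12' _ Dx) => /= ->.
have E2 : fubini_G m1 (EFin \o F) =
    EFin \o ((fun y => \int[m1]_(x in D1) f x y) \_ D2).
  apply/funext => y; rewrite /fubini_G/= patchE; case: ifPn; rewrite ?inE ?notin_setE => Dy.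
    rewrite EFin_Rint//; last exact: i2.
    rewrite [RHS]integral_mkcond; apply: eq_integral => x _.
    move/(congr1 (@^~ x)): (F21 _ Dy) => /= ->.
    by rewrite !patchE; case: ifP.
  rewrite integral0_eq// => x _.
  by move/(congr1 (@^~ x)): (F21' _ Dy) => /= ->.
have L1r (dd : measure_display) (T : measurableType dd) (m : {measure set T -> \bar R})
    (D : set T) (g : T -> R) : measurable D -> L1 m setT (g \_ D) -> L1 m D g.
  move=> mDD; move=> h; apply/(integrable_mkcond _ mDD).
  by apply: eq_integrable h => // y _; rewrite /= !patchE; case: ifP.
have IE : \int[(m1 \x m2)%E]_(z in D1 `*` D2) f z.1 z.2 =
          fine (\int[(m1 \x m2)%E]_z (EFin \o F) z)%E.
  by rewrite Rintegral_mkcond.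
split.
- exact: L1r iF.
- by apply: L1r => //; have := integrable_fubini_F iF; rewrite E1.
- have mG : measurable_fun D2 (fun y => \int[m1]_(x in D1) f x y).
    apply/(measurable_restrictT (fun y => \int[m1]_(x in D1) f x y)) => //.
    by apply/measurable_EFinP; rewrite -E2; exact: measurable_fubini_G iF.
  have iu1 : L1 m1 D1 (fun x => `|u x|) by exact: integrable_abse iu.
  apply: (@dominated_L1 _ _ _ m2 D2 _ (fun y => (\int[m1]_(x in D1) `|u x|) * `|v y|)) => //.
    by apply: L1Z => //; exact: integrable_abse iv.
  move=> y Dy; rewrite mulrC -RintegralZl//.
  apply: (le_trans (le_normr_Rintegral mD1 (i2 _ Dy))); apply: le_Rintegral => //.
  - exact: integrable_abse (i2 _ Dy).
  - exact: L1Z.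
  - by move=> x Dx; rewrite (le_trans (fuv _ _ Dx Dy))// mulrC -normrM ler_norm.
- by rewrite IE -integral12_prod_meas1//= E1 [RHS]Rintegral_mkcond.
- by rewrite IE -integral21_prod_meas1//= E2 [RHS]Rintegral_mkcond.
Qed.

End DominatedFubini.

(** * Integrals over open intervals *)

Section OpenIntervals.
Variable R : realType.
Notation mu := (@lebesgue_measure R).
Implicit Types (D : set R) (a b : nat -> R) (f F G : R -> R).

(** An open interval is handled through compact intervals that increase to
    it, so that half lines and bounded intervals are treated alike. *)
Definition exhausts D a b := [/\ nonincreasing_seq a, nondecreasing_seq b,
  forall n, a n < b n & D = \bigcup_n `[a n, b n]%classic].

Lemma exhausts_nd D a b : exhausts D a b ->
  nondecreasing_seq (fun n => `[a n, b n]%classic).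
Proof.
move=> [na nb _ _]; move=> n m nm; apply/subsetPset; apply: subset_itv.
  by rewrite bnd_simp; exact: na.
by rewrite bnd_simp; exact: nb.
Qed.

Lemma exhausts_sub D a b n x : exhausts D a b -> x \in `[a n, b n] -> D x.
Proof. by move=> [_ _ _ ->] h; exists n. Qed.

Lemma continuous_itv_within f D : (forall x, D x -> {for x, continuous f}) ->
  {within D, continuous f}.
Proof. by move=> cf; apply: continuous_in_subspaceT => x; rewrite inE; exact: cf. Qed.

Lemma FTC_compact (a b : R) f F : a < b ->
  (forall x, x \in `[a, b] -> {for x, continuous f}) ->
  (forall x, x \in `[a, b] -> is_derive x 1 F (f x)) ->
  (\int[mu]_(x in `[a, b]) (f x)%:E = (F b)%:E - (F a)%:E)%E.
Proof.
move=> ab cf dF; apply: continuous_FTC2 => //.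
- exact: continuous_itv_within.
- split=> [x xab||].
  + by apply: ex_derive; apply: dF; exact: subset_itv_oo_cc.
  + apply: cvg_at_right_filter; apply: differentiable_continuous.
    by apply/derivable1_diffP; apply: ex_derive; apply: dF; rewrite /= in_itv/= lexx ltW.
  + apply: cvg_at_left_filter; apply: differentiable_continuous.
    by apply/derivable1_diffP; apply: ex_derive; apply: dF; rewrite /= in_itv/= lexx ltW.
- move=> x xab; rewrite derive1E; apply: derive_val.
  by apply: dF; exact: subset_itv_oo_cc.
Qed.

Lemma continuous_exhausts_measurable D a b f : exhausts D a b ->
  (forall x, D x -> {for x, continuous f}) -> measurable_fun D f.
Proof.
move=> ex cf; have [_ _ _ ->] := ex; apply/measurable_fun_bigcup => // n.
apply: subspace_continuous_measurable_fun => //.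
by apply: continuous_itv_within => x /(exhausts_sub ex); exact: cf.
Qed.

Lemma exhausts_measurable D a b : exhausts D a b -> measurable D.
Proof. by move=> [_ _ _ ->]; exact: bigcup_measurable. Qed.

Lemma ge0_integral_exhausts D a b f : exhausts D a b -> measurable_fun D f ->
  (forall x, D x -> 0 <= f x) ->
  (\int[mu]_(x in `[a n, b n]) (f x)%:E @[n --> \oo] -->
   \int[mu]_(x in D) (f x)%:E)%E.
Proof.
move=> ex mf f0; have [_ _ _ DE] := ex; rewrite [in X in _ --> X]DE.
apply: ge0_nondecreasing_set_cvg_integral => //.
- exact: exhausts_nd ex.
- move=> n; apply/measurable_EFinP.
  apply: measurable_funS mf; first exact: exhausts_measurable ex.
  by move=> x; exact: exhausts_sub.
- by move=> n x /(exhausts_sub ex) Dx; rewrite lee_fin f0.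
Qed.

(** For a nonnegative integrand the limits of a primitive at the ends give
    integrability as well as the value, by monotone convergence. *)
Lemma ge0_FTC_exhausts D a b f F (l : R) : exhausts D a b ->
  (forall x, D x -> {for x, continuous f}) ->
  (forall x, D x -> is_derive x 1 F (f x)) ->
  (forall x, D x -> 0 <= f x) ->
  F (b n) - F (a n) @[n --> \oo] --> l ->
  L1 mu D f /\ \int[mu]_(x in D) f x = l.
Proof.
move=> ex cf dF f0 Fl; have mf := continuous_exhausts_measurable ex cf.
have mD := exhausts_measurable ex.
have E : (\int[mu]_(x in D) (f x)%:E = l%:E)%E.
  have h := ge0_integral_exhausts ex mf f0.
  apply: (cvg_unique _ h) => //.
  have -> : (fun n => \int[mu]_(x in `[a n, b n]) (f x)%:E)%E =
            EFin \o (fun n => F (b n) - F (a n)).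
    apply/funext => n /=; have [_ _ ab _] := ex.
    by apply: FTC_compact => // x /(exhausts_sub ex); [exact: cf|exact: dF].
  by apply: cvg_EFin => //; exact: nearW.
split; last by rewrite /Rintegral E.
apply/integrableP; split; first exact/measurable_EFinP.
under eq_integral => x xD.
  rewrite gee0_abs; last by rewrite /= lee_fin f0// -inE.
  over.
by rewrite /= E ltry.
Qed.

Lemma FTC_exhausts D a b f F (l : R) : exhausts D a b ->
  (forall x, D x -> {for x, continuous f}) ->
  (forall x, D x -> is_derive x 1 F (f x)) ->
  L1 mu D f -> F (b n) - F (a n) @[n --> \oo] --> l ->
  \int[mu]_(x in D) f x = l.
Proof.
move=> ex cf dF fi Fl.
have : \int[mu]_(x in `[a n, b n]) f x @[n --> \oo] --> \int[mu]_(x in D) f x.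
  have [_ _ _ DE] := ex; rewrite [in X in _ --> X]DE.
  apply: cvg_Rint_bigcup => //; first exact: exhausts_nd ex.
  by rewrite -DE.
have -> : (fun n => \int[mu]_(x in `[a n, b n]) f x) = (fun n => F (b n) - F (a n)).
  apply/funext => n /=; have [_ _ ab _] := ex; rewrite /Rintegral.
  suff -> : (\int[mu]_(x in `[a n, b n]) (f x)%:E = (F (b n))%:E - (F (a n))%:E)%E by [].
  by apply: FTC_compact => // x /(exhausts_sub ex); [exact: cf|exact: dF].
by move=> h; apply: (cvg_unique _ h) => //.
Qed.

Lemma exhausts_oo (u v : R) : u < v ->
  exhausts `]u, v[ (fun n => u + (v - u) / n.+3%:R)
                   (fun n => v - (v - u) / n.+3%:R).
Proof.
move=> uv; have vu0 : 0 < v - u by rewrite subr_gt0.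
have le n m : (n <= m)%N -> (v - u) / m.+3%:R <= (v - u) / n.+3%:R.
  by move=> nm; rewrite ler_pM2l// lef_pV2 ?posrE// ler_nat.
split.
- by move=> n m nm; rewrite lerD2l le.
- by move=> n m nm; rewrite lerD2l lerN2 le.
- move=> n; rewrite ltrBrDl addrCA -ltrBrDl.
  have h3 : (v - u) / n.+3%:R <= (v - u) / 3 by rewrite ler_pM2l// lef_pV2 ?posrE// ler_nat.
  by apply: le_lt_trans (lerD h3 h3) _; lra.
- apply/seteqP; split=> x /=; rewrite in_itv/=.
  + move=> /andP[ux xv]; pose e := Num.min (x - u) (v - x).
    have e0 : 0 < e by rewrite lt_min !subr_gt0 ux.
    pose N := Num.trunc ((v - u) / e).
    have : (v - u) / N.+3%:R <= e.
      rewrite ler_pdivrMr// mulrC -ler_pdivrMr//.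
      have /truncn_itv/andP[_ /ltW h] : 0 <= (v - u) / e by rewrite divr_ge0// ltW.
      by apply: (le_trans h); rewrite ler_nat ltnS leqW.
    rewrite /e le_min => /andP[h1 h2]; exists N => //=; rewrite in_itv/=.
    by rewrite -lerBrDl h1/= lerBrDr -lerBrDl.
  + move=> [n _] /=; rewrite in_itv/= => /andP[h1 h2].
    have q0 : 0 < (v - u) / n.+3%:R by rewrite divr_gt0.
    by rewrite (lt_le_trans _ h1) ?ltrDl//= (le_lt_trans h2)// ltrBlDr ltrDl.
Qed.

Lemma exhausts_oy (u : R) :
  exhausts `]u, +oo[ (fun n => u + n.+1%:R^-1) (fun n => u + n.+2%:R).
Proof.
split.
- by move=> n m nm; rewrite lerD2l lef_pV2 ?posrE// ler_nat.
- by move=> n m nm; rewrite lerD2l ler_nat.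
- by move=> n; rewrite ltrD2l (@le_lt_trans _ _ 1)// ?invf_le1// ?ler1n ?ltr1n.
- apply/seteqP; split=> x /=; rewrite in_itv/= ?andbT.
  + move=> ux.
    pose N := maxn (Num.trunc (x - u)^-1) (Num.trunc (x - u)).
    have xu0 : 0 < x - u by rewrite subr_gt0.
    have h1 : (x - u)^-1 <= N.+1%:R.
      have /truncn_itv/andP[_ /ltW h] : 0 <= (x - u)^-1 by rewrite invr_ge0 ltW.
      by apply: (le_trans h); rewrite ler_nat ltnS leq_maxl.
    have h2 : x - u <= N.+2%:R.
      have /truncn_itv/andP[_ /ltW h] : 0 <= (x - u) by rewrite ltW.
      by apply: (le_trans h); rewrite ler_nat ltnW// ltnS ltnS leq_maxr.
    have : N.+1%:R^-1 <= x - u by rewrite -[leRHS]invrK lef_pV2 ?posrE// invr_gt0.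
    by move=> h; exists N => //=; rewrite in_itv/= -lerBrDl h/= -lerBlDl.
  + move=> [n _] /=; rewrite in_itv/= => /andP[h1 h2].
    by apply: lt_le_trans h1; rewrite ltrDl invr_gt0.
Qed.

Lemma cvg_seq_oy (u : R) F (la : R) : F x @[x --> u^'+] --> la ->
  F (u + n.+1%:R^-1) @[n --> \oo] --> la.
Proof.
move=> /cvg_at_rightP; apply; split=> [n|]; first by rewrite ltrDl.
rewrite -[X in _ --> X]addr0; apply: cvgD; first exact: cvg_cst.
exact: cvg_harmonic.
Qed.

Lemma cvg_seq_y (u : R) F (la : R) : F x @[x --> +oo] --> la ->
  F (u + n.+2%:R) @[n --> \oo] --> la.
Proof.
move=> /cvg_pinftyP; apply.
apply/cvgryPge => r; near=> n.
rewrite -lerBlDl (@le_trans _ _ n%:R)//; last by rewrite ler_nat ltnW.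
by near: n; exact: nbhs_infty_ger.
Unshelve. all: end_near. Qed.

Lemma cvg_harm3 (c : R) : c / n.+3%:R @[n --> \oo] --> 0.
Proof.
rewrite -[X in _ --> X](mulr0 c); apply: cvgM; first exact: cvg_cst.
have := @cvg_harmonic R; rewrite -(cvg_shiftn 2); apply: cvg_trans.
by apply: near_eq_cvg; apply: nearW => n; rewrite /harmonic/= addn2.
Qed.

Lemma cvg_seq_oo_l (u v : R) F (la : R) : u < v -> F x @[x --> u^'+] --> la ->
  F (u + (v - u) / n.+3%:R) @[n --> \oo] --> la.
Proof.
move=> uv /cvg_at_rightP; apply; split=> [n|].
  by rewrite ltrDl divr_gt0// subr_gt0.
by rewrite -[X in _ --> X]addr0; apply: cvgD; [exact: cvg_cst|exact: cvg_harm3].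
Qed.

Lemma cvg_seq_oo_r (u v : R) F (la : R) : u < v -> F x @[x --> v^'-] --> la ->
  F (v - (v - u) / n.+3%:R) @[n --> \oo] --> la.
Proof.
move=> uv /cvg_at_leftP; apply; split=> [n|].
  by rewrite ltrBlDr ltrDl divr_gt0// subr_gt0.
rewrite -[X in _ --> X]subr0; apply: cvgB; first exact: cvg_cst.
exact: cvg_harm3.
Qed.

Lemma ge0_FTC_oy (u : R) f F (la lb : R) :
  (forall x, u < x -> {for x, continuous f}) ->
  (forall x, u < x -> is_derive x 1 F (f x)) ->
  (forall x, u < x -> 0 <= f x) ->
  F x @[x --> u^'+] --> la -> F x @[x --> +oo] --> lb ->
  L1 mu `]u, +oo[ f /\ \int[mu]_(x in `]u, +oo[) f x = lb - la.
Proof.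
move=> cf dF f0 Fa Fb; apply: (@ge0_FTC_exhausts _ _ _ f F _ (exhausts_oy u)).
- by move=> x; rewrite /= in_itv/= andbT; exact: cf.
- by move=> x; rewrite /= in_itv/= andbT; exact: dF.
- by move=> x; rewrite /= in_itv/= andbT; exact: f0.
- by apply: cvgB; [exact: cvg_seq_y|exact: cvg_seq_oy].
Qed.

Lemma FTC_oy (u : R) f F (la lb : R) :
  (forall x, u < x -> {for x, continuous f}) ->
  (forall x, u < x -> is_derive x 1 F (f x)) ->
  L1 mu `]u, +oo[ f ->
  F x @[x --> u^'+] --> la -> F x @[x --> +oo] --> lb ->
  \int[mu]_(x in `]u, +oo[) f x = lb - la.
Proof.
move=> cf dF fi Fa Fb; apply: (@FTC_exhausts _ _ _ f F _ (exhausts_oy u)) => //.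
- by move=> x; rewrite /= in_itv/= andbT; exact: cf.
- by move=> x; rewrite /= in_itv/= andbT; exact: dF.
- by apply: cvgB; [exact: cvg_seq_y|exact: cvg_seq_oy].
Qed.

Lemma ge0_FTC_oo (u v : R) f F (la lb : R) : u < v ->
  (forall x, u < x < v -> {for x, continuous f}) ->
  (forall x, u < x < v -> is_derive x 1 F (f x)) ->
  (forall x, u < x < v -> 0 <= f x) ->
  F x @[x --> u^'+] --> la -> F x @[x --> v^'-] --> lb ->
  L1 mu `]u, v[ f /\ \int[mu]_(x in `]u, v[) f x = lb - la.
Proof.
move=> uv cf dF f0 Fa Fb; apply: (@ge0_FTC_exhausts _ _ _ f F _ (exhausts_oo uv)).
- by move=> x; rewrite /= in_itv/=; exact: cf.
- by move=> x; rewrite /= in_itv/=; exact: f0.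
- by apply: cvgB; [exact: cvg_seq_oo_r|exact: cvg_seq_oo_l].
Qed.

(** A change of variables between two open intervals is checked on compact
    exhaustions, so that nothing is asked at the end points. *)
Section ChangeOfVariables.
Variables (i j : interval R) (a b : nat -> R) (phi dphi psi : R -> R).
Let I := [set` i].
Let J := [set` j].
Hypothesis exI : exhausts I a b.
Hypothesis phiJ : forall x, I x -> J (phi x).
Hypothesis psiI : forall y, J y -> I (psi y).
Hypothesis psiK : forall y, J y -> phi (psi y) = y.
Hypothesis dphiP : forall x, I x -> is_derive x 1 phi (dphi x).
Hypothesis cdphi : forall x, I x -> {for x, continuous dphi}.

Let cphi x : I x -> {for x, continuous phi}.
Proof.
move=> Ix; apply: differentiable_continuous; apply/derivable1_diffP.
by apply: ex_derive; exact: dphiP.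
Qed.

Let aI n : I (a n).
Proof.
have [_ _ ab _] := exI; apply: (@exhausts_sub _ _ _ n _ exI).
by rewrite in_itv/= lexx ltW.
Qed.

Let bI n : I (b n).
Proof.
have [_ _ ab _] := exI; apply: (@exhausts_sub _ _ _ n _ exI).
by rewrite in_itv/= lexx ltW.
Qed.

Let dphiE n x : x \in `]a n, b n[ -> derive1 phi x = dphi x.
Proof.
move=> xn; rewrite derive1E; apply: derive_val; apply: dphiP.
by apply: (@exhausts_sub _ _ _ n _ exI); exact: subset_itv_oo_cc.
Qed.

Let near_in n x : x \in `]a n, b n[ -> \forall y \near x, y \in `]a n, b n[.
Proof. by move=> xn; exact: near_in_itvoo. Qed.

Let cphi1 n : {in `]a n, b n[, continuous (derive1 phi)}.
Proof.
move=> x xn; rewrite /prop_for /continuous_at (@dphiE n)//.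
have : dphi y @[y --> x] --> dphi x.
  by apply: cdphi; apply: (@exhausts_sub _ _ _ n _ exI); exact: subset_itv_oo_cc.
apply: cvg_trans; apply: near_eq_cvg; near=> y.
by apply/esym/(@dphiE n); near: y; exact: near_in.
Unshelve. all: end_near. Qed.

Let cphil n : cvg (derive1 phi x @[x --> (a n)^'+]).
Proof.
have [_ _ ab _] := exI.
apply/cvg_ex; exists (dphi (a n)).
have : dphi y @[y --> (a n)^'+] --> dphi (a n) by apply: cvg_at_right_filter; exact: cdphi.
apply: cvg_trans; apply: near_eq_cvg; near=> y.
apply/esym/(@dphiE n); rewrite in_itv/=; apply/andP; split; near: y.
  exact: nbhs_right_gt.
exact: nbhs_right_lt.
Unshelve. all: end_near. Qed.

Let cphir n : cvg (derive1 phi x @[x --> (b n)^'-]).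
Proof.
have [_ _ ab _] := exI.
apply/cvg_ex; exists (dphi (b n)).
have : dphi y @[y --> (b n)^'-] --> dphi (b n) by apply: cvg_at_left_filter; exact: cdphi.
apply: cvg_trans; apply: near_eq_cvg; near=> y.
apply/esym/(@dphiE n); rewrite in_itv/=; apply/andP; split; near: y.
  exact: nbhs_left_gt.
exact: nbhs_left_lt.
Unshelve. all: end_near. Qed.

Let LRphi n : derivable_oo_LRcontinuous phi (a n) (b n).
Proof.
split.
- move=> x xn; apply: ex_derive; apply: dphiP.
  by apply: (@exhausts_sub _ _ _ n _ exI); exact: subset_itv_oo_cc.
- by apply: cvg_at_right_filter; exact: cphi.
- by apply: cvg_at_left_filter; exact: cphi.
Qed.

Let subI n x : x \in `[a n, b n] -> I x.
Proof. exact: exhausts_sub exI. Qed.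

(** Positive and negative parts reduce the general case to nonnegative
    integrands, for which monotone convergence applies. *)
Let signed_change (w : R -> R) :
  (forall G, (forall y, J y -> {for y, continuous G}) ->
     (forall y, J y -> 0 <= G y) ->
     (\int[mu]_(y in J) (G y)%:E = \int[mu]_(x in I) (G (phi x) * w x)%:E)%E) ->
  (forall x, I x -> 0 <= w x) -> (forall x, I x -> {for x, continuous w}) ->
  measurable J ->
  forall G, (forall y, J y -> {for y, continuous G}) ->
  (\int[mu]_(y in J) (G y)%:E = \int[mu]_(x in I) (G (phi x) * w x)%:E)%E /\
  (measurable_fun J G -> L1 mu J G <-> L1 mu I (fun x => G (phi x) * w x)).
Proof.
move=> ge0 w0 cw mJ G cG.
have cnorm (H : R -> R) y : {for y, continuous H} -> {for y, continuous (fun z => `|H z|)}.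
  by move=> cH; apply: cvg_norm.
split.
  pose P (s : R) y : R := (`|G y| + s * G y) / 2.
  have cP s y : J y -> {for y, continuous (P s)}.
    move=> Jy; apply: cvgM; last exact: cvg_cst.
    apply: cvgD; first by apply: cnorm; exact: cG.
    by apply: cvgM; [exact: cvg_cst|exact: cG].
  have P0 s y : `|s| = 1 -> 0 <= P s y.
    move=> s1; rewrite divr_ge0//.
    have : - (s * G y) <= `|G y| by rewrite -[leRHS]mul1r -s1 -normrM -normrN ler_norm.
    by lra.
  have maxE (r : R) : maxe r%:E 0%E = ((`|r| + r) / 2)%:E.
    rewrite /maxe lte_fin; case: ltP => h.
      by rewrite ltr0_norm// addNr mul0r.
    by rewrite ger0_norm//; congr EFin; field.
  rewrite integralE [RHS]integralE; congr (_ - _)%E.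
  - transitivity (\int[mu]_(y in J) (P 1 y)%:E)%E; first apply: eq_integral.
      by move=> y _; rewrite funeposE maxE /P mul1r.
    rewrite ge0//; [|exact: cP|by move=> y _; rewrite P0 ?normr1].
    apply: eq_integral => x; rewrite inE => Ix.
    by rewrite funeposE maxE normrM (ger0_norm (w0 _ Ix)) /P; congr EFin; ring.
  - transitivity (\int[mu]_(y in J) (P (-1) y)%:E)%E; first apply: eq_integral.
      by move=> y _; rewrite funenegE -EFinN maxE normrN /P mulN1r.
    rewrite ge0//; [|exact: cP|by move=> y _; rewrite P0 ?normrN1].
    apply: eq_integral => x; rewrite inE => Ix.
    by rewrite funenegE -EFinN maxE normrN normrM (ger0_norm (w0 _ Ix)) /P; congr EFin; ring.
move=> mG.
have mGw : measurable_fun I (fun x => G (phi x) * w x).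
  apply: (continuous_exhausts_measurable exI) => x Ix; apply: cvgM; last exact: cw.
  apply: continuous_comp; first exact: cphi.
  by apply: cG; exact: phiJ.
have E : (\int[mu]_(y in J) `|G y|%:E = \int[mu]_(x in I) `|G (phi x) * w x|%:E)%E.
  have := ge0 (fun y => `|G y|); rewrite /= => ->//; last first.
    by move=> y Jy; apply: cnorm; exact: cG.
  apply: eq_integral => x; rewrite inE => Ix.
  by rewrite normrM [in RHS](ger0_norm (w0 _ Ix)).
split=> /integrableP[m1 m2]; apply/integrableP; split; try exact/measurable_EFinP.
  have m3 : (\int[mu]_(y in J) `|G y|%:E < +oo)%E := m2.
  by rewrite E in m3; exact: m3.
have m3 : (\int[mu]_(x in I) `|G (phi x) * w x|%:E < +oo)%E := m2.
by rewrite -E in m3; exact: m3.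
Qed.

Section Increasing.
Hypothesis dphi_sg : forall x, I x -> 0 < dphi x.

Let mon x y : I x -> I y -> x < y -> phi x < phi y.
Proof.
move=> Ix Iy xy.
have sub z : z \in `[x, y] -> I z.
  rewrite in_itv/= => zxy; apply: (@interval_is_interval _ i x y) => //.
have [||z zxy E] := @MVT _ phi dphi x y xy.
- by move=> z zxy; apply: dphiP; apply: sub; exact: subset_itv_oo_cc.
- by apply: continuous_itv_within => z /sub; exact: cphi.
rewrite -subr_gt0 E mulr_gt0 ?subr_gt0//.
by apply: dphi_sg; apply: sub; exact: subset_itv_oo_cc.
Qed.

Let exJ : exhausts J (phi \o a) (phi \o b).
Proof.
have [na nb ab IE] := exI.
have le x y : I x -> I y -> x <= y -> phi x <= phi y.
  by move=> Ix Iy; rewrite le_eqVlt => /predU1P[->//|]; move/(mon Ix Iy)/ltW.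
split.
- by move=> n m nm /=; apply: le => //; exact: na.
- by move=> n m nm /=; apply: le => //; exact: nb.
- by move=> n /=; apply: mon.
- apply/seteqP; split=> y.
  + move=> Jy; have := psiI Jy; rewrite IE => -[n _] /= h; exists n => //=.
    have h' := subI h; move: h; rewrite !in_itv/= => /andP[h1 h2].
    by rewrite -(psiK Jy) !le.
  + move=> [n _] /=; rewrite in_itv/= => h.
    by apply: (@interval_is_interval _ j (phi (a n)) (phi (b n))) => //; exact: phiJ.
Qed.

Let ge0_change G : (forall y, J y -> {for y, continuous G}) ->
  (forall y, J y -> 0 <= G y) ->
  (\int[mu]_(y in J) (G y)%:E = \int[mu]_(x in I) (G (phi x) * (dphi x))%:E)%E.
Proof.
move=> cG G0; have [_ _ ab _] := exI.
have h1 := ge0_integral_exhausts exJ (continuous_exhausts_measurable exJ cG) G0.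
apply: (cvg_unique _ h1) => //.
have -> : (fun n => \int[mu]_(x in `[(phi \o a) n, (phi \o b) n]) (G x)%:E)%E =
    (fun n => \int[mu]_(x in `[a n, b n]) (G (phi x) * (dphi x))%:E)%E.
  apply/funext => n.
  rewrite (@integration_by_substitution_increasing _ phi G (a n) (b n))//; last 3 first.
  - exact/ltW.
  - by move=> x y /subI Ix /subI Iy; exact: mon.
  - by apply: continuous_itv_within => y /(exhausts_sub exJ); exact: cG.
  apply: eq_integral => x; rewrite inE => /subI Ix.
  by rewrite !fctE derive1E (@derive_val _ _ _ _ _ _ _ (dphiP Ix)).
apply: (ge0_integral_exhausts exI) => [|x Ix].
  apply: (continuous_exhausts_measurable exI) => x Ix; apply: cvgM.
    by apply: continuous_comp; [exact: cphi|apply: cG; exact: phiJ].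
  by exact: cdphi.
by rewrite mulr_ge0 ?G0//; [exact: phiJ|exact/ltW/dphi_sg].
Qed.

Lemma increasing_change_of_variables G : (forall y, J y -> {for y, continuous G}) ->
  (\int[mu]_(y in J) (G y)%:E = \int[mu]_(x in I) (G (phi x) * (dphi x))%:E)%E /\
  (L1 mu J G <-> L1 mu I (fun x => G (phi x) * (dphi x))).
Proof.
move=> cG; have [] := @signed_change (fun x => dphi x) ge0_change _ _ _ G cG.
- by move=> x /dphi_sg; rewrite ?oppr_ge0; exact: ltW.
- by move=> x Ix; exact: cdphi.
- exact: exhausts_measurable exJ.
by move=> E h; split=> //; apply: h; exact: continuous_exhausts_measurable exJ cG.
Qed.

End Increasing.

Section Decreasing.
Hypothesis dphi_sg : forall x, I x -> dphi x < 0.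

Let mon x y : I x -> I y -> x < y -> phi y < phi x.
Proof.
move=> Ix Iy xy.
have sub z : z \in `[x, y] -> I z.
  rewrite in_itv/= => zxy; apply: (@interval_is_interval _ i x y) => //.
have [||z zxy E] := @MVT _ phi dphi x y xy.
- by move=> z zxy; apply: dphiP; apply: sub; exact: subset_itv_oo_cc.
- by apply: continuous_itv_within => z /sub; exact: cphi.
rewrite -subr_lt0 E pmulr_llt0 ?subr_gt0//.
by apply: dphi_sg; apply: sub; exact: subset_itv_oo_cc.
Qed.

Let exJ : exhausts J (phi \o b) (phi \o a).
Proof.
have [na nb ab IE] := exI.
have le x y : I x -> I y -> x <= y -> phi y <= phi x.
  by move=> Ix Iy; rewrite le_eqVlt => /predU1P[->//|]; move/(mon Ix Iy)/ltW.
split.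
- by move=> n m nm /=; apply: le => //; exact: nb.
- by move=> n m nm /=; apply: le => //; exact: na.
- by move=> n /=; apply: mon.
- apply/seteqP; split=> y.
  + move=> Jy; have := psiI Jy; rewrite IE => -[n _] /= h; exists n => //=.
    have h' := subI h; move: h; rewrite !in_itv/= => /andP[h1 h2].
    by rewrite -(psiK Jy) !le.
  + move=> [n _] /=; rewrite in_itv/= => h.
    by apply: (@interval_is_interval _ j (phi (b n)) (phi (a n))) => //; exact: phiJ.
Qed.

Let ge0_change G : (forall y, J y -> {for y, continuous G}) ->
  (forall y, J y -> 0 <= G y) ->
  (\int[mu]_(y in J) (G y)%:E = \int[mu]_(x in I) (G (phi x) * (- dphi x))%:E)%E.
Proof.
move=> cG G0; have [_ _ ab _] := exI.
have h1 := ge0_integral_exhausts exJ (continuous_exhausts_measurable exJ cG) G0.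
apply: (cvg_unique _ h1) => //.
have -> : (fun n => \int[mu]_(x in `[(phi \o b) n, (phi \o a) n]) (G x)%:E)%E =
    (fun n => \int[mu]_(x in `[a n, b n]) (G (phi x) * (- dphi x))%:E)%E.
  apply/funext => n.
  rewrite (@integration_by_substitution_decreasing _ phi G (a n) (b n))//; last 3 first.
  - exact/ltW.
  - by move=> x y /subI Ix /subI Iy; exact: mon.
  - by apply: continuous_itv_within => y /(exhausts_sub exJ); exact: cG.
  apply: eq_integral => x; rewrite inE => /subI Ix.
  by rewrite !fctE derive1E (@derive_val _ _ _ _ _ _ _ (dphiP Ix)).
apply: (ge0_integral_exhausts exI) => [|x Ix].
  apply: (continuous_exhausts_measurable exI) => x Ix; apply: cvgM.
    by apply: continuous_comp; [exact: cphi|apply: cG; exact: phiJ].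
  by apply: cvgN; exact: cdphi.
by rewrite mulr_ge0 ?G0//; [exact: phiJ|rewrite oppr_ge0; exact/ltW/dphi_sg].
Qed.

Lemma decreasing_change_of_variables G : (forall y, J y -> {for y, continuous G}) ->
  (\int[mu]_(y in J) (G y)%:E = \int[mu]_(x in I) (G (phi x) * (- dphi x))%:E)%E /\
  (L1 mu J G <-> L1 mu I (fun x => G (phi x) * (- dphi x))).
Proof.
move=> cG; have [] := @signed_change (fun x => - dphi x) ge0_change _ _ _ G cG.
- by move=> x /dphi_sg; rewrite ?oppr_ge0; exact: ltW.
- by move=> x Ix; apply: cvgN; exact: cdphi.
- exact: exhausts_measurable exJ.
by move=> E h; split=> //; apply: h; exact: continuous_exhausts_measurable exJ cG.
Qed.

End Decreasing.

End ChangeOfVariables.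

End OpenIntervals.

(** * Derivatives, continuity and measurability of elementary expressions *)

Section Calculus.
Variable R : realType.
Implicit Types (f g : R -> R) (x a b : R).

Lemma der_eq f x a b : is_derive x 1 f a -> a = b -> is_derive x 1 f b.
Proof. by move=> ? <-. Qed.
Lemma der_cst x c : is_derive x 1 (fun=> c : R) 0.
Proof. exact: is_derive_cst. Qed.
Lemma der_id x : is_derive x 1 (fun y : R => y) 1.
Proof. exact: is_derive_id. Qed.
Lemma derD f g x a b : is_derive x 1 f a -> is_derive x 1 g b ->
  is_derive x 1 (fun y => f y + g y) (a + b).
Proof. by move=> ? ?; exact: is_deriveD. Qed.
Lemma derN f x a : is_derive x 1 f a -> is_derive x 1 (fun y => - f y) (- a).
Proof. by move=> ?; exact: is_deriveN. Qed.
Lemma derM f g x a b : is_derive x 1 f a -> is_derive x 1 g b ->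
  is_derive x 1 (fun y => f y * g y) (a * g x + f x * b).
Proof.
move=> da db; apply: (der_eq (is_deriveM da db)).
by rewrite /GRing.scale/= addrC; congr (_ + _); rewrite mulrC.
Qed.
Lemma derX f n x a : is_derive x 1 f a ->
  is_derive x 1 (fun y => f y ^+ n) (n%:R * f x ^+ n.-1 * a).
Proof.
move=> da; rewrite (_ : (fun y => f y ^+ n) = f ^+ n); last first.
  by apply/funext => y; rewrite exprfctE.
exact: (der_eq (is_deriveX n da)).
Qed.
Lemma derV f x a : f x != 0 -> is_derive x 1 f a ->
  is_derive x 1 (fun y => (f y)^-1) (- (f x) ^- 2 * a).
Proof. by move=> f0 da; apply: (der_eq (is_deriveV f0 da)). Qed.
Lemma der_comp (h : R -> R) f x a b : is_derive (f x) 1 h b -> is_derive x 1 f a ->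
  is_derive x 1 (fun y => h (f y)) (b * a).
Proof. by move=> dh df; exact: (@is_derive1_comp _ h f). Qed.
Lemma der_expR f x a : is_derive x 1 f a ->
  is_derive x 1 (fun y => expR (f y)) (expR (f x) * a).
Proof. by apply: der_comp. Qed.
Lemma der_sin f x a : is_derive x 1 f a ->
  is_derive x 1 (fun y => sin (f y)) (cos (f x) * a).
Proof. by apply: der_comp. Qed.
Lemma der_cos f x a : is_derive x 1 f a ->
  is_derive x 1 (fun y => cos (f y)) (- sin (f x) * a).
Proof. by apply: der_comp. Qed.
Lemma der_atan f x a : is_derive x 1 f a ->
  is_derive x 1 (fun y => atan (f y)) ((1 + f x ^+ 2)^-1 * a).
Proof. by apply: der_comp. Qed.
Lemma der_ln f x a : 0 < f x -> is_derive x 1 f a ->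
  is_derive x 1 (fun y => ln (f y)) ((f x)^-1 * a).
Proof. by move=> f0; apply: der_comp; exact: is_derive1_ln. Qed.
Lemma der_powR f p x a : 0 < f x -> is_derive x 1 f a ->
  is_derive x 1 (fun y => f y `^ p) (p * f x `^ (p - 1) * a).
Proof. by move=> f0; apply: (@der_comp (fun z => z `^ p)); exact: is_derive1_powR. Qed.

Lemma der_continuous f x a : is_derive x 1 f a -> {for x, continuous f}.
Proof.
move=> df; apply: differentiable_continuous; apply/derivable1_diffP.
exact: ex_derive.
Qed.

Lemma contD f g x : {for x, continuous f} -> {for x, continuous g} ->
  {for x, continuous (fun y => f y + g y)}.
Proof. by move=> cf cg; exact: cvgD. Qed.
Lemma contN f x : {for x, continuous f} -> {for x, continuous (fun y => - f y)}.
Proof. by move=> cf; exact: cvgN. Qed.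
Lemma contM f g x : {for x, continuous f} -> {for x, continuous g} ->
  {for x, continuous (fun y => f y * g y)}.
Proof. by move=> cf cg; exact: cvgM. Qed.
Lemma contV f x : f x != 0 -> {for x, continuous f} ->
  {for x, continuous (fun y => (f y)^-1)}.
Proof. by move=> f0 cf; exact: cvgV. Qed.
Lemma contX f n x : {for x, continuous f} ->
  {for x, continuous (fun y => f y ^+ n)}.
Proof. by move=> cf; apply: (@continuous_comp _ _ _ f (fun z => z ^+ n)) => //; exact: exprn_continuous. Qed.
Lemma cont_cst x c : {for x, continuous (fun=> c : R)}.
Proof. exact: cvg_cst. Qed.
Lemma cont_id x : {for x, continuous (fun y : R => y)}.
Proof. exact: cvg_id. Qed.
Lemma cont_comp (h : R -> R) f x : {for f x, continuous h} -> {for x, continuous f} ->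
  {for x, continuous (fun y => h (f y))}.
Proof. by move=> ch cf; exact: continuous_comp. Qed.
Lemma cont_norm f x : {for x, continuous f} -> {for x, continuous (fun y => `|f y|)}.
Proof. by move=> cf; exact: cvg_norm. Qed.
Lemma cont_expR f x : {for x, continuous f} -> {for x, continuous (fun y => expR (f y))}.
Proof. by apply: cont_comp; exact: continuous_expR. Qed.
Lemma cont_sin f x : {for x, continuous f} -> {for x, continuous (fun y => sin (f y))}.
Proof. by apply: cont_comp; exact: continuous_sin. Qed.
Lemma cont_cos f x : {for x, continuous f} -> {for x, continuous (fun y => cos (f y))}.
Proof. by apply: cont_comp; exact: continuous_cos. Qed.
Lemma cont_atan f x : {for x, continuous f} -> {for x, continuous (fun y => atan (f y))}.
Proof. by apply: cont_comp; exact: continuous_atan. Qed.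
Lemma cont_ln f x : 0 < f x -> {for x, continuous f} -> {for x, continuous (fun y => ln (f y))}.
Proof. by move=> f0; apply: cont_comp; exact: continuous_ln. Qed.
Lemma cont_powR f p x : 0 < f x -> {for x, continuous f} ->
  {for x, continuous (fun y => f y `^ p)}.
Proof.
move=> f0; apply: (@cont_comp (fun z => z `^ p)).
exact: der_continuous (is_derive1_powR p f0).
Qed.

Lemma der_cvg_right f x a : is_derive x 1 f a -> f y @[y --> x^'+] --> f x.
Proof. by move=> /der_continuous cf; exact: cvg_at_right_filter. Qed.
Lemma der_cvg_left f x a : is_derive x 1 f a -> f y @[y --> x^'-] --> f x.
Proof. by move=> /der_continuous cf; exact: cvg_at_left_filter. Qed.

Lemma cvg_expRN b : 0 < b -> expR (- (b * x)) @[x --> +oo] --> (0 : R).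
Proof.
move=> b0; apply: (@cvg_comp _ _ _ (fun x => b * x) (fun x => expR (- x)) +oo +oo).
  by apply: gt0_cvgMry => //; exact: cvg_id.
exact: cvgr_expR.
Qed.

Lemma cvg_to0 (T : Type) (F : set_system T) (FF : Filter F) (f g : T -> R) :
  (\forall x \near F, `|f x| <= g x) -> g x @[x --> F] --> 0 -> f x @[x --> F] --> 0.
Proof.
move=> fg g0; apply: norm_cvg0; apply: (squeeze_cvgr _ (cvg_cst 0) g0).
by apply: filterS fg => x fgx /=; apply/andP; split; first exact: normr_ge0.
Qed.

Lemma cvg_inv_y : x^-1 @[x --> +oo] --> (0 : R).
Proof.
apply/cvgrPdist_le => e e0; near=> x.
have x0 : 0 < x by near: x; exact: nbhs_pinfty_gt.
rewrite sub0r normrN ger0_norm ?invr_ge0 ?ltW//.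
suff : e^-1 < x by move=> h; rewrite -[e]invrK ltf_pV2// posrE invr_gt0.
by near: x; apply: nbhs_pinfty_gt; exact: num_real.
Unshelve. all: end_near. Qed.

End Calculus.

Ltac eta_goal := lazymatch goal with
  | |- is_derive _ _ (fun _ => _) _ => idtac
  | |- is_derive ?x ?v ?f ?a => change (is_derive x v (fun y => f y) a)
  | |- measurable_fun _ (fun _ => _) => idtac
  | |- measurable_fun ?D ?f => change (measurable_fun D (fun y => f y))
  | |- prop_for ?x (inPhantom (continuous (fun _ => _))) => idtac
  | |- prop_for ?pt (inPhantom (continuous ?f)) =>
      change {for pt, continuous (fun y => f y)}
  | _ => idtac
  end.

(** Differentiation, continuity and measurability are proved by recursion on
    the syntax of the body of the function. [der] leaves the positivity and
    nonvanishing conditions, then the comparison of the derivative found with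
    the derivative claimed; it closes subterms with derivatives taken from the
    context. *)
Ltac der_rec := eta_goal; lazymatch goal with
  | |- is_derive _ _ (fun y => y) _ => eapply der_id
  | |- is_derive _ _ (fun _ => ?c) _ => eapply der_cst
  | |- is_derive _ _ (fun y => @?f y + @?g y) _ => eapply derD; der_rec
  | |- is_derive _ _ (fun y => - @?f y) _ => eapply derN; der_rec
  | |- is_derive _ _ (fun y => @?f y * @?g y) _ => eapply derM; der_rec
  | |- is_derive _ _ (fun y => @?f y ^+ _) _ => eapply derX; der_rec
  | |- is_derive _ _ (fun y => (@?f y)^-1) _ => eapply derV; [ | der_rec]
  | |- is_derive _ _ (fun y => expR (@?f y)) _ => eapply der_expR; der_rec
  | |- is_derive _ _ (fun y => sin (@?f y)) _ => eapply der_sin; der_rec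
  | |- is_derive _ _ (fun y => cos (@?f y)) _ => eapply der_cos; der_rec
  | |- is_derive _ _ (fun y => atan (@?f y)) _ => eapply der_atan; der_rec
  | |- is_derive _ _ (fun y => ln (@?f y)) _ => eapply der_ln; [ | der_rec]
  | |- is_derive _ _ (fun y => powR (@?f y) _) _ => eapply der_powR; [ | der_rec]
  | _ => eassumption
  end.

Ltac der := eapply der_eq; [der_rec | ]; cbv beta.

Ltac cont := eta_goal; lazymatch goal with
  | |- context [continuous (fun y => y)] => apply: cont_id
  | |- context [continuous (fun _ => ?c)] => apply: cont_cst
  | |- context [continuous (fun y => @?f y + @?g y)] => apply: contD; cont
  | |- context [continuous (fun y => - @?f y)] => apply: contN; cont
  | |- context [continuous (fun y => @?f y * @?g y)] => apply: contM; cont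
  | |- context [continuous (fun y => @?f y ^+ _)] => apply: contX; cont
  | |- context [continuous (fun y => (@?f y)^-1)] => apply: contV; [ | cont]
  | |- context [continuous (fun y => `|@?f y|)] => apply: cont_norm; cont
  | |- context [continuous (fun y => expR (@?f y))] => apply: cont_expR; cont
  | |- context [continuous (fun y => sin (@?f y))] => apply: cont_sin; cont
  | |- context [continuous (fun y => cos (@?f y))] => apply: cont_cos; cont
  | |- context [continuous (fun y => atan (@?f y))] => apply: cont_atan; cont
  | |- context [continuous (fun y => ln (@?f y))] => apply: cont_ln; [ | cont]
  | |- context [continuous (fun y => powR (@?f y) _)] => apply: cont_powR; [ | cont]
  | _ => try assumption
  end.

Section Measurability.
Context d (T : measurableType d) (R : realType) (D : set T).
Implicit Types (f g : T -> R).

Lemma meas_comp (h : R -> R) f : measurable_fun setT h -> measurable_fun D f ->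
  measurable_fun D (fun x => h (f x)).
Proof. by move=> mh mf; exact: measurableT_comp. Qed.
Lemma measD f g : measurable_fun D f -> measurable_fun D g ->
  measurable_fun D (fun x => f x + g x).
Proof. exact: measurable_funD. Qed.
Lemma measN f : measurable_fun D f -> measurable_fun D (fun x => - f x).
Proof. by move=> mf; exact: measurable_funN. Qed.
Lemma measM f g : measurable_fun D f -> measurable_fun D g ->
  measurable_fun D (fun x => f x * g x).
Proof. exact: measurable_funM. Qed.
Lemma measX f n : measurable_fun D f -> measurable_fun D (fun x => f x ^+ n).
Proof. exact: measurable_funX. Qed.
Lemma meas_norm f : measurable_fun D f -> measurable_fun D (fun x => `|f x|).
Proof. by apply: meas_comp; exact: normr_measurable. Qed.
Lemma meas_expR f : measurable_fun D f -> measurable_fun D (fun x => expR (f x)).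
Proof. by apply: meas_comp; exact: measurable_expR. Qed.
Lemma meas_ln f : measurable_fun D f -> measurable_fun D (fun x => ln (f x)).
Proof. by apply: meas_comp; exact: measurable_ln. Qed.
Lemma meas_sin f : measurable_fun D f -> measurable_fun D (fun x => sin (f x)).
Proof. by apply: meas_comp; exact: continuous_measurable_fun (@continuous_sin R). Qed.
Lemma meas_cos f : measurable_fun D f -> measurable_fun D (fun x => cos (f x)).
Proof. by apply: meas_comp; exact: continuous_measurable_fun (@continuous_cos R). Qed.
Lemma meas_atan f : measurable_fun D f -> measurable_fun D (fun x => atan (f x)).
Proof.
by apply: meas_comp; apply: continuous_measurable_fun => x; exact: continuous_atan.
Qed.
Lemma meas_powR f p : measurable_fun D f -> measurable_fun D (fun x => f x `^ p).
Proof. by apply: (@meas_comp (fun z => z `^ p)); exact: measurable_powR. Qed.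
Lemma measV f : measurable_fun D f -> measurable_fun D (fun x => (f x)^-1).
Proof.
(* the inverse is read off the real power of a square, whose measurability is known *)
apply: (@meas_comp (fun z => z^-1)).
have -> : (fun z : R => z^-1) = (fun z => z * (z ^+ 2) `^ (-1)).
  apply/funext => z; rewrite powR_inv1 ?sqr_ge0//.
  have [->|z0] := eqVneq z 0; first by rewrite invr0 mul0r.
  by rewrite expr2 invfM mulrA divff// mul1r.
apply: measurable_funM => //.
by apply: (measurableT_comp (measurable_powR (-1))); exact: exprn_measurable.
Qed.
Lemma meas_cst (c : R) : measurable_fun D (fun=> c).
Proof. exact: measurable_cst. Qed.
End Measurability.

Section PairMeasurability.
Context d d1 d2 (T : measurableType d) (T1 : measurableType d1)
  (T2 : measurableType d2) (D : set T).
Lemma meas_fst (f : T -> T1 * T2) : measurable_fun D f ->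
  measurable_fun D (fun x => (f x).1).
Proof. by move=> mf; exact: (measurableT_comp measurable_fst mf). Qed.
Lemma meas_snd (f : T -> T1 * T2) : measurable_fun D f ->
  measurable_fun D (fun x => (f x).2).
Proof. by move=> mf; exact: (measurableT_comp measurable_snd mf). Qed.
End PairMeasurability.

Ltac meas := eta_goal; lazymatch goal with
  | |- measurable_fun _ (fun y => y) => apply: measurable_id
  | |- measurable_fun _ (fun _ => ?c) => apply: meas_cst
  | |- measurable_fun _ (fun y => (@?f y).1) => apply: meas_fst; meas
  | |- measurable_fun _ (fun y => (@?f y).2) => apply: meas_snd; meas
  | |- measurable_fun _ (fun y => @?f y + @?g y) => apply: measD; meas
  | |- measurable_fun _ (fun y => - @?f y) => apply: measN; meas
  | |- measurable_fun _ (fun y => @?f y * @?g y) => apply: measM; meas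
  | |- measurable_fun _ (fun y => @?f y ^+ _) => apply: measX; meas
  | |- measurable_fun _ (fun y => (@?f y)^-1) => apply: measV; meas
  | |- measurable_fun _ (fun y => `|@?f y|) => apply: meas_norm; meas
  | |- measurable_fun _ (fun y => expR (@?f y)) => apply: meas_expR; meas
  | |- measurable_fun _ (fun y => sin (@?f y)) => apply: meas_sin; meas
  | |- measurable_fun _ (fun y => cos (@?f y)) => apply: meas_cos; meas
  | |- measurable_fun _ (fun y => atan (@?f y)) => apply: meas_atan; meas
  | |- measurable_fun _ (fun y => ln (@?f y)) => apply: meas_ln; meas
  | |- measurable_fun _ (fun y => powR (@?f y) _) => apply: meas_powR; meas
  | |- measurable_fun _ (fun y => ?h (@?f y)) =>
      first [eassumption | apply: (@meas_comp _ _ _ _ h f); [try eassumption | meas] | idtac]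
  | _ => try eassumption
  end.

(** * Elementary integrals *)

Section ElementaryIntegrals.
Variable R : realType.
Notation mu := (@lebesgue_measure R).

Lemma int_expRN (b : R) : 0 < b ->
  L1 mu `]0, +oo[ (fun x => expR (- (b * x))) /\
  \int[mu]_(x in `]0, +oo[) expR (- (b * x)) = b^-1.
Proof.
move=> b0; have d (x : R) : is_derive x 1 (fun x => - b^-1 * expR (- (b * x))) (expR (- (b * x))).
  by der; field; rewrite gt_eqF.
have [||||i ->] := @ge0_FTC_oy R 0 _ _ (- b^-1) 0 _ (fun x _ => d x).
- by move=> x _; cont.
- by move=> x _; exact: expR_ge0.
- by have := der_cvg_right (d 0); rewrite mulr0 oppr0 expR0 mulr1.
- rewrite -[X in _ --> X](mulr0 (- b^-1)).
  by apply: cvgM; [exact: cvg_cst|exact: cvg_expRN].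
by rewrite sub0r opprK.
Qed.

Lemma int_expRN_cos (b a : R) : 0 < b ->
  \int[mu]_(x in `]0, +oo[) (expR (- (b * x)) * cos (a * x)) = b / (b ^+ 2 + a ^+ 2).
Proof.
move=> b0.
have q0 : 0 < b ^+ 2 + a ^+ 2 by rewrite ltr_pwDl ?sqr_ge0// exprn_gt0.
pose F x := expR (- (b * x)) * (a * sin (a * x) - b * cos (a * x)) / (b ^+ 2 + a ^+ 2).
have d (x : R) : is_derive x 1 F (expR (- (b * x)) * cos (a * x)).
  by rewrite /F; der; field; rewrite gt_eqF.
rewrite (@FTC_oy R 0 _ F (- (b / (b ^+ 2 + a ^+ 2))) 0 _ (fun x _ => d x)).
- by rewrite sub0r opprK.
- by move=> x _; cont.
- apply: dominated_L1 (int_expRN b0).1 _ => //; first by meas.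
  move=> x _; rewrite normrM ger0_norm ?expR_ge0// ler_piMr ?expR_ge0//.
  by rewrite ler_norml cos_geN1 cos_le1.
- have := der_cvg_right (d 0); rewrite {2}/F !mulr0 oppr0 expR0 sin0 cos0.
  by rewrite !mulr0 mul1r sub0r mulr1 mulNr.
- apply: (@cvg_to0 _ _ _ _ _ (fun x => (`|a| + b) / (b ^+ 2 + a ^+ 2) * expR (- (b * x)))).
    apply: nearW => x; rewrite /F normrM normfV (gtr0_norm q0) mulrAC ler_pM2r ?invr_gt0//.
    rewrite normrM (ger0_norm (expR_ge0 _)) mulrC ler_pM2r ?expR_gt0//.
    apply: (le_trans (ler_normB _ _)); rewrite !normrM (gtr0_norm b0).
    by apply: lerD; rewrite ler_piMr// ?(ltW b0)// ler_norml ?sin_geN1 ?sin_le1 ?cos_geN1 ?cos_le1.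
  rewrite -[X in _ --> X](mulr0 ((`|a| + b) / (b ^+ 2 + a ^+ 2))).
  by apply: cvgM; [exact: cvg_cst|exact: cvg_expRN].
Qed.

End ElementaryIntegrals.

(** * Substitutions *)
Section Substitutions.
Variable R : realType.
Notation mu := (@lebesgue_measure R).
Implicit Types (G : R -> R) (c u v x y : R).

Lemma scale_oy c u G : 0 < c -> (forall y, c * u < y -> {for y, continuous G}) ->
  (L1 mu `]c * u, +oo[ G <-> L1 mu `]u, +oo[ (fun x => G (c * x) * c)) /\
  \int[mu]_(y in `]c * u, +oo[) G y = \int[mu]_(x in `]u, +oo[) (G (c * x) * c).
Proof.
move=> c0 cG.
have dP x : x \in `]u, +oo[ -> is_derive x 1 (fun x => c * x) c by move=> _; der; ring.
have [||||||E H] := @increasing_change_of_variables R `]u, +oo[ `]c * u, +oo[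
   _ _ (fun x => c * x) (fun=> c) (fun y => c^-1 * y) (exhausts_oy u) _ _ _ dP _ _ G _.
- by move=> x; rewrite /= !in_itv/= !andbT ltr_pM2l.
- by move=> y; rewrite /= !in_itv/= !andbT => h; rewrite mulrC ltr_pdivlMr// mulrC.
- by move=> y _; rewrite mulrA divff ?mul1r// gt_eqF.
- by move=> x _; cont.
- by move=> x _.
- by move=> y; rewrite /= in_itv/= andbT; exact: cG.
- by split=> //; congr fine.
Qed.

Lemma scale_0o c v G : 0 < c -> 0 < v -> (forall y, 0 < y < c * v -> {for y, continuous G}) ->
  (L1 mu `]0, c * v[ G <-> L1 mu `]0, v[ (fun x => G (c * x) * c)) /\
  \int[mu]_(y in `]0, c * v[) G y = \int[mu]_(x in `]0, v[) (G (c * x) * c).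
Proof.
move=> c0 v0 cG.
have dP x : x \in `]0, v[ -> is_derive x 1 (fun x => c * x) c by move=> _; der; ring.
have [||||||E H] := @increasing_change_of_variables R `]0, v[ `]0, c * v[
   _ _ (fun x => c * x) (fun=> c) (fun y => c^-1 * y) (exhausts_oo v0) _ _ _ dP _ _ G _.
- by move=> x; rewrite /= !in_itv/= => /andP[x0 xv]; rewrite mulr_gt0// ltr_pM2l.
- move=> y; rewrite /= !in_itv/= => /andP[y0 yv].
  by rewrite mulr_gt0 ?invr_gt0//= mulrC ltr_pdivrMr// mulrC.
- by move=> y _; rewrite mulrA divff ?mul1r// gt_eqF.
- by move=> x _; cont.
- by move=> x _.
- by move=> y; rewrite /= in_itv/=; exact: cG.
- by split=> //; congr fine.
Qed.

Lemma inversion_01 G : (forall y, 0 < y < 1 -> {for y, continuous G}) ->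
  (L1 mu `]0, 1[ G <-> L1 mu `]1, +oo[ (fun x => G x^-1 * x ^- 2)) /\
  \int[mu]_(y in `]0, 1[) G y = \int[mu]_(x in `]1, +oo[) (G x^-1 * x ^- 2).
Proof.
move=> cG.
have gt1 x : x \in `]1, +oo[ -> 1 < x by rewrite in_itv/= andbT.
have gt0 x : x \in `]1, +oo[ -> 0 < x by move/gt1; apply: lt_trans.
have dP x : x \in `]1, +oo[ -> is_derive x 1 (fun x => x^-1) (- x ^- 2).
  by move=> /gt0 x0; der; [rewrite gt_eqF|rewrite mulr1].
have [||||||E H] := @decreasing_change_of_variables R `]1, +oo[ `]0, 1[
   _ _ (fun x => x^-1) (fun x => - x ^- 2) (fun x => x^-1) (exhausts_oy 1) _ _ _ dP _ _ G _.
- by move=> x h; rewrite /= in_itv/= invr_gt0 gt0//= invf_lt1 ?gt0// gt1.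
- by move=> y; rewrite /= !in_itv/= andbT => /andP[y0 y1]; rewrite -invf_lt1 ?invr_gt0// invrK.
- by move=> y _; rewrite invrK.
- by move=> x /gt0 x0; cont; rewrite expf_neq0// gt_eqF.
- by move=> x /gt0 x0; rewrite oppr_lt0 invr_gt0 exprn_gt0.
- by move=> y; rewrite /= in_itv/=; exact: cG.
have eqo (f g : R -> R) : f =1 g -> L1 mu `]1, +oo[ f <-> L1 mu `]1, +oo[ g.
  by move=> /funext ->.
split.
  by rewrite H; apply: eqo => x; rewrite opprK.
by rewrite /Rintegral E; congr fine; apply: eq_integral => x _; rewrite opprK.
Qed.

Lemma square_shift G : (forall y, 0 < y -> {for y, continuous G}) ->
  (L1 mu `]0, +oo[ G <-> L1 mu `]1, +oo[ (fun x => G (x ^+ 2 - 1) * (2 * x))) /\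
  \int[mu]_(y in `]0, +oo[) G y = \int[mu]_(x in `]1, +oo[) (G (x ^+ 2 - 1) * (2 * x)).
Proof.
move=> cG.
have gt1 x : x \in `]1, +oo[ -> 1 < x by rewrite in_itv/= andbT.
have gt0 x : x \in `]1, +oo[ -> 0 < x by move/gt1; apply: lt_trans.
have dP x : x \in `]1, +oo[ -> is_derive x 1 (fun x => x ^+ 2 - 1) (2 * x).
  by move=> _; der; rewrite /=; ring.
have [||||||E H] := @increasing_change_of_variables R `]1, +oo[ `]0, +oo[
   _ _ (fun x => x ^+ 2 - 1) (fun x => 2 * x) (fun y => Num.sqrt (1 + y)) (exhausts_oy 1) _ _ _ dP _ _ G _.
- by move=> x /gt1 x1; rewrite /= in_itv/= andbT subr_gt0 exprn_egt1.
- move=> y; rewrite /= !in_itv/= !andbT => y0.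
  by rewrite -[ltLHS]sqrtr1 ltr_sqrt ?ltrDl// addr_gt0.
- move=> y; rewrite /= in_itv/= andbT => y0.
  by rewrite sqr_sqrtr ?addr_ge0 ?ltW//; ring.
- by move=> x _; cont.
- by move=> x /gt0 x0; rewrite mulr_gt0.
- by move=> y; rewrite /= in_itv/= andbT; exact: cG.
by split=> //; congr fine.
Qed.

Lemma moebius G : (forall y, 1 < y -> {for y, continuous G}) ->
  (L1 mu `]1, +oo[ G <-> L1 mu `]0, 1[ (fun w => G ((1 + w) / (1 - w)) * (2 / (1 - w) ^+ 2))) /\
  \int[mu]_(y in `]1, +oo[) G y =
  \int[mu]_(w in `]0, 1[) (G ((1 + w) / (1 - w)) * (2 / (1 - w) ^+ 2)).
Proof.
move=> cG.
have dP x : x \in `]0, 1[ -> is_derive x 1 (fun w => (1 + w) / (1 - w)) (2 / (1 - x) ^+ 2).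
  rewrite in_itv/= => /andP[w0 w1].
  have h : 1 - x != 0 by rewrite gt_eqF// subr_gt0.
  by der; [exact: h|field].
have [||||||E H] := @increasing_change_of_variables R `]0, 1[ `]1, +oo[
   _ _ (fun w => (1 + w) / (1 - w)) (fun w => 2 / (1 - w) ^+ 2)
   (fun y => (y - 1) / (y + 1)) (exhausts_oo ltr01) _ _ _ dP _ _ G _.
- move=> w; rewrite /= !in_itv/= andbT => /andP[w0 w1].
  by rewrite ltr_pdivlMr ?mul1r; lra.
- move=> y; rewrite /= !in_itv/= andbT => y1.
  have h : 0 < y + 1 by lra.
  by rewrite divr_gt0 ?subr_gt0//= ltr_pdivrMr// mul1r; lra.
- move=> y; rewrite /= !in_itv/= andbT => y1.
  have h : y + 1 != 0 by rewrite gt_eqF//; lra.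
  by field; rewrite h /= gt_eqF//; lra.
- move=> w; rewrite /= !in_itv/= => /andP[w0 w1].
  by cont; rewrite expf_neq0// gt_eqF//; lra.
- move=> w; rewrite /= !in_itv/= => /andP[w0 w1].
  by rewrite divr_gt0// exprn_gt0//; lra.
- by move=> y; rewrite /= in_itv/= andbT; exact: cG.
by split=> //; congr fine.
Qed.

End Substitutions.

(** * The cardinal sine and the band kernel *)
(** [field] and [ring] unfold pi; it is replaced by a positive variable
    first. *)
Ltac genpi :=
  match goal with |- context [@pi ?R] =>
    move: (pi_gt0 R); generalize (@pi R) => p p_gt0 end.

Section Sinc.
Variable R : realType.
Notation mu := (@lebesgue_measure R).
Notation I01 := (`[0%R, 1%R]%classic : set R).
Implicit Types (a b u v x y z : R).

Lemma mean_value_bound (f df : R -> R) (K a b : R) : a <= b ->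
  (forall x, a <= x <= b -> is_derive x 1 f (df x)) ->
  (forall x, a <= x <= b -> `|df x| <= K) -> `|f b - f a| <= K * (b - a).
Proof.
move=> ab d K_.
have d' x : x \in `]a, b[%R -> is_derive x 1 f (df x).
  by move=> xab; apply: d; rewrite !(itvP xab).
have [|c cab ->] := @MVT_segment R f df a b ab d'.
- by apply: continuous_itv_within => x /=; rewrite in_itv/= => /d /der_continuous.
- by rewrite normrM (ger0_norm (_ : 0 <= b - a)) ?subr_ge0// ler_wpM2r ?subr_ge0// K_// !(itvP cab).
Qed.

Lemma cos_lipschitz a b : `|cos a - cos b| <= `|a - b|.
Proof.
wlog ab : a b / b <= a.
  by move=> H; have [/H//|/ltW/H] := leP b a; rewrite distrC [leRHS]distrC.
rewrite (ger0_norm (_ : 0 <= a - b)) ?subr_ge0// -[leRHS]mul1r.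
apply: (@mean_value_bound cos (fun x => - sin x)) => // x _.
by rewrite normrN ler_norml sin_geN1 sin_le1.
Qed.

Lemma norm_cos_le1 a : `|cos a| <= 1.
Proof. by rewrite ler_norml cos_geN1 cos_le1. Qed.

Lemma norm_sin_le1 a : `|sin a| <= 1.
Proof. by rewrite ler_norml sin_geN1 sin_le1. Qed.

Lemma cst_L1 (i : interval R) (K : R) : (mu [set` i] < +oo)%E -> L1 mu [set` i] (fun=> K).
Proof.
move=> fin; apply/integrableP; split; first exact/measurable_EFinP/measurable_cst.
under eq_integral do rewrite /=.
by rewrite integral_cst//= lte_mul_pinfty// lee_fin.
Qed.

Lemma bounded_L1_itv (i : interval R) (K : R) (f : R -> R) :
  (mu [set` i] < +oo)%E -> measurable_fun [set` i] f ->
  (forall x, x \in i -> `|f x| <= K) -> L1 mu [set` i] f.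
Proof.
move=> fin mf fK; apply: (@dominated_L1 _ _ _ mu [set` i] f (fun=> K)) => //.
exact: cst_L1.
Qed.

Lemma Rint_01_bound (f : R -> R) (K : R) : L1 mu I01 f ->
  (forall x, 0 <= x <= 1 -> `|f x| <= K) -> `|\int[mu]_(x in I01) f x| <= K.
Proof.
move=> fi fK; have -> : K = \int[mu]_(x in I01) K.
  by rewrite Rintegral_cst//= lebesgue_measure_itv/= lte_fin ltr01/= subr0 mulr1.
apply: le_trans (le_normr_Rintegral _ fi) _ => //.
apply: le_Rintegral => //.
- exact: integrable_abse fi.
- by apply: cst_L1; rewrite //= lebesgue_measure_itv/= lte_fin ltr01 ltry.
Qed.

Lemma L1_01 (K : R) (f : R -> R) : measurable_fun I01 f ->
  (forall x, 0 <= x <= 1 -> `|f x| <= K) -> L1 mu I01 f.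
Proof.
move=> mf fK; apply: (@bounded_L1_itv _ K) => //.
by rewrite /= lebesgue_measure_itv/= lte_fin ltr01/= ltry.
Qed.

Definition sinc u := \int[mu]_(z in I01) cos (2 * pi * u * z).

Lemma sinc_L1 u : L1 mu I01 (fun z => cos (2 * pi * u * z)).
Proof.
by apply: (@L1_01 1) => [|z _]; [meas|exact: norm_cos_le1].
Qed.

Lemma norm_sinc_le1 u : `|sinc u| <= 1.
Proof. by apply: Rint_01_bound => [|z _]; [exact: sinc_L1|exact: norm_cos_le1]. Qed.

Lemma sinc_lipschitz u v : `|sinc u - sinc v| <= 2 * pi * `|u - v|.
Proof.
rewrite /sinc -RintegralB//; [|exact: sinc_L1..].
apply: Rint_01_bound => [|z /andP[z0 z1]].
  by apply: L1B => //; exact: sinc_L1.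
apply: (le_trans (cos_lipschitz _ _)).
rewrite -mulrBl -mulrBr !normrM (ger0_norm z0) (ger0_norm (pi_ge0 R)) (ger0_norm (ler0n R 2)).
by rewrite ler_piMr// !mulr_ge0// pi_ge0.
Qed.

Lemma lipschitz_continuous (f : R -> R) (K x : R) :
  (forall y, `|f y - f x| <= K * `|y - x|) -> {for x, continuous f}.
Proof.
move=> lip; apply/subr_cvg0; apply: (@cvg_to0 _ _ _ _ _ (fun y => K * `|y - x|)).
  exact: nearW.
have : {for x, continuous (fun y => K * `|y - x|)} by cont.
by rewrite /prop_for /continuous_at subrr normr0 mulr0.
Qed.

Lemma sinc_continuous x : {for x, continuous sinc}.
Proof. by apply: lipschitz_continuous => y; exact: sinc_lipschitz. Qed.

(** The value sin (2 pi u) / (2 pi u), multiplied out so that it holds at u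
    = 0 as well. *)
Lemma sincE u : 2 * pi * u * sinc u = sin (2 * pi * u).
Proof.
have [->|u0] := eqVneq u 0; first by rewrite !(mulr0, mul0r) sin0.
have c0 : 2 * pi * u != 0 by rewrite !mulf_neq0// gt_eqF// pi_gt0.
have d (z : R) : z \in `[0, 1] -> is_derive z 1 (fun z => (2 * pi * u)^-1 * sin (2 * pi * u * z)) (cos (2 * pi * u * z)).
  by move=> _; der; genpi; field; rewrite u0 gt_eqF.
have c (z : R) : z \in `[0, 1] -> {for z, continuous (fun z => cos (2 * pi * u * z))}.
  by move=> _; cont.
have E := FTC_compact ltr01 c d.
by rewrite /sinc /Rintegral E /= mulr1 mulr0 sin0 mulr0 subr0 mulrA divff// mul1r.
Qed.

(** The exponent 3/4 interpolates between the bounds 1 and 1/(2 pi u), so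
    that the bound of sinc (a y) is integrable over 0 < y < 1 and still
    decays in a. *)
Lemma norm_sinc_powR u : 0 < u -> `|sinc u| <= (2 * pi * u) `^ (- (3 / 4)).
Proof.
move=> u0; have c0 : 0 < 2 * pi * u by rewrite !mulr_gt0// pi_gt0.
have [c1|/ltW c1] := leP (2 * pi * u) 1.
  apply: (le_trans (norm_sinc_le1 _)).
  rewrite powRN invf_ge1 ?powR_gt0// -[leRHS](powRr0 (2 * pi * u)).
  by apply: ger_powR; [rewrite c0|lra].
have -> : sinc u = sin (2 * pi * u) / (2 * pi * u).
  by rewrite -sincE mulrAC divff ?mul1r// gt_eqF.
rewrite normrM normfV (gtr0_norm c0).
apply: (@le_trans _ _ (2 * pi * u)^-1).
  by rewrite ler_piMl ?invr_ge0 ?(ltW c0)// norm_sin_le1.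
by rewrite -powR_inv1 ?(ltW c0)// ler_powR//; lra.
Qed.

Lemma meas_sinc (d : measure_display) (T : measurableType d) (D : set T) (f : T -> R) :
  measurable_fun D f -> measurable_fun D (fun t => sinc (f t)).
Proof. by apply: meas_comp; apply: continuous_measurable_fun => x; exact: sinc_continuous. Qed.

Lemma cont_sinc (f : R -> R) x : {for x, continuous f} ->
  {for x, continuous (fun y => sinc (f y))}.
Proof. by apply: cont_comp; exact: sinc_continuous. Qed.

(** The reproducing kernel of the even functions with Fourier transform
    supported in [-1, 1]. *)
Definition band_kernel x y := 2 * (sinc (x - y) + sinc (x + y)).

Lemma band_kernelE x y : band_kernel x y =
  \int[mu]_(z in I01) (2 * cos (2 * pi * x * z) * (2 * cos (2 * pi * y * z))).
Proof.
rewrite /band_kernel /sinc -RintegralD//; [|exact: sinc_L1..].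
rewrite -RintegralZl//; last by apply: L1D => //; exact: sinc_L1.
apply: eq_Rint => z _.
rewrite (_ : 2 * pi * (x - y) * z = 2 * pi * x * z - 2 * pi * y * z); last by ring.
rewrite (_ : 2 * pi * (x + y) * z = 2 * pi * x * z + 2 * pi * y * z); last by ring.
by rewrite cosB cosD; ring.
Qed.

Lemma band_kernelC x y : band_kernel x y = band_kernel y x.
Proof. by rewrite !band_kernelE; apply: eq_Rint => z _; rewrite mulrC. Qed.

Lemma band_kernel_le4 x y : `|band_kernel x y| <= 4.
Proof.
rewrite /band_kernel normrM (ger0_norm (ler0n R 2)).
have -> : 4 = 2 * 2 :> R by ring.
rewrite ler_pM2l//; apply: (le_trans (ler_normD _ _)).
by apply: lerD; exact: norm_sinc_le1.
Qed.

(** Exchange the integrals: the Laplace transform of cos (2 pi a z y) in y is a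
    Cauchy kernel in z, whose primitive is an arc tangent. *)
Lemma Laplace_sinc b a : 0 < b -> 0 < a ->
  \int[mu]_(y in `]0, +oo[) (expR (- (b * y)) * sinc (a * y)) =
  atan (2 * pi * a / b) / (2 * pi * a).
Proof.
move=> b0 a0; have c0 : 0 < 2 * pi * a by rewrite !mulr_gt0// pi_gt0.
have i1 : L1 mu I01 (fun=> 1 : R) by apply: (@L1_01 1) => [|z _]; [meas|rewrite normr1].
have [] := @dominated_Fubini _ _ _ _ R mu mu `]0%R, +oo[ I01
  (fun y z => expR (- (b * y)) * cos (2 * pi * (a * y) * z)) (fun y => expR (- (b * y))) (fun=> 1) _ _ _ (int_expRN b0).1 i1 _ => //.
- by apply: measurable_funTS; meas.
- move=> y z _ _; rewrite normrM (ger0_norm (expR_ge0 _)) mulr1 ler_piMr ?expR_ge0//.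
  exact: norm_cos_le1.
move=> _ _ _ E1 E2.
transitivity (\int[mu]_(y in `]0, +oo[) \int[mu]_(z in I01) (expR (- (b * y)) * cos (2 * pi * (a * y) * z))).
  by apply: eq_Rint => y _; rewrite RintegralZl//; exact: sinc_L1.
rewrite -E1 E2.
have -> : \int[mu]_(z in I01) \int[mu]_(y in `]0, +oo[) (expR (- (b * y)) * cos (2 * pi * (a * y) * z)) =
   \int[mu]_(z in I01) (b / (b ^+ 2 + (2 * pi * a * z) ^+ 2)).
  apply: eq_Rint => z _; rewrite -int_expRN_cos//; apply: eq_Rint => y _.
  by congr (_ * cos _); ring.
have q0 z : 0 < b ^+ 2 + (2 * pi * a * z) ^+ 2 by rewrite ltr_pwDl ?sqr_ge0// exprn_gt0.
have d (z : R) : z \in `[0, 1] -> is_derive z 1 (fun z => atan (2 * pi * a * z / b) / (2 * pi * a)) (b / (b ^+ 2 + (2 * pi * a * z) ^+ 2)).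
  move=> _; der.
  have h : 1 + (2 * pi * a * z / b) ^+ 2 != 0 by rewrite gt_eqF// ltr_pwDl ?sqr_ge0.
  by move: h (q0 z); genpi => h qz; field; rewrite (gt_eqF b0) (gt_eqF a0) (gt_eqF p_gt0) gt_eqF.
have c (z : R) : z \in `[0, 1] -> {for z, continuous (fun z => b / (b ^+ 2 + (2 * pi * a * z) ^+ 2))}.
  by move=> _; cont; rewrite gt_eqF.
have E := FTC_compact ltr01 c d.
by rewrite /Rintegral E /= mulr1 mulr0 mul0r atan0 mul0r subr0.
Qed.

End Sinc.

(** * Bessel's inequality for the band [-1, 1] *)
Section Bessel.
Variable R : realType.
Notation mu := (@lebesgue_measure R).
Notation mu2 := (mu \x mu)%E.
Notation I01 := (`[0%R, 1%R]%classic : set R).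
Notation Iy := (`]1%R, +oo[%classic : set R).
Implicit Types (x y z : R).

Lemma expRN_L1 (e : R) : 0 < e -> L1 mu Iy (fun x => expR (- (e * x))).
Proof.
move=> e0; apply: integrableS (int_expRN e0).1 => //.
by apply: subset_itvr; rewrite bnd_simp.
Qed.

Lemma inv_sqr_L1 : L1 mu Iy (fun y => y ^- 2).
Proof.
have d y : 1 < y -> is_derive y 1 (fun y => - y^-1) (y ^- 2).
  move=> y1; have y0 : y != 0 by rewrite gt_eqF// (lt_trans _ y1).
  by der; [exact: y0|rewrite mulr1 opprK].
have [] // := @ge0_FTC_oy R 1 _ _ (- 1) 0 _ d.
- by move=> x x1; cont; rewrite expf_neq0// gt_eqF// (lt_trans _ x1).
- by move=> x x1; rewrite invr_ge0 sqr_ge0.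
- have c : {for 1, continuous (fun y : R => - y^-1)} by cont; rewrite oner_neq0.
  by have := cvg_at_right_filter c; rewrite invr1.
- by rewrite -oppr0; apply: cvgN; exact: cvg_inv_y.
Qed.

Section Poisson.
Variables (eta : R) (eta0 : 0 < eta).
Definition cauchy_kernel (a : R) := eta / (eta ^+ 2 + (2 * pi * a) ^+ 2).
Definition poisson_kernel x y := 2 * (cauchy_kernel (x - y) + cauchy_kernel (x + y)).

Let den_gt0 (a : R) : 0 < eta ^+ 2 + (2 * pi * a) ^+ 2.
Proof. by rewrite ltr_pwDl ?sqr_ge0// exprn_gt0. Qed.

Lemma cauchy_kernel_ge0 a : 0 <= cauchy_kernel a.
Proof. by rewrite divr_ge0// ltW. Qed.

Lemma poisson_kernel_ge0 x y : 0 <= poisson_kernel x y.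
Proof. by rewrite mulr_ge0// addr_ge0// cauchy_kernel_ge0. Qed.

Lemma poisson_kernelC x y : poisson_kernel x y = poisson_kernel y x.
Proof.
rewrite /poisson_kernel (addrC x y); congr (_ * (_ + _)); rewrite /cauchy_kernel -(sqrrN (2 * pi * (y - x))).
by rewrite -mulrN opprB.
Qed.

(** The product of cosines is half the sum of the cosines of x - y and x +
    y. *)
Lemma Laplace_cosM x y :
  \int[mu]_(z in `]0, +oo[) (expR (- (eta * z)) *
    (2 * cos (2 * pi * x * z) * (2 * cos (2 * pi * y * z)))) = poisson_kernel x y.
Proof.
have i (a : R) : L1 mu `]0, +oo[ (fun z => expR (- (eta * z)) * cos (2 * pi * a * z)).
  apply: dominated_L1 (int_expRN eta0).1 _ => //; first by meas.
  move=> z _; rewrite normrM (ger0_norm (expR_ge0 _)) ler_piMr ?expR_ge0//.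
  exact: norm_cos_le1.
rewrite /poisson_kernel /cauchy_kernel -!int_expRN_cos// -RintegralD//; [|exact: i..].
rewrite -RintegralZl//; last by apply: L1D => //; exact: i.
apply: eq_Rint => z _.
rewrite (_ : 2 * pi * (x - y) * z = 2 * pi * x * z - 2 * pi * y * z); last by ring.
rewrite (_ : 2 * pi * (x + y) * z = 2 * pi * x * z + 2 * pi * y * z); last by ring.
by rewrite cosB cosD; ring.
Qed.

Definition poisson_const : R := 4 * (4 / eta + eta).

(** A bound by a product of functions of x and y, as required to integrate
    over pairs. If y > 2 x both arguments of the kernel are at least y/2 in
    size; if y <= 2 x the factor x^2 / y^2 is bounded below. *)
Lemma poisson_kernel_bound x y : 1 < x -> 1 < y -> poisson_kernel x y <= poisson_const * x ^+ 2 * y ^- 2.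
Proof.
move=> x1 y1; have y20 : 0 < y ^+ 2 by rewrite exprn_gt0// (lt_trans _ y1).
have pi1 : 1 <= pi :> R by rewrite (le_trans _ (pi_ge2 R))// ler1n.
have far a : y ^+ 2 <= (2 * pi * a) ^+ 2 -> cauchy_kernel a <= (4 / eta + eta) * x ^+ 2 * y ^- 2.
  move=> h; rewrite /cauchy_kernel ler_pdivrMr ?den_gt0// mulrAC ler_pdivlMr//.
  have : eta * y ^+ 2 <= eta * (eta ^+ 2 + (2 * pi * a) ^+ 2).
    by rewrite ler_pM2l// (le_trans h)// lerDr sqr_ge0.
  move/le_trans; apply.
  rewrite ler_pM2r ?den_gt0//.
  apply: (@le_trans _ _ (eta * x ^+ 2)).
    by rewrite ler_peMr ?(ltW eta0)// exprn_ege1// ltW.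
  by rewrite ler_wpM2r ?sqr_ge0// lerDr divr_ge0// ltW.
have near a : y <= 2 * x -> cauchy_kernel a <= (4 / eta + eta) * x ^+ 2 * y ^- 2.
  move=> h; apply: (@le_trans _ _ eta^-1).
    rewrite /cauchy_kernel ler_pdivrMr ?den_gt0//.
    have {1}-> : eta = eta^-1 * eta ^+ 2 by rewrite expr2 mulrA mulVf ?mul1r// gt_eqF.
    by rewrite ler_pM2l ?invr_gt0// lerDl sqr_ge0.
  rewrite ler_pdivlMr//.
  apply: (@le_trans _ _ (eta^-1 * (4 * x ^+ 2))).
    rewrite ler_pM2l ?invr_gt0//; have -> : 4 * x ^+ 2 = (2 * x) ^+ 2 by ring.
    by rewrite ler_sqr ?nnegrE//; lra.
  by rewrite mulrA ler_wpM2r ?sqr_ge0// mulrC lerDl ltW.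
have sq a : y <= 2 * a -> y ^+ 2 <= (2 * pi * a) ^+ 2.
  move=> h; rewrite ler_sqr ?nnegrE; first last.
  - by rewrite !mulr_ge0 ?pi_ge0//; lra.
  - by lra.
  apply: (le_trans h); rewrite mulrAC ler_peMr//; lra.
have sqN a : y <= - (2 * a) -> y ^+ 2 <= (2 * pi * a) ^+ 2.
  by move=> h; rewrite -(sqrrN (2 * pi * a)) -mulrN; apply: sq; rewrite mulrN.
have h2 : cauchy_kernel (x + y) <= (4 / eta + eta) * x ^+ 2 * y ^- 2 by apply: far; apply: sq; lra.
have h1 : cauchy_kernel (x - y) <= (4 / eta + eta) * x ^+ 2 * y ^- 2.
  have [h|h] := leP y (2 * x); first exact: near.
  by apply: far; apply: sqN; lra.
rewrite /poisson_kernel /poisson_const; apply: (le_trans (_ : _ <= 2 * ((4 / eta + eta) * x ^+ 2 * y ^- 2 + (4 / eta + eta) * x ^+ 2 * y ^- 2))).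
  by rewrite ler_pM2l// lerD.
by rewrite le_eqVlt; apply/orP; left; apply/eqP; ring.
Qed.

(** The total mass of the Poisson kernel on the half line is at most that on
    the line, that is 1. *)
Lemma poisson_kernel_mass x : 1 < x -> L1 mu Iy (poisson_kernel x) /\ \int[mu]_(y in Iy) poisson_kernel x y <= 1.
Proof.
move=> x1.
pose F y := pi^-1 * (atan (2 * pi * (y - x) / eta) + atan (2 * pi * (y + x) / eta)).
have p0 : pi != 0 :> R by rewrite gt_eqF// pi_gt0.
have d y : 1 < y -> is_derive y 1 F (poisson_kernel x y).
  move=> y1; rewrite /F; der; rewrite /poisson_kernel /cauchy_kernel.
  have := den_gt0 (x - y); have := den_gt0 (x + y).
  have : 0 < 1 + (2 * pi * (y - x) / eta) ^+ 2 by rewrite ltr_pwDl ?sqr_ge0.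
  have : 0 < 1 + (2 * pi * (y + x) / eta) ^+ 2 by rewrite ltr_pwDl ?sqr_ge0.
  genpi => h1 h2 h3 h4; field.
  by rewrite (gt_eqF eta0) (gt_eqF p_gt0) !gt_eqF//=; nra.
have lin c : 2 * pi * (y + c) / eta @[y --> +oo] --> +oo.
  apply: gt0_cvgMly; first by rewrite invr_gt0.
  apply: gt0_cvgMry; first by rewrite mulr_gt0// pi_gt0.
  by apply: cvg_addrr.
have [||||i E] := @ge0_FTC_oy R 1 _ _ (F 1) 1 _ d.
- by move=> y _; rewrite /poisson_kernel /cauchy_kernel; cont; rewrite gt_eqF.
- by move=> y _; exact: poisson_kernel_ge0.
- have c : {for 1, continuous F} by rewrite /F; cont.
  exact: cvg_at_right_filter c.
- have -> : 1 = pi^-1 * (pi / 2 + pi / 2) :> R by rewrite -splitr mulVf.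
  apply: cvgM; first exact: cvg_cst.
  by apply: cvgD; apply: (cvg_comp _ _ (lin _)); exact: cvgy_atan.
split=> //; rewrite E gerBl /F mulr_ge0 ?invr_ge0 ?pi_ge0//.
rewrite -opprB mulrN mulNr atanN addrC subr_ge0 le_atan// ler_pM2r ?invr_gt0//.
by rewrite ler_pM2l ?mulr_gt0 ?pi_gt0//; lra.
Qed.

End Poisson.

Section BandEnergy.
Variables (xi : R -> R) (M e : R).
Hypotheses (M0 : 0 <= M) (e0 : 0 < e) (mxi : measurable_fun setT xi).
Hypothesis xiM : forall x, 1 < x -> `|xi x| <= M * expR (- (e * x)).
Notation D2 := (Iy `*` Iy).

Let mD2 : measurable D2.
Proof. exact: measurableX. Qed.

Let Iy1 x : Iy x -> 1 < x.
Proof. by rewrite /= in_itv/= andbT. Qed.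

Let cc (p : R * R) z := 2 * cos (2 * pi * p.1 * z) * (2 * cos (2 * pi * p.2 * z)).

Let cc_le4 p z : `|cc p z| <= 4.
Proof.
rewrite /cc mulrACA normrM (_ : 2 * 2 = 4 :> R); last by ring.
by rewrite ger0_norm// ler_piMr// normrM mulr_ile1// norm_cos_le1.
Qed.

Let bound (p : R * R) := (M * expR (- (e * p.1))) * (M * expR (- (e * p.2))).

Let bound_L1 : L1 mu2 D2 bound.
Proof.
have i : L1 mu Iy (fun x => M * expR (- (e * x))) by apply: L1Z => //; exact: expRN_L1.
have [] := @dominated_Fubini _ _ _ _ R mu mu Iy Iy
  (fun x y => (M * expR (- (e * x))) * (M * expR (- (e * y)))) _ _ _ _ _ i i _ => //.
- by apply: measurable_funTS; meas.
- by move=> x y _ _; rewrite ger0_norm// !mulr_ge0// expR_ge0.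
Qed.

Let xi2_bound p : D2 p -> `|xi p.1 * xi p.2| <= bound p.
Proof.
move=> [/Iy1 p1 /Iy1 p2]; rewrite normrM /bound.
by apply: ler_pM => //; exact: xiM.
Qed.

Let energy z := \int[mu2]_(p in D2) (xi p.1 * xi p.2 * cc p z).

Let integrand_L1 z : L1 mu2 D2 (fun p => xi p.1 * xi p.2 * cc p z).
Proof.
apply: (@dominated_L1 _ _ _ mu2 D2 _ (fun p => 4 * bound p)) => //.
- by apply: measurable_funTS; rewrite /cc; meas.
- by apply: L1Z.
- move=> p Dp; rewrite normrM mulrC.
  by apply: ler_pM => //; first [exact: cc_le4|exact: xi2_bound].
Qed.

(** A double integral that separates into a square. *)
Let energy_ge0 z : 0 <= energy z.
Proof.
have i : L1 mu Iy (fun x => 2 * (M * expR (- (e * x)))).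
  by do 2! apply: L1Z => //; exact: expRN_L1.
have b x : 1 < x -> `|xi x * (2 * cos (2 * pi * x * z))| <= 2 * (M * expR (- (e * x))).
  move=> x1; rewrite normrM mulrC; apply: ler_pM => //; last exact: xiM.
  by rewrite normrM (ger0_norm (ler0n R 2)) ler_piMr// norm_cos_le1.
have j : L1 mu Iy (fun x => xi x * (2 * cos (2 * pi * x * z))).
  apply: dominated_L1 i _ => //; first by apply: measurable_funTS; meas.
  by move=> x /Iy1; exact: b.
have [] := @dominated_Fubini _ _ _ _ R mu mu Iy Iy
  (fun x y => (xi x * (2 * cos (2 * pi * x * z))) * (xi y * (2 * cos (2 * pi * y * z)))) _ _ _ _ _ i i _ => //.
- by apply: measurable_funTS; meas.
- by move=> x y /Iy1 x1 /Iy1 y1; rewrite normrM; apply: ler_pM => //; exact: b.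
move=> _ _ _ E _.
have -> : energy z = (\int[mu]_(x in Iy) (xi x * (2 * cos (2 * pi * x * z)))) ^+ 2.
  rewrite /energy; under eq_Rintegral do rewrite /cc mulrACA.
  rewrite E expr2 -RintegralZr//; apply: eq_Rint => x _.
  by rewrite RintegralZl.
exact: sqr_ge0.
Qed.

(** Exchanging the integral over the frequency z with the double integral
    turns a weight on frequencies into a kernel on pairs. *)
Lemma weighted_band_energy (Z : set R) (w : R -> R) : measurable Z ->
  measurable_fun setT w -> (forall z, Z z -> 0 <= w z) -> L1 mu Z w ->
  [/\ L1 mu Z (fun z => w z * energy z),
      L1 mu2 D2 (fun p => xi p.1 * xi p.2 * \int[mu]_(z in Z) (w z * cc p z)) &
      \int[mu]_(z in Z) (w z * energy z) =
      \int[mu2]_(p in D2) (xi p.1 * xi p.2 * \int[mu]_(z in Z) (w z * cc p z))].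
Proof.
move=> mZ mw w0 wi.
have i : L1 mu2 D2 (fun p => 4 * bound p) by apply: L1Z.
have [] := @dominated_Fubini _ _ _ _ R mu (product_sigma_finite mu mu) Z D2
  (fun z p => w z * (xi p.1 * xi p.2 * cc p z)) _ _ _ _ _ wi i _ => //.
- by apply: measurable_funTS; rewrite /cc; meas.
- move=> z p Zz Dp; rewrite normrM (ger0_norm (w0 _ Zz)) ler_wpM2l ?w0//.
  by rewrite normrM mulrC; apply: ler_pM => //; first [exact: cc_le4|exact: xi2_bound].
have E1 z : Z z -> \int[mu2]_(p in D2) (w z * (xi p.1 * xi p.2 * cc p z)) = w z * energy z.
  by move=> Zz; rewrite RintegralZl.
have E2 p : D2 p -> \int[mu]_(z in Z) (w z * (xi p.1 * xi p.2 * cc p z)) =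
    xi p.1 * xi p.2 * \int[mu]_(z in Z) (w z * cc p z).
  move=> Dp; rewrite -RintegralZl//; first by apply: eq_Rint => z _; rewrite mulrCA.
  apply: (@dominated_L1 _ _ _ mu Z _ (fun z => 4 * w z)) => //.
  - by apply: measurable_funTS; rewrite /cc; meas.
  - exact: L1Z.
  - by move=> z Zz; rewrite normrM mulrC (ger0_norm (w0 _ Zz)) ler_wpM2r ?w0// cc_le4.
move=> _ a1 a2 F1 F2; split.
- have a1' : L1 mu Z (fun z => \int[mu2]_(p in D2) (w z * (xi p.1 * xi p.2 * cc p z))) := a1.
  exact: (@eq_L1 _ _ _ mu Z _ _ mZ E1 a1').
- exact: (@eq_L1 _ _ _ mu2 D2 _ _ mD2 E2 a2).
- rewrite -(eq_Rint mu E1) -(eq_Rint mu2 E2); exact: etrans (esym F1) F2.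
Qed.

Let xi_sqr_L1 : L1 mu Iy (fun x => xi x ^+ 2).
Proof.
have i : L1 mu Iy (fun x => M ^+ 2 * expR (- (2 * e * x))).
  by apply: L1Z => //; apply: expRN_L1; rewrite mulr_gt0.
apply: dominated_L1 i _ => //; first by apply: measurable_funTS; meas.
move=> x /Iy1 x1; rewrite normrX.
rewrite (_ : M ^+ 2 * _ = (M * expR (- (e * x))) ^+ 2); last first.
  rewrite exprMn -expRM_natl; congr (_ * expR _); ring.
by rewrite ler_sqr ?nnegrE ?mulr_ge0 ?expR_ge0// xiM.
Qed.

Let xi_sqr_poisson eta : 0 < eta ->
  [/\ L1 mu2 D2 (fun p => xi p.1 ^+ 2 * poisson_kernel eta p.1 p.2),
      L1 mu2 D2 (fun p => xi p.2 ^+ 2 * poisson_kernel eta p.1 p.2),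
      \int[mu2]_(p in D2) (xi p.1 ^+ 2 * poisson_kernel eta p.1 p.2) <=
        \int[mu]_(x in Iy) xi x ^+ 2 &
      \int[mu2]_(p in D2) (xi p.2 ^+ 2 * poisson_kernel eta p.1 p.2) <=
        \int[mu]_(x in Iy) xi x ^+ 2].
Proof.
move=> eta0.
have c0 : 0 <= poisson_const eta by rewrite mulr_ge0// addr_ge0 ?divr_ge0// ltW.
have iu : L1 mu Iy (fun x => M ^+ 2 * (4 / e ^+ 2) * expR (- (e * x))).
  by apply: L1Z => //; exact: expRN_L1.
have iv : L1 mu Iy (fun y => poisson_const eta * y ^- 2) by apply: L1Z => //; exact: inv_sqr_L1.
have mP : measurable_fun setT (fun p : R * R => poisson_kernel eta p.1 p.2).
  by rewrite /poisson_kernel /cauchy_kernel; meas.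
have mP' : measurable_fun setT (fun p : R * R => poisson_kernel eta p.2 p.1).
  by rewrite /poisson_kernel /cauchy_kernel; meas.
have bnd x y : Iy x -> Iy y -> `|xi x ^+ 2 * poisson_kernel eta x y| <=
    M ^+ 2 * (4 / e ^+ 2) * expR (- (e * x)) * (poisson_const eta * y ^- 2).
  move=> /Iy1 x1 /Iy1 y1; have x0 : 0 < x by rewrite (lt_trans _ x1).
  rewrite ger0_norm; last by apply: mulr_ge0; [exact: sqr_ge0|exact: poisson_kernel_ge0].
  apply: (@le_trans _ _ ((M * expR (- (e * x))) ^+ 2 * (poisson_const eta * x ^+ 2 * y ^- 2))).
    apply: ler_pM; rewrite ?sqr_ge0 ?poisson_kernel_ge0//.
    - by rewrite -[leLHS]real_normK ?num_real// ler_sqr ?nnegrE ?mulr_ge0 ?expR_ge0// xiM.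
    - exact: poisson_kernel_bound.
  have h : (e * x) ^+ 2 <= 4 * expR (e * x).
    have : (e * x / 2) ^+ 2 <= expR (e * x / 2) ^+ 2.
      rewrite ler_sqr ?nnegrE ?expR_ge0 ?divr_ge0 ?mulr_ge0 ?(ltW e0) ?(ltW x0)//.
      by rewrite (le_trans _ (expR_ge1Dx _))// lerDr.
    rewrite -expRM_natl (_ : 2%:R * (e * x / 2) = e * x); last by field.
    have e4 : 2 ^+ 2 = 4 :> R by rewrite -natrX.
    by rewrite expr_div_n e4 ler_pdivrMr// [_ * 4]mulrC.
  have h2 : x ^+ 2 * expR (- (e * x)) <= 4 / e ^+ 2.
    rewrite expRN ler_pdivrMr ?expR_gt0// mulrAC ler_pdivlMr ?exprn_gt0//.
    by rewrite mulrC -exprMn.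
  move: h2; set E := expR _; set q := 4 / e ^+ 2 => h2.
  have -> : (M * E) ^+ 2 * (poisson_const eta * x ^+ 2 / y ^+ 2) =
    M ^+ 2 * (x ^+ 2 * E * (E * (poisson_const eta / y ^+ 2))) by ring.
  have -> : M ^+ 2 * q * E * (poisson_const eta / y ^+ 2) =
    M ^+ 2 * (q * (E * (poisson_const eta / y ^+ 2))) by ring.
  rewrite ler_wpM2l ?sqr_ge0// ler_wpM2r//.
  by rewrite mulr_ge0 ?expR_ge0// mulr_ge0// invr_ge0 sqr_ge0.
have [|||a1 a2 _ a4 _] := @dominated_Fubini _ _ _ _ R mu mu Iy Iy
  (fun x y => xi x ^+ 2 * poisson_kernel eta x y) _ _ _ _ _ iu iv bnd => //.
  by apply: measurable_funTS; meas.
have [||||b1 _ _ _ b4] := @dominated_Fubini _ _ _ _ R mu mu Iy Iy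
  (fun x y => xi y ^+ 2 * poisson_kernel eta x y) _ _ _ _ _ iv iu _ => //.
- by apply: measurable_funTS; meas.
- by move=> x y Dx Dy; rewrite poisson_kernelC [leRHS]mulrC; exact: bnd.
have le1 : \int[mu]_(x in Iy) \int[mu]_(y in Iy) (xi x ^+ 2 * poisson_kernel eta x y) <=
   \int[mu]_(x in Iy) xi x ^+ 2.
  apply: le_Rintegral => // x /Iy1 x1.
  have [i le1] := poisson_kernel_mass eta0 x1.
  by rewrite RintegralZl// ler_piMr// sqr_ge0.
split => //.
- by rewrite a4.
- rewrite b4; apply: le_trans le1; rewrite le_eqVlt; apply/orP; left; apply/eqP.
  apply: (@eq_Rint _ _ _ mu) => x _; apply: (@eq_Rint _ _ _ mu) => y _.
  by rewrite poisson_kernelC.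
Qed.

(** Schur test: the Poisson kernel is nonnegative, symmetric and of mass at
    most one. *)
Lemma weighted_energy_le eta : 0 < eta ->
  \int[mu]_(z in `]0, +oo[) (expR (- (eta * z)) * energy z) <=
  \int[mu]_(x in Iy) xi x ^+ 2.
Proof.
move=> eta0.
have [||||_ i ->] := @weighted_band_energy `]0, +oo[ (fun z => expR (- (eta * z))) => //.
- by meas.
- exact: (int_expRN eta0).1.
have [i1 i2 h1 h2] := xi_sqr_poisson eta0.
have E p : D2 p -> xi p.1 * xi p.2 * \int[mu]_(z in `]0, +oo[) (expR (- (eta * z)) * cc p z) =
    xi p.1 * xi p.2 * poisson_kernel eta p.1 p.2 by move=> _; rewrite Laplace_cosM.
rewrite (eq_Rint mu2 E); have {}i := @eq_L1 _ _ _ mu2 D2 _ _ mD2 E i.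
apply: (@le_trans _ _ (\int[mu2]_(p in D2) (2^-1 * (xi p.1 ^+ 2 * poisson_kernel eta p.1 p.2) +
   2^-1 * (xi p.2 ^+ 2 * poisson_kernel eta p.1 p.2)))).
  apply: le_Rintegral => //.
  - by apply: L1D => //; apply: L1Z.
  (* a b <= (a^2 + b^2) / 2, so that only the mass of the kernel matters *)
  - move=> p _; move: (poisson_kernel_ge0 eta0 p.1 p.2).
    set k := poisson_kernel _ _ _; move: (xi p.1) (xi p.2) => a b k0.
    rewrite -subr_ge0.
    have -> : 2^-1 * (a ^+ 2 * k) + 2^-1 * (b ^+ 2 * k) - a * b * k =
      2^-1 * ((a - b) ^+ 2 * k) by field.
    by rewrite mulr_ge0// mulr_ge0// sqr_ge0.
rewrite RintegralD//; [|exact: L1Z..].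
by rewrite !RintegralZl//; lra.
Qed.

(** Bessel's inequality for the orthogonal projection onto the band [-1, 1]:
    the energy of the even extension of xi inside the band is at most its total
    energy. The band indicator is dominated by exponential weights, whose
    kernels are Poisson kernels of mass at most one. *)
Lemma band_energy_le :
  L1 mu2 D2 (fun p => xi p.1 * xi p.2 * band_kernel p.1 p.2) /\
  \int[mu2]_(p in D2) (xi p.1 * xi p.2 * band_kernel p.1 p.2) <=
  \int[mu]_(x in Iy) xi x ^+ 2.
Proof.
have i01 : L1 mu I01 (fun=> 1 : R) by apply: (@L1_01 _ 1) => [|z _]; [meas|rewrite normr1].
have [||||j i EB] := @weighted_band_energy I01 (fun=> 1) => //.
have E p : D2 p -> xi p.1 * xi p.2 * \int[mu]_(z in I01) (1 * cc p z) =
    xi p.1 * xi p.2 * band_kernel p.1 p.2.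
  by move=> _; rewrite band_kernelE; congr (_ * _); apply: eq_Rint => z _; rewrite mul1r.
rewrite -(eq_Rint mu2 E); split; first exact: (@eq_L1 _ _ _ mu2 D2 _ _ mD2 E i).
rewrite -EB; set B := Rintegral _ _ _; set S := Rintegral _ _ _.
have B0 : 0 <= B by apply: Rintegral_ge0 => z _; rewrite mul1r.
have key eta : 0 < eta -> expR (- eta) * B <= S.
  move=> eta0; apply: le_trans (weighted_energy_le eta0).
  have [||||k _ _] := @weighted_band_energy `]0, +oo[ (fun z => expR (- (eta * z))) => //.
  - by meas.
  - exact: (int_expRN eta0).1.
  have k1 : L1 mu `]0, 1] (fun z => expR (- (eta * z)) * energy z).
    apply: integrableS k => //; apply: subset_itvl; by rewrite bnd_simp.
  have j1 : L1 mu `]0, 1] (fun z => 1 * energy z).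
    by apply: integrableS j => //; apply: subset_itvr; rewrite bnd_simp.
  have := @Rintegral_itvB R _ (BRight 0) +oo%O 1 k.
  rewrite bnd_simp ler01 => /(_ isT isT) EE.
  have : 0 <= \int[mu]_(x in `]1, +oo[) (expR (- (eta * x)) * energy x).
    by apply: Rintegral_ge0 => z _; rewrite mulr_ge0 ?expR_ge0.
  rewrite -EE subr_ge0; apply: le_trans.
  rewrite /B -Rintegral_itv_obnd_cbnd// -RintegralZl//.
  apply: le_Rintegral => //; first exact: L1Z.
  move=> z /=; rewrite in_itv/= => /andP[z0 z1]; rewrite mul1r ler_wpM2r// ler_expR lerN2.
  by rewrite ler_piMr// ltW.
(* let eta tend to 0, made quantitative: e^(-eta) >= 1 - eta, and this eta makes
   (1 - eta) B the midpoint of S and B *)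
rewrite leNgt; apply/negP => SB.
have S0 : 0 <= S by apply: Rintegral_ge0 => z _; rewrite sqr_ge0.
have B1 : 0 < B by exact: le_lt_trans SB.
pose eta := (B - S) / (2 * B).
have eta0 : 0 < eta by rewrite divr_gt0 ?subr_gt0// mulr_gt0.
have := key _ eta0; apply/negP; rewrite -ltNge.
apply: (@lt_le_trans _ _ ((1 - eta) * B)); last first.
  by rewrite ler_wpM2r// expR_ge1Dx.
rewrite (_ : (1 - eta) * B = (B + S) / 2); first by lra.
by rewrite /eta; field; rewrite gt_eqF.
Qed.

End BandEnergy.
End Bessel.

(** * The quadratic form in the coordinate x / y *)
Section Folding.
Variable R : realType.
Notation mu := (@lebesgue_measure R).
Notation mu2 := (mu \x mu)%E.
Notation I01 := (`[0%R, 1%R]%classic : set R).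
Notation Iy := (`]1%R, +oo[%classic : set R).
Notation D2 := (Iy `*` Iy).
Implicit Types (x y z r : R).

Lemma Iy_gt1 x : Iy x -> 1 < x.
Proof. by rewrite /= in_itv/= andbT. Qed.

Lemma meas_ler : measurable_fun setT (fun p : R * R => ((p.1 <= p.2)%R%:R : R)).
Proof.
have -> : (fun p : R * R => ((p.1 <= p.2)%R%:R : R)) = (fun p => if (p.1 <= p.2)%R then 1 else 0).
  by apply/funext => p; case: ifP.
by apply: measurable_fun_ifT => //; apply: measurable_fun_ler; meas.
Qed.

Variables (F : R -> R) (M e : R).
Hypotheses (M0 : 0 <= M) (e0 : 0 < e) (mF : measurable_fun setT F).
Hypothesis FM : forall x, 0 < x -> `|F x| <= M.
Hypothesis Fsym : forall x, 0 < x -> F x^-1 = F x.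
Hypothesis Fcont : forall x, 0 < x -> {for x, continuous F}.

(** The exponential makes all the integrals converge, and is removed at the
    end; x^(-1/2) is the square root of the density of the Haar measure. *)
Definition cutoff x := x `^ (- 2^-1) * expR (- (e * x)).

Definition cutoff_kernel x y := cutoff x * cutoff y * F (x / y) * band_kernel x y.

Definition radial_kernel r := \int[mu]_(y in Iy) (expR (- (e * (r + 1) * y)) * band_kernel (r * y) y).

Let bnd x := 2 * (M + 1) * expR (- (e * x)).

Let bnd_L1 : L1 mu Iy bnd.
Proof. by apply: L1Z => //; exact: expRN_L1. Qed.

Lemma cutoff_ge0 x : 0 <= cutoff x.
Proof. by rewrite mulr_ge0 ?powR_ge0 ?expR_ge0. Qed.

Lemma cutoff_le x : 1 < x -> cutoff x <= expR (- (e * x)).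
Proof.
move=> x1; rewrite /cutoff -[leRHS]mul1r ler_wpM2r ?expR_ge0//.
by rewrite -[leRHS](powRr0 x) ler_powR ?(ltW x1)// oppr_le0.
Qed.

Let M_le : M <= (M + 1) ^+ 2.
Proof.
rewrite -subr_ge0 (_ : _ - M = M ^+ 2 + M + 1); last by ring.
by rewrite !addr_ge0 ?sqr_ge0.
Qed.

Let kernel_bound x y : Iy x -> Iy y -> `|cutoff_kernel x y| <= bnd x * bnd y.
Proof.
move=> /Iy_gt1 x1 /Iy_gt1 y1.
have x0 : 0 < x by rewrite (lt_trans _ x1).
have y0 : 0 < y by rewrite (lt_trans _ y1).
rewrite /cutoff_kernel 3!normrM (ger0_norm (cutoff_ge0 x)) (ger0_norm (cutoff_ge0 y)).
have hF : `|F (x / y)| <= (M + 1) ^+ 2.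
  by apply: (le_trans (FM _)); [rewrite divr_gt0|exact: M_le].
rewrite /bnd (_ : 2 * _ * _ * (2 * _ * _) = expR (- (e * x)) * expR (- (e * y)) * ((M + 1) ^+ 2) * 4); last by ring.
move: (cutoff_ge0 x) (cutoff_le x1) (cutoff_ge0 y) (cutoff_le y1).
move: (cutoff x) (cutoff y) => a b a0 ha b0 hb.
do 2 (apply: ler_pM; rewrite ?mulr_ge0 ?band_kernel_le4//).
exact: ler_pM.
Qed.

Lemma meas_kernel : measurable_fun setT (fun p : R * R => cutoff_kernel p.1 p.2).
Proof.
rewrite /cutoff_kernel /cutoff /band_kernel.
have ms : measurable_fun setT (@sinc R).
  by apply: continuous_measurable_fun => x; exact: sinc_continuous.
by meas.
Qed.

Let kernelC x y : 0 < x -> 0 < y -> cutoff_kernel x y = cutoff_kernel y x.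
Proof.
move=> x0 y0; rewrite /cutoff_kernel band_kernelC -(Fsym (divr_gt0 x0 y0)).
by rewrite invf_div (mulrC (cutoff x)).
Qed.

Let scaled_kernel x y : 1 < x -> 1 < y ->
  cutoff_kernel (x * y) y * y =
  F x * x `^ (- 2^-1) * (expR (- (e * (x + 1) * y)) * band_kernel (x * y) y).
Proof.
move=> x1 y1; have x0 : 0 < x by rewrite (lt_trans _ x1).
have y0 : 0 < y by rewrite (lt_trans _ y1).
rewrite /cutoff_kernel mulfK ?gt_eqF// /cutoff powRM ?(ltW x0) ?(ltW y0)//.
rewrite (_ : e * (x + 1) * y = e * (x * y) + e * y); last by ring.
rewrite opprD expRD.
have : y `^ (- 2^-1) * y `^ (- 2^-1) * y = 1.
  rewrite powRN powR12_sqrt ?(ltW y0)// -invfM -expr2 sqr_sqrtr ?(ltW y0)//.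
  by rewrite mulVf// gt_eqF.
move: (y `^ _) (x `^ _) (expR _) (expR _) (F x) (band_kernel _ _) => a b c d f g h.
transitivity (f * b * (c * d * g) * (a * a * y)); first by ring.
by rewrite h mulr1 (mulrC c).
Qed.

(** The half x > y of the domain; the other half gives the same by the
    symmetry of the kernel. *)
Let upper y := \int[mu]_(x in `]y, +oo[) cutoff_kernel x y.

Let upperE y : 1 < y -> upper y =
  \int[mu]_(r in Iy) (F r * r `^ (- 2^-1) * (expR (- (e * (r + 1) * y)) * band_kernel (r * y) y)).
Proof.
move=> y1; have y0 : 0 < y by rewrite (lt_trans _ y1).
have cont_k x : y * 1 < x -> {for x, continuous (cutoff_kernel ^~ y)}.
  rewrite mulr1 => yx; have x0 : 0 < x by rewrite (lt_trans _ yx).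
  rewrite /cutoff_kernel /cutoff /band_kernel.
  apply: contM; last first.
    by apply: contM; [exact: cont_cst|apply: contD; apply: cont_sinc; cont].
  apply: contM; first by cont.
  apply: (@cont_comp _ F); last by cont.
  by apply: Fcont; rewrite divr_gt0.
have [_ E] := scale_oy y0 cont_k.
rewrite /upper -{1}(mulr1 y) E; apply: eq_Rint => r /Iy_gt1 r1.
by rewrite (mulrC y r) scaled_kernel.
Qed.

Let upper_lt y : 1 < y ->
  \int[mu]_(x in Iy) (cutoff_kernel x y * (y < x)%R%:R) = upper y.
Proof.
move=> y1; rewrite /upper.
rewrite (_ : `]y, +oo[%classic = Iy `&` `]y, +oo[%classic); last first.
  by rewrite setIidr//; apply: subset_itvr; rewrite bnd_simp ltW.
rewrite Rintegral_mkcondr; apply: eq_Rint => x _; rewrite patchE mem_setE in_itv/= andbT.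
by case: ifP => _; rewrite ?mulr1 ?mulr0.
Qed.

Let upper_le y : 1 < y ->
  \int[mu]_(x in Iy) (cutoff_kernel x y * (y <= x)%R%:R) = upper y.
Proof.
move=> y1; rewrite /upper Rintegral_itv_obnd_cbnd.
  rewrite (_ : `[y, +oo[%classic = Iy `&` `[y, +oo[%classic); last first.
    by rewrite setIidr//; apply: subset_itvr; rewrite bnd_simp.
  rewrite Rintegral_mkcondr; apply: eq_Rint => x _; rewrite patchE mem_setE in_itv/= andbT.
  by case: ifP => _; rewrite ?mulr1 ?mulr0.
have sub : `]y, +oo[%classic `<=` Iy by apply: subset_itvr; rewrite bnd_simp ltW.
have h : L1 mu `]y, +oo[ (fun x => bnd y * bnd x).
  by apply: L1Z => //; apply: integrableS bnd_L1.
apply: dominated_L1 h _ => //.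
  by apply: measurable_funTS; exact: (measurableT_comp meas_kernel (measurable_pair2 y)).
move=> x /sub Ix; rewrite mulrC; apply: kernel_bound => //.
by rewrite /= in_itv/= andbT.
Qed.

(** The symmetry F(1/r) = F(r) makes the halves x <= y and x > y of the
    domain contribute equally, and x = r y on the second one. *)
Lemma cutoff_form_fold :
  [/\ L1 mu2 D2 (fun p => cutoff_kernel p.1 p.2),
      L1 mu Iy (fun r => F r * r `^ (- 2^-1) * radial_kernel r) &
      \int[mu2]_(p in D2) cutoff_kernel p.1 p.2 =
      2 * \int[mu]_(r in Iy) (F r * r `^ (- 2^-1) * radial_kernel r)].
Proof.
have mk := meas_kernel.
have ml1 : measurable_fun setT (fun p : R * R => ((p.1 <= p.2)%R%:R : R)) by exact: meas_ler.
have ml2 : measurable_fun setT (fun p : R * R => ((p.2 < p.1)%R%:R : R)).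
  have -> : (fun p : R * R => ((p.2 < p.1)%R%:R : R)) = (fun p => 1 - (p.1 <= p.2)%R%:R).
    by apply/funext => p; rewrite ltNge; case: (_ <= _); rewrite ?subrr ?subr0.
  by apply: measD; [exact: meas_cst|exact: measN].
have ind (b : bool) u v : `|u| <= v -> `|u * b%:R| <= v :> R.
  move=> uv; rewrite normrM (le_trans _ uv)// ler_piMr// ger0_norm ?ler0n//.
  by case: b; rewrite ?lexx ?ler01.
have [] := @dominated_Fubini _ _ _ _ R mu mu Iy Iy cutoff_kernel _ _ _ _ _ bnd_L1 bnd_L1 _ => //.
- by apply: measurable_funTS.
move=> i _ _ EH _.
have [] := @dominated_Fubini _ _ _ _ R mu mu Iy Iy
   (fun x y => cutoff_kernel x y * (x <= y)%R%:R) _ _ _ _ _ bnd_L1 bnd_L1 _ => //.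
- by apply: measurable_funTS; exact: measurable_funM.
- by move=> x y Dx Dy; apply: ind; exact: kernel_bound.
move=> i1 j1 _ E1 _.
have [] := @dominated_Fubini _ _ _ _ R mu mu Iy Iy
   (fun x y => cutoff_kernel x y * (y < x)%R%:R) _ _ _ _ _ bnd_L1 bnd_L1 _ => //.
- by apply: measurable_funTS; exact: measurable_funM.
- by move=> x y Dx Dy; apply: ind; exact: kernel_bound.
move=> i2 _ j2 _ E2.
have E1' : \int[mu2]_(p in D2) (cutoff_kernel p.1 p.2 * (p.1 <= p.2)%R%:R) =
    \int[mu]_(y in Iy) upper y.
  rewrite E1; apply: eq_Rint => x Ix; rewrite -(upper_le (Iy_gt1 Ix)).
  apply: eq_Rint => y Iy'; rewrite kernelC//.
    by rewrite (lt_trans _ (Iy_gt1 Ix)).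
  by rewrite (lt_trans _ (Iy_gt1 Iy')).
have E2' : \int[mu2]_(p in D2) (cutoff_kernel p.1 p.2 * (p.2 < p.1)%R%:R) =
    \int[mu]_(y in Iy) upper y.
  by rewrite E2; apply: eq_Rint => y Iy'; rewrite (upper_lt (Iy_gt1 Iy')).
have bE x : Iy x -> 1 < x by exact: Iy_gt1.
pose f r y := F r * r `^ (- 2^-1) * (expR (- (e * (r + 1) * y)) * band_kernel (r * y) y).
have ms : measurable_fun setT (@sinc R).
  by apply: continuous_measurable_fun => x; exact: sinc_continuous.
have [] := @dominated_Fubini _ _ _ _ R mu mu Iy Iy f _ _ _ _ _ bnd_L1 bnd_L1 _ => //.
- by apply: measurable_funTS; rewrite /f /band_kernel; meas.
- move=> r y /Iy_gt1 r1 /Iy_gt1 y1; rewrite /f.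
  have r0 : 0 < r by rewrite (lt_trans _ r1).
  have y0 : 0 < y by rewrite (lt_trans _ y1).
  rewrite 2!normrM (ger0_norm (powR_ge0 _ _)) (normrM (expR _)) (ger0_norm (expR_ge0 _)).
  rewrite /bnd (_ : _ * _ * _ * (_ * _ * _) = (M + 1) * (M + 1) * (expR (- (e * r)) * expR (- (e * y)) * 4)); last by ring.
  have hM : `|F r| * r `^ (- 2^-1) <= (M + 1) * (M + 1).
    have p1 : r `^ (- 2^-1) <= 1.
      by rewrite -[leRHS](powRr0 r) ler_powR ?(ltW r1)// oppr_le0.
    have M1 : M <= (M + 1) * (M + 1) by rewrite -expr2; exact: M_le.
    apply: le_trans M1; apply: (le_trans _ (FM r0)).
    by rewrite ler_piMr.
  have hE : expR (- (e * (r + 1) * y)) <= expR (- (e * r)) * expR (- (e * y)).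
    rewrite -expRD ler_expR -opprD lerN2 -mulrDr -mulrA ler_pM2l//.
    rewrite -subr_ge0 (_ : _ - _ = r * (y - 1)); last by ring.
    by rewrite mulr_ge0 ?subr_ge0// ltW.
  apply: ler_pM hM _; first by rewrite mulr_ge0 ?powR_ge0.
    by rewrite mulr_ge0 ?expR_ge0.
  by apply: ler_pM hE (band_kernel_le4 _ _); rewrite ?expR_ge0.
move=> _ k1 k2 F1 F2.
have fE y : Iy y -> \int[mu]_(r in Iy) f r y = upper y.
  by move=> Iy'; rewrite upperE//; exact: Iy_gt1.
have gE r : Iy r -> \int[mu]_(y in Iy) f r y = F r * r `^ (- 2^-1) * radial_kernel r.
  move=> /Iy_gt1 r1; rewrite /f RintegralZl// /radial_kernel.
  have h : L1 mu Iy (fun y => 4 * expR (- (e * (r + 1) * y))).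
    by apply: L1Z => //; apply: expRN_L1; rewrite mulr_gt0// addr_gt0// (lt_trans _ r1).
  apply: dominated_L1 h _ => //.
    by apply: measurable_funTS; rewrite /band_kernel; meas.
  move=> y _; rewrite normrM mulrC (ger0_norm (expR_ge0 _)).
  by rewrite ler_wpM2r ?expR_ge0// band_kernel_le4.
split => //.
- exact: (@eq_L1 _ _ _ mu Iy _ _ _ gE k1).
- rewrite -(eq_Rint mu gE) -F1 F2 (eq_Rint mu fE) mulr_natl mulr2n -{1}E1' -E2'.
  rewrite -RintegralD; [|exact: measurableX|exact: i1|exact: i2].
  apply: (@eq_Rint _ _ _ mu2) => p _; rewrite -mulrDr ltNge.
  by case: (_ <= _); rewrite ?addr0 ?add0r mulr1.
Qed.

End Folding.

(** * The radial kernel *)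
Section RadialKernel.
Variable R : realType.
Notation mu := (@lebesgue_measure R).
Notation I01 := (`[0%R, 1%R]%classic : set R).
Notation Iy := (`]1%R, +oo[%classic : set R).
Implicit Types (a b c e r x y z : R).

Lemma expRN_lipschitz u v : 0 <= u -> 0 <= v -> `|expR (- u) - expR (- v)| <= `|u - v| :> R.
Proof.
wlog uv : u v / u <= v.
  move=> H u0 v0; case: (leP u v) => [uv|/ltW vu]; first exact: H.
  by rewrite distrC (distrC u); exact: H.
move=> u0 v0; rewrite distrC (distrC u) [leRHS]ger0_norm ?subr_ge0// -[leRHS]mul1r.
have d x : u <= x <= v -> is_derive x 1 (fun x => expR (- x)) (- expR (- x)).
  by move=> _; der; ring.
apply: (mean_value_bound uv d) => x /andP[ux _].
by rewrite normrN ger0_norm ?expR_ge0// expR_le1 oppr_le0 (le_trans u0).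
Qed.

Lemma atan_ge0 u : 0 <= u -> 0 <= atan u :> R.
Proof. by move=> u0; rewrite -(@atan0 R) le_atan. Qed.

Lemma atan_le_id u : 0 <= u -> atan u <= u :> R.
Proof.
move=> u0; have d x : 0 <= x <= u -> is_derive x 1 atan (1 + x ^+ 2)^-1.
  by move=> _; exact: is_derive1_atan.
have := mean_value_bound u0 d (K := 1); rewrite atan0 !subr0 mul1r => h.
apply: (le_trans (ler_norm _)); apply: h => x _.
have : 1 <= 1 + x ^+ 2 by rewrite lerDl sqr_ge0.
by move=> h; rewrite ger0_norm ?invr_ge0 ?(le_trans ler01)// invf_le1 ?(lt_le_trans ltr01).
Qed.

(** The part over 0 < y < 1 of the Laplace transform in Laplace_sinc. *)
Definition sinc_transform b a := \int[mu]_(y in I01) (expR (- (b * y)) * sinc (a * y)).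

Let st_bound b a y : 0 <= b -> 0 <= y <= 1 -> `|expR (- (b * y)) * sinc (a * y)| <= 1.
Proof.
move=> b0 /andP[y0 y1]; rewrite normrM ger0_norm ?expR_ge0// mulr_ile1 ?expR_ge0 ?norm_sinc_le1//.
by rewrite expR_le1 oppr_le0 mulr_ge0.
Qed.

Lemma sinc_transform_L1 b a : 0 <= b -> L1 mu I01 (fun y => expR (- (b * y)) * sinc (a * y)).
Proof.
move=> b0; apply: (@L1_01 _ 1); last by move=> y; exact: st_bound.
by apply: measM; [meas|apply: meas_sinc; meas].
Qed.

Lemma norm_sinc_transform_le1 b a : 0 <= b -> `|sinc_transform b a| <= 1.
Proof.
move=> b0; apply: Rint_01_bound; first exact: sinc_transform_L1.
by move=> y; exact: st_bound.
Qed.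

Lemma sinc_transform_lipschitz b b' a a' : 0 <= b -> 0 <= b' ->
  `|sinc_transform b a - sinc_transform b' a'| <= `|b - b'| + 2 * pi * `|a - a'|.
Proof.
move=> b0 b'0; rewrite /sinc_transform -RintegralB//; [|exact: sinc_transform_L1..].
apply: Rint_01_bound; first by apply: L1B => //; exact: sinc_transform_L1.
move=> y /andP[y0 y1].
rewrite (_ : _ - _ = (expR (- (b * y)) - expR (- (b' * y))) * sinc (a * y) +
   expR (- (b' * y)) * (sinc (a * y) - sinc (a' * y))); last by ring.
apply: (le_trans (ler_normD _ _)); apply: lerD; rewrite normrM.
  apply: (@le_trans _ _ (`|b - b'| * 1 * 1)); last by rewrite !mulr1.
  apply: ler_pM => //; last exact: norm_sinc_le1.
  apply: (le_trans (expRN_lipschitz _ _)); rewrite ?mulr_ge0//.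
  by rewrite -mulrBl normrM ler_pM// ger0_norm.
rewrite -[leRHS]mul1r; apply: ler_pM => //.
  by rewrite ger0_norm ?expR_ge0// expR_le1 oppr_le0 mulr_ge0.
apply: (le_trans (sinc_lipschitz _ _)).
rewrite ler_pM2l ?mulr_gt0 ?pi_gt0// -mulrBl normrM ler_piMr//.
by rewrite ger0_norm.
Qed.

Lemma int_powR_01 : L1 mu `]0, 1[ (fun y => y `^ (- (3 / 4))) /\
  \int[mu]_(y in `]0, 1[) y `^ (- (3 / 4)) = 4.
Proof.
have d y : 0 < y < 1 -> is_derive y 1 (fun y => 4 * y `^ 4^-1) (y `^ (- (3 / 4))).
  move=> /andP[y0 _]; der; first exact: y0.
  transitivity (y `^ (4^-1 - 1)); first by field.
  by congr (_ `^ _); field.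
have [||||i ->] := @ge0_FTC_oo R 0 1 _ _ 0 4 ltr01 _ d.
- by move=> y /andP[y0 _]; cont.
- by move=> y _; exact: powR_ge0.
- rewrite -[X in _ --> X](mulr0 4); apply: cvgM; first exact: cvg_cst.
  by apply: powR_cvg0; rewrite invr_gt0.
- have c : {for 1, continuous (fun y : R => 4 * y `^ 4^-1)} by cont.
  by have := cvg_at_left_filter c; rewrite powR1 mulr1.
by rewrite subr0.
Qed.

(** A decay rate independent of b, as needed to let the cutoff tend to zero
    under the integral sign. *)
Lemma norm_sinc_transform_powR b a : 0 <= b -> 0 < a ->
  `|sinc_transform b a| <= 4 * (2 * pi * a) `^ (- (3 / 4)).
Proof.
move=> b0 a0; have i := sinc_transform_L1 a b0.
have [j E] := int_powR_01.
have i' : L1 mu `]0, 1[ (fun y => expR (- (b * y)) * sinc (a * y)).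
  by apply: integrableS i => //; exact: subset_itv_oo_cc.
have -> : sinc_transform b a = \int[mu]_(y in `]0, 1[) (expR (- (b * y)) * sinc (a * y)).
  rewrite /sinc_transform -Rintegral_itv_obnd_cbnd ?Rintegral_itv_bndo_bndc//.
  by apply: integrableS i => //; apply: subset_itvr; rewrite bnd_simp.
apply: (le_trans (le_normr_Rintegral _ i')) => //.
apply: (@le_trans _ _ (\int[mu]_(y in `]0, 1[) ((2 * pi * a) `^ (- (3 / 4)) * y `^ (- (3 / 4))))); last first.
  by rewrite RintegralZl// E mulrC.
apply: le_Rintegral => //.
- exact: integrable_abse i'.
- exact: L1Z.
move=> y; rewrite /= in_itv/= => /andP[y0 y1].
rewrite -powRM ?mulr_ge0 ?pi_ge0 ?(ltW a0) ?(ltW y0)//.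
rewrite normrM ger0_norm ?expR_ge0// -mulrA.
apply: (@le_trans _ _ (`|sinc (a * y)|)).
  by rewrite ler_piMl// expR_le1 oppr_le0 mulr_ge0// ltW.
by have := norm_sinc_powR (mulr_gt0 a0 y0); rewrite mulrA.
Qed.

Definition local_kernel e r :=
  2 * (sinc_transform (e * (r + 1)) (r - 1) + sinc_transform (e * (r + 1)) (r + 1)).

Definition atan_kernel e r :=
  pi^-1 * (atan (2 * pi * ((r - 1) / (r + 1)) / e) / (r - 1) + atan (2 * pi / e) / (r + 1)).

(** The integral over y > 1 is that over y > 0, known in closed form, minus
    that over 0 < y < 1. *)
Lemma radial_kernelE e r : 0 < e -> 1 < r ->
  radial_kernel e r = atan_kernel e r - local_kernel e r.
Proof.
move=> e0 r1; pose b := e * (r + 1).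
have r1' : 0 < r - 1 by rewrite subr_gt0.
have r1'' : 0 < r + 1 by lra.
have b0 : 0 < b by rewrite mulr_gt0.
pose f a y := expR (- (b * y)) * sinc (a * y).
have f_L1 a : L1 mu `]0, +oo[ (f a).
  apply: dominated_L1 (int_expRN b0).1 _ => //.
    by apply: measurable_funTS; apply: measM; [meas|apply: meas_sinc; meas].
  by move=> y _; rewrite normrM ger0_norm ?expR_ge0// ler_piMr ?expR_ge0// norm_sinc_le1.
have split a : \int[mu]_(y in Iy) f a y = \int[mu]_(y in `]0, +oo[) f a y - sinc_transform b a.
  have := @Rintegral_itvB R _ (BRight 0) +oo%O 1 (f_L1 a).
  rewrite bnd_simp ler01 => /(_ isT isT) <-; congr (_ - _).
  rewrite Rintegral_itv_obnd_cbnd//; apply: integrableS (f_L1 a) => //.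
  by apply: subset_itvl; rewrite bnd_simp.
have fy_L1 a : L1 mu Iy (f a).
  by apply: integrableS (f_L1 a) => //; apply: subset_itvr; rewrite bnd_simp.
have -> : radial_kernel e r = 2 * (\int[mu]_(y in Iy) f (r - 1) y + \int[mu]_(y in Iy) f (r + 1) y).
  rewrite /radial_kernel -RintegralD; [|by []|exact: fy_L1|exact: fy_L1].
  rewrite -RintegralZl; [|by []|by apply: L1D; [|exact: fy_L1|exact: fy_L1]].
  apply: eq_Rint => y _; rewrite /f /band_kernel -/b mulrCA -mulrDr.
  by congr (_ * (_ * (sinc _ + sinc _))); ring.
rewrite !split !Laplace_sinc// /atan_kernel /local_kernel -/b.
have -> : 2 * pi * (r + 1) / b = 2 * pi / e by rewrite /b; move: (pi) => p; field; rewrite !gt_eqF.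
have -> : 2 * pi * (r - 1) / b = 2 * pi * ((r - 1) / (r + 1)) / e.
  by rewrite /b; move: (pi) => p; field; rewrite !gt_eqF.
move: (atan _) (atan _) (sinc_transform _ _) (sinc_transform _ _); genpi => u v s t.
by field; rewrite !gt_eqF.
Qed.

Lemma local_kernel_lipschitz e e' r : 0 <= e -> 0 <= e' -> 1 < r ->
  `|local_kernel e r - local_kernel e' r| <= 4 * (r + 1) * `|e - e'|.
Proof.
move=> e0 e'0 r1; have r0 : 0 <= r + 1 by lra.
have h a : `|sinc_transform (e * (r + 1)) a - sinc_transform (e' * (r + 1)) a| <=
    (r + 1) * `|e - e'|.
  apply: (le_trans (sinc_transform_lipschitz _ _ _ _)); rewrite ?mulr_ge0//.
  by rewrite (subrr a) normr0 mulr0 addr0 -mulrBl normrM (ger0_norm r0) mulrC.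
move: (h (r - 1)) (h (r + 1)); rewrite /local_kernel.
move: (sinc_transform _ (r - 1)) (sinc_transform _ (r + 1)) (sinc_transform _ (r - 1)) (sinc_transform _ (r + 1)).
move=> s3 s4 s1 s2 h1 h2; rewrite -mulrBr normrM (ger0_norm (ler0n _ _)).
rewrite (_ : s1 + s2 - (s3 + s4) = (s1 - s3) + (s2 - s4)); last by ring.
apply: (@le_trans _ _ (2 * ((r + 1) * `|e - e'| + (r + 1) * `|e - e'|))); last first.
  by rewrite le_eqVlt; apply/orP; left; apply/eqP; ring.
rewrite ler_pM2l//; apply: (le_trans (ler_normD _ _)); exact: lerD.
Qed.

Lemma local_kernel_continuous e r : 0 <= e -> 1 < r -> {for r, continuous (local_kernel e)}.
Proof.
move=> e0 r1.
have h c : {for r, continuous (fun r => sinc_transform (e * (r + 1)) (r + c))}.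
  apply/subr_cvg0; apply: (@cvg_to0 _ _ _ _ _ (fun y => (e + 2 * pi) * `|y - r|)).
    near=> y; have y0 : 0 < y by near: y; apply: lt_nbhsr; rewrite (lt_trans _ r1).
    apply: (le_trans (sinc_transform_lipschitz _ _ _ _)).
    - by rewrite mulr_ge0//; lra.
    - by rewrite mulr_ge0//; lra.
    rewrite -mulrBr normrM (ger0_norm e0).
    have E k : y + k - (r + k) = y - r by rewrite opprD addrACA subrr addr0.
    by rewrite !E -mulrDl.
  move: (e + 2 * pi) => K.
  have : {for r, continuous (fun y => K * `|y - r|)} by cont.
  by rewrite /prop_for /continuous_at subrr normr0 mulr0.
by rewrite /local_kernel; apply: contM; [cont|apply: contD; exact: h].
Unshelve. all: end_near. Qed.

Lemma local_kernel_le e r : 0 <= e -> 1 < r -> `|local_kernel e r| <= 16 * r `^ (- (3 / 4)).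
Proof.
move=> e0 r1; have r0 : 0 < r by rewrite (lt_trans _ r1).
have b0 : 0 <= e * (r + 1) by rewrite mulr_ge0//; lra.
have pi1 : 2 <= pi :> R by exact: pi_ge2.
have far a : 0 < a -> r <= 4 * a -> `|sinc_transform (e * (r + 1)) a| <= 4 * r `^ (- (3 / 4)).
  move=> a0 ra; apply: (le_trans (norm_sinc_transform_powR b0 a0)).
  rewrite ler_pM2l// !powRN lef_pV2 ?posrE ?powR_gt0 ?mulr_gt0 ?pi_gt0//.
  have q : 0 <= 3 / 4 :> R by rewrite divr_ge0.
  apply: (ge0_ler_powR q); rewrite ?nnegrE ?(ltW r0)//.
    by rewrite !mulr_ge0 ?pi_ge0 ?(ltW a0).
  by apply: (le_trans ra); rewrite ler_pM2r//; lra.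
have h1 := far (r + 1) ltac:(lra) ltac:(lra).
have h2 : `|sinc_transform (e * (r + 1)) (r - 1)| <= 4 * r `^ (- (3 / 4)).
  have [r2|r2] := leP r 2; last by apply: far; lra.
  apply: (le_trans (norm_sinc_transform_le1 _ b0)).
  rewrite powRN ler_pdivlMr ?powR_gt0// mul1r.
  apply: (@le_trans _ _ (r `^ 1)); first by rewrite ler_powR ?(ltW r1)//; lra.
  by rewrite powRr1 ?(ltW r0)//; lra.
rewrite /local_kernel normrM (ger0_norm (ler0n _ _)).
rewrite (_ : 16 * r `^ (- (3 / 4)) = 2 * (4 * r `^ (- (3 / 4)) + 4 * r `^ (- (3 / 4)))); last by ring.
by rewrite ler_pM2l//; apply: (le_trans (ler_normD _ _)); exact: lerD.
Qed.

(** The integral over x in the definition of delta is a band kernel at the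
    pair (r y, y). *)
Lemma tr_delta_local r : 1 < r -> tr_delta r = r `^ 2^-1 * local_kernel 0 r.
Proof.
move=> r1; rewrite /tr_delta (ltW r1) /tr_delta_ge1.
have h x : \int[mu]_(y in `[0, 1]) (cos (2 * pi * r * x * y) * cos (2 * pi * x * y)) =
    4^-1 * band_kernel (r * x) x.
  rewrite band_kernelE -RintegralZl//.
    by apply: eq_Rint => y _; rewrite (_ : 2 * pi * (r * x) * y = 2 * pi * r * x * y); [field|ring].
  apply: (@L1_01 _ 4); first by meas.
  move=> y _; rewrite mulrACA normrM (_ : 2 * 2 = 4 :> R); last by ring.
  by rewrite (ger0_norm (ler0n R 4)) ler_piMr// normrM mulr_ile1// norm_cos_le1.
have st0 a : sinc_transform 0 a = \int[mu]_(x in I01) sinc (a * x).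
  by rewrite /sinc_transform; apply: (@eq_Rint _ _ _ mu) => z _; rewrite mul0r oppr0 expR0 mul1r.
have i a : L1 mu I01 (fun x => sinc (a * x)).
  by apply: (@L1_01 _ 1) => [|x _]; [apply: meas_sinc; meas|exact: norm_sinc_le1].
have E : \int[mu]_(x in `[0, 1]) \int[mu]_(y in `[0, 1]) (cos (2 * pi * r * x * y) * cos (2 * pi * x * y)) =
   2^-1 * (sinc_transform 0 (r - 1) + sinc_transform 0 (r + 1)).
  rewrite !st0 -RintegralD; [|by []|exact: i|exact: i].
  rewrite -RintegralZl; [|by []|by apply: L1D; [|exact: i|exact: i]].
  apply: eq_Rint => x _; rewrite h /band_kernel.
  rewrite (_ : r * x - x = (r - 1) * x); last by ring.
  rewrite (_ : r * x + x = (r + 1) * x); last by ring.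
  by field.
rewrite E /local_kernel (mul0r (r + 1)).
by move: (sinc_transform _ _) (sinc_transform _ _) (_ `^ _) => u v w; field.
Qed.

End RadialKernel.

(** * Euler's constant as an integral *)
Section EulerConstant.
Variable R : realType.
Notation mu := (@lebesgue_measure R).
Notation I0 := (`]0%R, +oo[%classic : set R).
Notation Iy := (`]1%R, +oo[%classic : set R).
Implicit Types (a b c s v x y : R).

Lemma I0_gt0 x : I0 x -> 0 < x.
Proof. by rewrite /= in_itv/= andbT. Qed.

(** Integrate e^(-u v) over a <= u <= b and v > 0 in both orders. *)
Lemma Frullani_lt a b : 0 < a -> a < b ->
  L1 mu I0 (fun v => (expR (- (a * v)) - expR (- (b * v))) / v) /\
  \int[mu]_(v in I0) ((expR (- (a * v)) - expR (- (b * v))) / v) = ln b - ln a.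
Proof.
move=> a0 ab.
have i1 : L1 mu `[a, b] (fun=> 1 : R).
  by apply: cst_L1; rewrite /= lebesgue_measure_itv/= lte_fin ab ltry.
have [] := @dominated_Fubini _ _ _ _ R mu mu I0 `[a, b]
  (fun v u => expR (- (u * v))) _ _ _ _ _ (int_expRN a0).1 i1 _ => //.
- by apply: measurable_funTS; meas.
- move=> v u /I0_gt0 v0; rewrite /= in_itv/= => /andP[au _].
  by rewrite ger0_norm ?expR_ge0// mulr1 ler_expR lerN2 ler_pM2r.
move=> _ k _ E1 E2.
have inner v : I0 v -> \int[mu]_(u in `[a, b]) expR (- (u * v)) =
    (expR (- (a * v)) - expR (- (b * v))) / v.
  move=> /I0_gt0 v0.
  have d (u : R) : u \in `[a, b] -> is_derive u 1 (fun u => - expR (- (u * v)) / v) (expR (- (u * v))).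
    by move=> _; der; field; rewrite gt_eqF.
  have c (u : R) : u \in `[a, b] -> {for u, continuous (fun u : R => expR (- (u * v)))} by move=> _; cont.
  by rewrite /Rintegral (FTC_compact ab c d)/= !mulNr opprK addrC mulrBl.
split; first exact: (@eq_L1 _ _ _ mu I0 _ _ _ inner k).
rewrite -(eq_Rint mu inner) -E1 E2.
have -> : \int[mu]_(u in `[a, b]) \int[mu]_(v in I0) expR (- (u * v)) =
    \int[mu]_(u in `[a, b]) u^-1.
  have h (u : R) : `[a, b]%classic u -> \int[mu]_(v in I0) expR (- (u * v)) = u^-1.
    by rewrite /= in_itv/= => /andP[au _]; have [] := int_expRN (lt_le_trans a0 au).
  exact: (eq_Rint mu h).
have gt0 (u : R) : u \in `[a, b] -> 0 < u.
  by rewrite in_itv/= => /andP[au _]; exact: lt_le_trans au.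
have d (u : R) : u \in `[a, b] -> is_derive u 1 (@ln R) u^-1 by move=> /gt0; exact: is_derive1_ln.
have c (u : R) : u \in `[a, b] -> {for u, continuous (fun u : R => u^-1)}.
  by move=> /gt0 u0; cont; rewrite gt_eqF.
by rewrite /Rintegral (FTC_compact ab c d).
Qed.

Lemma Frullani s : 0 < s ->
  L1 mu I0 (fun v => (expR (- v) - expR (- (s * v))) / v) /\
  \int[mu]_(v in I0) ((expR (- v) - expR (- (s * v))) / v) = ln s.
Proof.
move=> s0; have [s1|s1|<-] := ltgtP 1 s.
- have [i E] := Frullani_lt (@ltr01 R) s1; split.
    by apply: (@eq_L1 _ _ _ mu I0 _ _ _ _ i) => // v _; rewrite mul1r.
  move: E; rewrite ln1 subr0 => <-.
  by apply: (@eq_Rint _ _ _ mu) => v _; rewrite mul1r.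
- have [i E] := Frullani_lt s0 s1.
  have h v : I0 v -> - ((expR (- (s * v)) - expR (- (1 * v))) / v) =
      (expR (- v) - expR (- (s * v))) / v by rewrite mul1r -mulNr opprB.
  split; first by apply: (@eq_L1 _ _ _ mu I0 _ _ _ h) => //; exact: L1N.
  by rewrite -(eq_Rint mu h) RintN// E ln1 sub0r opprK.
- have h v : I0 v -> 0 = (expR (- v) - expR (- (1 * v))) / v by rewrite mul1r subrr mul0r.
  split; first by apply: (@eq_L1 _ _ _ mu I0 _ _ _ h) => //; exact: integrable0.
  by rewrite -(eq_Rint mu h) Rintegral_cst//= mul0r ln1.
Qed.

Lemma int_inv_pow (k : nat) :
  L1 mu I0 (fun v => (1 + v) ^- k.+2) /\
  \int[mu]_(v in I0) (1 + v) ^- k.+2 = k.+1%:R^-1.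
Proof.
have pos v : 0 <= v -> 1 + v != 0 by move=> v0; rewrite gt_eqF// ltr_pwDl.
have d (v : R) : 0 <= v -> is_derive v 1 (fun v => - k.+1%:R^-1 * (1 + v) ^- k.+1) ((1 + v) ^- k.+2).
  move=> v0; der; first by rewrite expf_neq0// pos.
  rewrite mul0r !add0r /= !exprS.
  by field; rewrite expf_neq0 ?pos//= pnatr_eq0.
have dP (v : R) : 0 < v -> is_derive v 1 (fun v => - k.+1%:R^-1 * (1 + v) ^- k.+1) ((1 + v) ^- k.+2).
  by move=> /ltW; exact: d.
have [||||i E] := @ge0_FTC_oy R 0 _ _ (- k.+1%:R^-1) 0 _ dP.
- by move=> v v0; cont; rewrite expf_neq0// pos// ltW.
- by move=> v v0; rewrite invr_ge0 exprn_ge0// addr_ge0// ltW.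
- by have := der_cvg_right (d 0 (lexx _)); rewrite addr0 expr1n invr1 mulr1.
- rewrite -[X in _ --> X](mulr0 (- k.+1%:R^-1)); apply: cvgM; first exact: cvg_cst.
  apply: (@cvg_to0 _ _ _ _ _ (fun v => v^-1)); last exact: cvg_inv_y.
  near=> v; have v0 : 0 < v by near: v; apply: nbhs_pinfty_gt; exact: num_real.
  rewrite ger0_norm ?invr_ge0 ?exprn_ge0 ?addr_ge0 ?(ltW v0)//.
  rewrite lef_pV2 ?posrE ?exprn_gt0 ?addr_gt0//.
  apply: (@le_trans _ _ (1 + v)); first by rewrite lerDr.
  by rewrite ler_eXnr// lerDl ltW.
by rewrite E sub0r opprK.
Unshelve. all: end_near. Qed.

(** Each further term adds the integral of (1 + v)^(-n-2). *)
Lemma int_harmonic (n : nat) :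
  L1 mu I0 (fun v => ((1 + v)^-1 - (1 + v) ^- n.+1) / v) /\
  \int[mu]_(v in I0) (((1 + v)^-1 - (1 + v) ^- n.+1) / v) = \sum_(1 <= k < n.+1) k%:R^-1.
Proof.
elim: n => [|n [i E]].
  have h v : I0 v -> 0 = ((1 + v)^-1 - (1 + v) ^- 1) / v by rewrite expr1 subrr mul0r.
  split; first by apply: (@eq_L1 _ _ _ mu I0 _ _ _ h) => //; exact: integrable0.
  by rewrite -(eq_Rint mu h) Rintegral_cst//= mul0r big_nil.
have [j E'] := int_inv_pow n.
have h v : I0 v -> ((1 + v)^-1 - (1 + v) ^- n.+1) / v + (1 + v) ^- n.+2 =
    ((1 + v)^-1 - (1 + v) ^- n.+2) / v.
  move=> /I0_gt0 v0; have v1 : 1 + v != 0 by rewrite gt_eqF// ltr_pwDl// ltW.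
  rewrite !exprS; field; rewrite v1 gt_eqF//=.
  by rewrite expf_neq0.
split; first by apply: (@eq_L1 _ _ _ mu I0 _ _ _ h) => //; exact: L1D.
by rewrite -(eq_Rint mu h) RintegralD// E E' [RHS]big_nat_recr.
Qed.

Definition gamma_integrand v : R := ((1 + v)^-1 - expR (- v)) / v.

(** From 1 + v <= e^v and 1 - v <= e^(-v). *)
Lemma one_sub_bound v : 0 <= v -> 0 <= 1 - (1 + v) * expR (- v) <= v ^+ 2.
Proof.
move=> v0; apply/andP; split.
  by rewrite subr_ge0 expRN ler_pdivrMr ?expR_gt0// mul1r expR_ge1Dx.
have := expR_ge1Dx (- v) => h.
rewrite lerBlDr -lerBlDl.
apply: (@le_trans _ _ ((1 + v) * (1 - v))); last by rewrite ler_pM2l// ltr_pwDl.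
by rewrite (_ : (1 + v) * (1 - v) = 1 - v ^+ 2)//; ring.
Qed.

Lemma gamma_integrand_L1 : L1 mu I0 gamma_integrand.
Proof.
have [j _] := int_inv_pow 0.
have i : L1 mu I0 (fun v => 4 * (1 + v) ^- 2) by apply: L1Z.
apply: dominated_L1 i _ => //; first by apply: measurable_funTS; rewrite /gamma_integrand; meas.
move=> v /I0_gt0 v0; have v1 : 0 < 1 + v by rewrite ltr_pwDl// ltW.
have /andP[b0 b1] := one_sub_bound (ltW v0).
have b2 : 1 - (1 + v) * expR (- v) <= 1 by rewrite gerBl mulr_ge0 ?expR_ge0// ltW.
have -> : gamma_integrand v = (1 - (1 + v) * expR (- v)) / ((1 + v) * v).
  by rewrite /gamma_integrand; field; rewrite !gt_eqF.
have q4 : (1 - (1 + v) * expR (- v)) * (1 + v) <= 4 * v.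
  move: v0 b0 b1 b2; move: (1 - _) => q v0 b0 b1 b2; clear -v0 b0 b1 b2.
  have [v1|v1] := lerP v 1; nra.
rewrite ger0_norm ?divr_ge0 ?mulr_ge0 ?(ltW v0) ?(ltW v1)//.
rewrite ler_pdivrMr ?mulr_gt0//.
rewrite (_ : 4 * _ * _ = 4 * v / (1 + v)); last by field; rewrite gt_eqF.
by rewrite ler_pdivlMr.
Qed.

End EulerConstant.

Section Asymptotics.
Variable R : realType.
Notation mu := (@lebesgue_measure R).
Notation I0 := (`]0%R, +oo[%classic : set R).
Notation Iy := (`]1%R, +oo[%classic : set R).
Implicit Types (a b c s v x y : R).

Lemma cvg_of_sub (T : Type) (F : set_system T) (FF : Filter F) (u : T -> R) (l : R) :
  u n - l @[n --> F] --> 0 -> u n @[n --> F] --> l.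
Proof.
move=> h; have E : u = (fun n => (u n - l) + l) by apply/funext => n; rewrite subrK.
have h' : u n - l + l @[n --> F] --> 0 + l by apply: cvgD => //; exact: cvg_cst.
rewrite E; move: h'; rewrite add0r; apply.
Qed.

Lemma one_sub_expr_le (q : R) n : 0 <= q <= 1 -> 1 - q ^+ n <= n%:R * (1 - q).
Proof.
move=> /andP[q0 q1]; elim: n => [|n IH]; first by rewrite expr0 subrr mul0r.
rewrite exprS -natr1 mulrDl mul1r.
rewrite (_ : 1 - q * q ^+ n = q * (1 - q ^+ n) + (1 - q)); last by ring.
rewrite lerD2r (le_trans _ IH)// ler_piMl// subr_ge0.
by rewrite exprn_ile1.
Qed.

(** With q = (1 + v) e^(-v), this compares e^(-n v) = q^n (1 + v)^(-n) with
    (1 + v)^(-n), where 1 - q^n <= n (1 - q) <= n v^2. The index starts at 3 so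
    that the powers remain integrable after division by v. *)
Let remainder_bound n v : 0 < v ->
  `|(expR (- (n.+3%:R * v)) - (1 + v) ^- n.+4) / v| <=
  n.+3%:R * ((1 + v) ^- n.+2 - (1 + v) ^- n.+3) + (1 + v) ^- n.+4.
Proof.
move=> v0; have w0 : 0 < 1 + v by rewrite addr_gt0.
have /andP[h1 h2] := one_sub_bound (ltW v0).
set q := (1 + v) * expR (- v) in h1 h2.
have q0 : 0 <= q by rewrite mulr_ge0 ?expR_ge0// ltW.
have q1 : q <= 1 by rewrite -subr_ge0.
have E : expR (- (n.+3%:R * v)) = q ^+ n.+3 * (1 + v) ^- n.+3.
  by rewrite /q exprMn -expRM_natl mulrN mulrAC divff ?mul1r// expf_neq0// gt_eqF.
have T : expR (- (n.+3%:R * v)) - (1 + v) ^- n.+4 =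
   (1 + v) ^- n.+4 * v - (1 + v) ^- n.+3 * (1 - q ^+ n.+3).
  have -> : (1 + v) ^- n.+4 = (1 + v)^-1 * (1 + v) ^- n.+3 by rewrite -invfM -exprS.
  rewrite E; move: (q ^+ n.+3) ((1 + v) ^- n.+3)%R => r s; clear -w0.
  by field; rewrite gt_eqF.
rewrite T normrM normfV (gtr0_norm v0) ler_pdivrMr//.
apply: (le_trans (ler_normB _ _)); rewrite addrC mulrDl lerD//; last first.
  by rewrite ger0_norm// mulr_ge0 ?invr_ge0 ?exprn_ge0// ltW.
have p0 : 0 <= (1 + v) ^- n.+3 by rewrite invr_ge0 exprn_ge0// ltW.
rewrite ger0_norm ?mulr_ge0 ?subr_ge0 ?exprn_ile1//.
have -> : (1 + v) ^- n.+2 - (1 + v) ^- n.+3 = (1 + v) ^- n.+3 * v.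
  have -> : (1 + v) ^- n.+3 = (1 + v)^-1 * (1 + v) ^- n.+2 by rewrite -invfM -exprS.
  by move: ((1 + v) ^- n.+2)%R => s; clear -w0; field; rewrite gt_eqF.
rewrite mulrCA -!mulrA ler_wpM2l//.
apply: (le_trans (one_sub_expr_le _ _)); first by rewrite q0.
by rewrite ler_wpM2l// -expr2.
Qed.

(** Frullani's integral for ln n, subtracted from that of the n-th harmonic
    number, leaves a remainder of order 1/n. *)
Lemma int_gamma_integrand : \int[mu]_(v in I0) gamma_integrand v = euler_gamma R.
Proof.
set G := \int[mu]_(v in I0) _.
suff: (fun n : nat => \sum_(1 <= k < n.+1) k%:R^-1 - ln (n%:R : R)) @ \oo --> G.
  by move=> /cvg_lim h; rewrite /euler_gamma h.
rewrite -(cvg_shiftn 3).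
apply: cvg_of_sub.
apply: (@cvg_to0 _ _ _ _ _ (fun n => 3 * harmonic n)); last first.
  by rewrite -[X in _ --> X](mulr0 3); apply: cvgM; [exact: cvg_cst|exact: cvg_harmonic].
apply: nearW => n; rewrite addn3.
have [i1 <-] := int_harmonic R n.+3.
have n0 : 0 < n.+3%:R :> R by [].
have [i2 <-] := Frullani n0.
have iG := @gamma_integrand_L1 R.
rewrite /G -!RintegralB//; last exact: L1B.
have [j2 E2] := int_inv_pow R n; have [j3 E3] := int_inv_pow R n.+1.
have [j4 E4] := int_inv_pow R n.+2.
have jB : L1 mu I0 (fun v => ((1 + v)^-1 - (1 + v) ^- n.+4) / v -
    (expR (- v) - expR (- (n.+3%:R * v))) / v - gamma_integrand v).
  by apply: L1B => //; exact: L1B.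
have jd : L1 mu I0 (fun v => n.+3%:R * ((1 + v) ^- n.+2 - (1 + v) ^- n.+3) + (1 + v) ^- n.+4).
  by apply: L1D => //; apply: L1Z => //; exact: L1B.
apply: (le_trans (le_normr_Rintegral _ jB)) => //.
apply: (@le_trans _ _ (\int[mu]_(v in I0) (n.+3%:R * ((1 + v) ^- n.+2 - (1 + v) ^- n.+3) + (1 + v) ^- n.+4))).
  apply: le_Rintegral => //; first exact: integrable_abse jB.
  move=> v /I0_gt0 v0; have := remainder_bound n v0; rewrite /gamma_integrand.
  by rewrite -!mulrBl; congr (`|_ / _| <= _); ring.
rewrite RintegralD//; last by apply: L1Z => //; exact: L1B.
rewrite RintegralZl//; last exact: L1B.
rewrite RintegralB// E2 E3 E4 (_ : harmonic n = n.+1%:R^-1)//.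
have m0 : 0 <= n%:R :> R by [].
have -> : n.+3%:R = n%:R + 3 :> R by rewrite -addn3 natrD.
have -> : n.+2%:R = n%:R + 2 :> R by rewrite -addn2 natrD.
have -> : n.+1%:R = n%:R + 1 :> R by rewrite -addn1 natrD.
move: (n%:R : R) m0 => m m0; clear -m0.
rewrite -subr_ge0.
have -> : 3 * (m + 1)^-1 - ((m + 3) * ((m + 1)^-1 - (m + 2)^-1) + (m + 3)^-1) =
  ((m + 1)^-1 - (m + 3)^-1) + (m + 2)^-1 * (m + 1)^-1 * (m + 1).
  by field; rewrite !gt_eqF//; lra.
rewrite addr_ge0 ?mulr_ge0 ?subr_ge0 ?invr_ge0//; try lra.
by rewrite lef_pV2 ?posrE; lra.
Qed.

End Asymptotics.

(** * The divergent parts *)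
Section ExpIntegral.
Variable R : realType.
Notation mu := (@lebesgue_measure R).
Notation I0 := (`]0%R, +oo[%classic : set R).
Notation Iy := (`]1%R, +oo[%classic : set R).
Implicit Types (a b c s v x y : R).

Definition exp_integral a := \int[mu]_(x in Iy) (expR (- (a * x)) / x).

Lemma cvg_ln_ratio : ln x - ln (1 + x) @[x --> +oo] --> (0 : R).
Proof.
apply: (@cvg_to0 _ _ _ _ _ (fun x => x^-1)); last exact: cvg_inv_y.
near=> x; have x0 : 0 < x by near: x; apply: nbhs_pinfty_gt; exact: num_real.
rewrite distrC ger0_norm; last by rewrite subr_ge0 ler_ln ?posrE ?addr_gt0// lerDr.
rewrite -ln_div ?posrE ?addr_gt0// (_ : (1 + x) / x = 1 + x^-1).
  by apply: le_ln1Dx; apply: (@lt_trans _ _ 0) => //; rewrite invr_gt0.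
by clear -x0; field; rewrite gt_eqF.
Unshelve. all: end_near. Qed.

(** Rescale to the integral of e^(-v) / v over v > a, and compare e^(-v)
    with 1 / (1 + v). *)
Lemma exp_integralE a : 0 < a ->
  exp_integral a + ln a = ln (1 + a) - \int[mu]_(v in `]a, +oo[) gamma_integrand v.
Proof.
move=> a0; have gt0 v : a < v -> 0 < v by exact: lt_trans.
have d v : a < v -> is_derive v 1 (fun v => ln v - ln (1 + v)) ((v * (1 + v))^-1).
  move=> /gt0 v0; der => //; first by rewrite addr_gt0.
  by field; rewrite !gt_eqF// addr_gt0.
have [||||i E] := @ge0_FTC_oy R a _ _ (ln a - ln (1 + a)) 0 _ d.
- by move=> v /gt0 v0; cont; rewrite mulf_neq0// gt_eqF// addr_gt0.
- by move=> v /gt0 v0; rewrite invr_ge0 mulr_ge0 ?addr_ge0// ltW.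
- have da : is_derive a 1 (fun v => ln v - ln (1 + v)) ((a * (1 + a))^-1).
    by der => //; [rewrite addr_gt0|field; rewrite !gt_eqF// addr_gt0].
  exact: (der_cvg_right da).
- exact: cvg_ln_ratio.
have ig : L1 mu `]a, +oo[ (@gamma_integrand R).
  apply: integrableS (@gamma_integrand_L1 R) => //.
  by move=> v; rewrite /= !in_itv/= !andbT; exact: gt0.
have := @scale_oy R a 1 (fun y => expR (- y) / y) a0.
rewrite mulr1 => -[|_ S].
  by move=> y /gt0 y0; cont; rewrite gt_eqF.
have -> : exp_integral a = \int[mu]_(y in `]a, +oo[) (expR (- y) / y).
  rewrite S; apply: (@eq_Rint _ _ _ mu) => x /Iy_gt1 x1.
  move: (expR _) => q; field.
  by rewrite !gt_eqF// (lt_trans _ x1).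
have h v : `]a, +oo[%classic v -> (v * (1 + v))^-1 - gamma_integrand v = expR (- v) / v.
  rewrite /= in_itv/= andbT => /gt0 v0; rewrite /gamma_integrand.
  by move: (expR _) => q; clear -v0; field; rewrite !gt_eqF// addr_gt0.
rewrite -(eq_Rint mu h) RintegralB// E.
by ring.
Qed.

Lemma exp_integral_cvg :
  exp_integral (harmonic n) + ln (harmonic n) @[n --> \oo] --> - euler_gamma R.
Proof.
have h0 n : 0 < harmonic n :> R by rewrite invr_gt0.
have U : \bigcup_n `]harmonic n, +oo[%classic = I0.
  apply/seteqP; split=> v.
    by move=> [n _]; rewrite /= !in_itv/= !andbT; exact: lt_trans.
  rewrite /= in_itv/= andbT => v0.
  have [n nv] : exists n, harmonic n < v.
    have /cvgrPdist_lt/(_ v v0) [N _ /(_ N (leqnn N))] := @cvg_harmonic R.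
    by rewrite /= sub0r normrN gtr0_norm//; exists N.
  by exists n => //=; rewrite in_itv/= nv.
under eq_fun do rewrite exp_integralE//.
rewrite -sub0r -int_gamma_integrand; apply: cvgB.
  apply: (@cvg_to0 _ _ _ _ _ harmonic); last exact: cvg_harmonic.
  apply: nearW => n; rewrite ger0_norm; last by rewrite ln_ge0// lerDl ltW.
  by apply: le_ln1Dx; rewrite (lt_trans _ (h0 n)).
rewrite -U; apply: cvg_Rint_bigcup => //.
- move=> n m nm; apply/subsetPset; apply: subset_itvr; rewrite bnd_simp.
  by rewrite /harmonic /= lef_pV2 ?posrE// ler_nat.
- by rewrite U; exact: gamma_integrand_L1.
Qed.

End ExpIntegral.

Section Arctan.
Variable R : realType.
Notation mu := (@lebesgue_measure R).
Notation Iy := (`]1%R, +oo[%classic : set R).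
Implicit Types (a b c s v x y A : R).

Lemma atan_inv v : 0 < v -> atan v + atan v^-1 = pi / 2 :> R.
Proof.
move=> v0; pose h (v : R) := atan v + atan v^-1.
have d x : 0 < x -> is_derive x 1 h 0.
  move=> x0; rewrite /h; der; first by rewrite gt_eqF.
  by field; rewrite !gt_eqF// ltr_wpDl ?sqr_ge0//.
have -> : pi / 2 = h 1 by rewrite /h invr1 atan1; genpi; field.
apply/eqP; rewrite -subr_eq0 -normr_le0.
have [v1|v1] := lerP 1 v.
  rewrite -(mul0r (v - 1)); apply: (@mean_value_bound _ h (fun=> 0)) => // x /andP[x1 _].
    by apply: d; exact: lt_le_trans x1.
  by rewrite normr0.
rewrite distrC -(mul0r (1 - v)); apply: (@mean_value_bound _ h (fun=> 0)) => //; first exact: ltW.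
  by move=> x /andP[x1 _]; apply: d; exact: lt_le_trans x1.
by move=> x _; rewrite normr0.
Qed.

Definition atan_integral A := \int[mu]_(w in `]0, 1[) (atan (A * w) / w).

Lemma norm_atan_quotient A w : 0 <= A -> 0 < w -> `|atan (A * w) / w| <= A.
Proof.
move=> A0 w0; have Aw : 0 <= A * w by rewrite mulr_ge0// ltW.
rewrite ger0_norm ?divr_ge0 ?atan_ge0// ?(ltW w0)//.
by rewrite ler_pdivrMr// atan_le_id.
Qed.

Lemma mu_oo_lty a b : (mu `]a, b[ < +oo)%E.
Proof. by rewrite lebesgue_measure_itv; case: ifP => // _; rewrite -EFinB ltry. Qed.

Lemma atan_quotient_L1 A B : 0 <= A -> L1 mu `]0, B[ (fun w => atan (A * w) / w).
Proof.
move=> A0; apply: (@bounded_L1_itv _ `]0, B[ A) => //; first exact: mu_oo_lty.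
  by meas.
by move=> w; rewrite in_itv/= => /andP[w0 _]; exact: norm_atan_quotient.
Qed.

Lemma atan_inv_L1 : L1 mu Iy (fun x => atan x^-1 / x).
Proof.
apply: dominated_L1 (@inv_sqr_L1 R) _ => //; first by meas.
move=> x /Iy_gt1 x1; have x0 : 0 < x by rewrite (lt_trans _ x1).
have := @norm_atan_quotient 1 x^-1 ler01; rewrite mul1r invr_gt0 x0 => /(_ isT).
rewrite !normrM invrK normfV (gtr0_norm x0) expr2 invfM => h.
by rewrite ler_pdivlMr// divfK ?gt_eqF// -ler_pdivlMr// div1r in h *.
Qed.

(** The substitution v -> 1/v exchanges the parts of the integral of atan v / v
    below and above 1, and atan v + atan (1/v) = pi/2 leaves a logarithm. *)
Lemma atan_integralE A : 1 < A ->
  atan_integral A - pi / 2 * ln A = \int[mu]_(x in `]A, +oo[) (atan x^-1 / x).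
Proof.
move=> A1; have A0 : 0 < A by rewrite (lt_trans _ A1).
have -> : atan_integral A = \int[mu]_(v in `]0, A[) (atan v / v).
  have [|_] := @scale_0o R A 1 (fun v => atan v / v) A0 ltr01.
    by move=> y /andP[y0 _]; cont; rewrite gt_eqF.
  rewrite mulr1 => ->; apply: (@eq_Rint _ _ _ mu) => w; rewrite /= in_itv/= => /andP[w0 _].
  by move: (atan _) => q; field; rewrite !gt_eqF.
have j B : L1 mu `]0, B[ (fun v => atan v / v).
  by apply: (@eq_L1 _ _ _ mu _ _ _ _ _ (@atan_quotient_L1 1 B ler01)) => // v _; rewrite mul1r.
have S1 := @Rintegral_itvB R (fun v => atan v / v) (BRight 0) (BLeft A) 1 (j A).
rewrite !bnd_simp A1 in S1; move/(_ ler01 isT) in S1.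
have S2 := @Rintegral_itvB R _ _ _ A atan_inv_L1.
rewrite !bnd_simp (ltW A1) in S2; move/(_ isT isT) in S2.
rewrite -S2 -Rintegral_itv_bndo_bndc; last first.
  by apply: integrableS atan_inv_L1 => //; apply: subset_itvl; rewrite bnd_simp.
rewrite -Rintegral_itv_bndo_bndc// in S1.
have S3 : \int[mu]_(v in `]0, 1[) (atan v / v) = \int[mu]_(x in Iy) (atan x^-1 / x).
  have [|_ ->] := @inversion_01 R (fun v => atan v / v).
    by move=> y /andP[y0 _]; cont; rewrite gt_eqF.
  apply: (@eq_Rint _ _ _ mu) => x /Iy_gt1 x1.
  have x0 : x != 0 by rewrite gt_eqF// (lt_trans _ x1).
  by move: (atan _) => q; clear -x0; field.
have dl (x : R) : 1 < x < A -> is_derive x 1 (@ln R) x^-1.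
  by move=> /andP[x1 _]; apply: is_derive1_ln; rewrite (lt_trans _ x1).
have [||||iV EV] := @ge0_FTC_oo R 1 A _ _ (ln 1) (ln A) A1 _ dl.
- by move=> x /andP[x1 _]; cont; rewrite gt_eqF// (lt_trans _ x1).
- by move=> x /andP[x1 _]; rewrite invr_ge0 ltW// (lt_trans _ x1).
- exact: (der_cvg_right (is_derive1_ln ltr01)).
- exact: (der_cvg_left (is_derive1_ln A0)).
have jg : L1 mu `]1, A[ (fun x => atan x^-1 / x).
  by apply: integrableS atan_inv_L1 => //; apply: subset_itvl; rewrite bnd_simp.
have h (x : R) : `]1, A[%classic x -> pi / 2 * x^-1 - atan x^-1 / x = atan x / x.
  rewrite /= in_itv/= => /andP[x1 _].
  by rewrite -(@atan_inv x) ?(lt_trans _ x1)// -mulrBl addrK.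
move: S1; rewrite -(eq_Rint mu h) RintegralB//; last exact: L1Z.
rewrite RintegralZl// EV ln1 subr0 S3 => S1.
move: S1; move: (Rintegral _ _ _) (Rintegral _ _ _) (Rintegral _ _ _) (pi / 2 * ln A) => a b c d; clear.
by lra.
Qed.

Lemma int_inv_sqr_tail A : 0 < A -> L1 mu `]A, +oo[ (fun x => x ^- 2) /\
  \int[mu]_(x in `]A, +oo[) x ^- 2 = A^-1.
Proof.
move=> A0; have gt0 x : A < x -> 0 < x by exact: lt_trans.
have d x : A < x -> is_derive x 1 (fun x => - x^-1) (x ^- 2).
  by move=> /gt0 x0; der; [rewrite gt_eqF|rewrite mulr1 opprK].
have [||||i E] := @ge0_FTC_oy R A _ _ (- A^-1) 0 _ d.
- by move=> x /gt0 x0; cont; rewrite expf_neq0// gt_eqF.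
- by move=> x /gt0 x0; rewrite invr_ge0 exprn_ge0// ltW.
- have dA : is_derive A 1 (fun x => - x^-1) (A ^- 2).
    by der; [rewrite gt_eqF|rewrite mulr1 opprK].
  exact: (der_cvg_right dA).
- by rewrite -oppr0; apply: cvgN; exact: cvg_inv_y.
by rewrite sub0r opprK in E.
Qed.

Lemma atan_integral_asymp A : 1 < A -> `|atan_integral A - pi / 2 * ln A| <= A^-1.
Proof.
move=> A1; have A0 : 0 < A by rewrite (lt_trans _ A1).
have [i E] := int_inv_sqr_tail A0.
have j : L1 mu `]A, +oo[ (fun x => atan x^-1 / x).
  apply: integrableS atan_inv_L1 => //; apply: subset_itvr.
  by rewrite bnd_simp ltW.
rewrite atan_integralE// -E.
apply: (le_trans (le_normr_Rintegral _ j)) => //; apply: le_Rintegral => //.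
  exact: integrable_abse j.
move=> x; rewrite /= in_itv/= andbT => Ax; have x0 : 0 < x by rewrite (lt_trans _ Ax).
rewrite ger0_norm ?divr_ge0 ?atan_ge0 ?invr_ge0 ?(ltW x0)//.
by rewrite expr2 invfM ler_pM2r ?invr_gt0// atan_le_id// invr_ge0 ltW.
Qed.

Let defect A w := (atan A - atan (A * w)) / (1 + w).

Let norm_defect A w : 0 < A -> 0 < w < 1 -> `|defect A w| <= Num.min (pi / 2) ((A * w)^-1).
Proof.
move=> A0 /andP[w0 w1]; have Aw : 0 < A * w by rewrite mulr_gt0.
have h : atan (A * w) <= atan A by apply: le_atan; rewrite ler_piMr// ltW.
have w2 : 1 <= 1 + w by rewrite lerDl ltW.
apply: (@le_trans _ _ (atan A - atan (A * w))).
  rewrite ger0_norm ?divr_ge0 ?subr_ge0 ?(le_trans ler01)//.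
  by rewrite ler_pdivrMr ?(lt_le_trans ltr01)// ler_peMr// subr_ge0.
rewrite le_min; apply/andP; split.
  apply: (@le_trans _ _ (atan A)); last exact/ltW/atan_ltpi2.
  by rewrite gerBl atan_ge0// ltW.
have := atan_inv Aw; have := atan_ltpi2 A; have := @atan_le_id _ (A * w)^-1.
rewrite invr_ge0 ltW// => /(_ isT).
move: (atan (A * w)^-1) (atan (A * w)) (atan A) (pi / 2) ((A * w)^-1) => a b c d e.
by clear; lra.
Qed.

(** The substitution w = (r - 1) / (r + 1), under which dr / (r (r - 1))
    becomes dw / w - dw / (1 + w). *)
Lemma int_atan_kernel e : 0 < e ->
  L1 mu Iy (fun r => atan_kernel e r / r) /\
  2 * \int[mu]_(r in Iy) (atan_kernel e r / r) =
  2 / pi * (atan_integral (2 * pi / e) + \int[mu]_(w in `]0, 1[) defect (2 * pi / e) w).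
Proof.
move=> e0; have p0 := pi_gt0 R; set A := 2 * pi / e.
have A0 : 0 < A by rewrite divr_gt0// mulr_gt0.
have i1 := @atan_quotient_L1 A 1 (ltW A0).
have i2 : L1 mu `]0, 1[ (defect A).
  apply: (@bounded_L1_itv _ `]0, 1[ (pi / 2)); first exact: mu_oo_lty.
    by rewrite /defect; meas.
  move=> w w01; apply: (le_trans (norm_defect A0 _)); first by rewrite in_itv in w01.
  by rewrite ge_min lexx.
have i3 : L1 mu `]0, 1[ (fun w => pi^-1 * (atan (A * w) / w + defect A w)).
  by apply: L1Z => //; exact: L1D.
have [|H1 H2] := @moebius R (fun r => atan_kernel e r / r).
  move=> y y1; rewrite /atan_kernel; cont; try (by rewrite gt_eqF//; clear -y1; lra).
have h (w : R) : `]0, 1[%classic w -> pi^-1 * (atan (A * w) / w + defect A w) =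
    atan_kernel e ((1 + w) / (1 - w)) / ((1 + w) / (1 - w)) * (2 / (1 - w) ^+ 2).
  rewrite /= in_itv/= => /andP[w0 w1].
  have a1 : 1 - w != 0 by rewrite subr_eq0 gt_eqF.
  have a2 : 1 + w != 0 by rewrite gt_eqF// addr_gt0.
  rewrite /atan_kernel /defect.
  have -> : 2 * pi * (((1 + w) / (1 - w) - 1) / ((1 + w) / (1 - w) + 1)) / e = A * w.
    rewrite /A; genpi; clear -a1 a2 e0; field; rewrite a1 gt_eqF//=.
    by rewrite (_ : 1 + w + (1 - w) = 2) ?pnatr_eq0//; ring.
  move: (atan _) (atan _) => q q'; move: pi p0 => p p0; clear -p0 w0 a1 a2; field.
  have b1 : 1 + w + (1 - w) != 0 by rewrite gt_eqF//; clear; lra.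
  have b2 : 1 + w + -1 * (1 - w) != 0 by rewrite gt_eqF//; clear -w0; lra.
  by rewrite a1 a2 b1 b2 !gt_eqF.
split.
  by rewrite H1; exact: (@eq_L1 _ _ _ mu _ _ _ _ h i3).
rewrite H2 -(eq_Rint mu h) RintegralZl//; last exact: L1D.
by rewrite RintegralD// /atan_integral mulrA.
Qed.

(** Both terms diverge logarithmically. With A = 2 pi / e the second is ln A
    + o(1), the first is - ln (2 e) - gamma + o(1), and 2 e A = 4 pi. *)
Lemma int_atan_kernel_cvg :
  exp_integral (harmonic n) -
  2 * \int[mu]_(r in Iy) (atan_kernel (harmonic n / 2) r / r) @[n --> \oo] -->
  - (ln (4 * pi) + euler_gamma R).
Proof.
have p0 := pi_gt0 R; have h0 n : 0 < harmonic n :> R by rewrite invr_gt0.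
pose A n : R := 4 * pi / harmonic n.
have AE n : 2 * pi / (harmonic n / 2) = A n.
  by rewrite /A; move: (harmonic n) (h0 n) => x x0; genpi; clear -x0; field; rewrite gt_eqF.
have A1 n : 1 < A n.
  rewrite /A ltr_pdivlMr// mul1r (@le_lt_trans _ _ 1)//.
    by rewrite invf_le1 ?ler1n.
  by have := pi_ge2 R; clear; move: (pi) => p h; lra.
have A0 n : 0 < A n by rewrite (lt_trans _ (A1 n)).
have AV n : (A n)^-1 <= harmonic n.
  rewrite /A invf_div ler_pdivrMr ?mulr_gt0// ler_peMr ?ltW//.
  by have := pi_ge2 R; clear; move: (pi) => p h; lra.
have lnA n : ln (A n) = ln (4 * pi) - ln (harmonic n).
  by rewrite /A ln_div ?posrE ?mulr_gt0.
have c1 : atan_integral (A n) - pi / 2 * ln (A n) @[n --> \oo] --> (0 : R).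
  apply: (@cvg_to0 _ _ _ _ _ harmonic); last exact: cvg_harmonic.
  by apply: nearW => n; rewrite (le_trans (atan_integral_asymp _))//.
have c2 : \int[mu]_(w in `]0, 1[) defect (A n) w @[n --> \oo] --> (0 : R).
  have k : L1 mu `]0, 1[ (fun=> pi / 2 : R) by apply: cst_L1; exact: mu_oo_lty.
  have [||||_] := @Rdominated_cvg _ _ _ mu `]0, 1[ (fun n => defect (A n)) (fun=> 0) _ _ _ _ k.
  - by [].
  - by move=> n; rewrite /defect; meas.
  - move=> w; rewrite /= in_itv/= => w01; have /andP[w0 w1] := w01.
    apply: (@cvg_to0 _ _ _ _ _ (fun n => w^-1 * harmonic n)).
      apply: nearW => n; apply: (le_trans (norm_defect (A0 n) w01)).
      rewrite ge_min; apply/orP; right; rewrite invfM mulrC ler_pM2l ?invr_gt0//.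
    by rewrite -[X in _ --> X](mulr0 w^-1); apply: cvgM; [exact: cvg_cst|exact: cvg_harmonic].
  - move=> n w; rewrite /= in_itv/= => w01; apply: (le_trans (norm_defect (A0 n) w01)).
    by rewrite ge_min lexx.
  by rewrite Rintegral_cst// mul0r.
have E n : exp_integral (harmonic n) -
    2 * \int[mu]_(r in Iy) (atan_kernel (harmonic n / 2) r / r) =
    (exp_integral (harmonic n) + ln (harmonic n)) - ln (4 * pi) -
    2 / pi * ((atan_integral (A n) - pi / 2 * ln (A n)) +
       \int[mu]_(w in `]0, 1[) defect (A n) w).
  have e0 : 0 < harmonic n / 2 :> R by rewrite divr_gt0.
  have [_ ->] := int_atan_kernel e0; rewrite AE lnA.
  move: (exp_integral _) (atan_integral _) (Rintegral _ _ _) (ln (4 * pi)) (ln _).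
  by move: (pi) p0 => p p0 a b c d f; clear -p0; field; rewrite gt_eqF.
under eq_fun do rewrite E.
have -> : - (ln (4 * pi) + euler_gamma R) = - euler_gamma R - ln (4 * pi) - 2 / pi * (0 + 0).
  by rewrite addr0 mulr0 subr0 opprD addrC.
apply: cvgB; first by apply: cvgB; [exact: exp_integral_cvg|exact: cvg_cst].
by apply: cvgM; [exact: cvg_cst|exact: cvgD].
Qed.

End Arctan.

(** * Removing the cutoff *)
Section Limit.
Variable R : realType.
Notation mu := (@lebesgue_measure R).
Notation mu2 := (mu \x mu)%E.
Notation Iy := (`]1%R, +oo[%classic : set R).
Notation D2 := (Iy `*` Iy).
Implicit Types (e r x y : R).

Lemma powRD_gt0 x (a b : R) : 0 < x -> x `^ (a + b) = x `^ a * x `^ b.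
Proof. by move=> x0; rewrite powRD//; apply/implyP => _; rewrite gt_eqF. Qed.

Lemma powR_54_L1 : L1 mu Iy (fun r => r `^ (- (5 / 4))).
Proof.
have [|[H _] _] := @inversion_01 R (fun y => y `^ (- (3 / 4))).
  by move=> y /andP[y0 _]; cont.
apply: (@eq_L1 _ _ _ mu Iy _ _ _ _ (H (@int_powR_01 R).1)) => // x /Iy_gt1 x1.
have x0 : 0 < x by rewrite (lt_trans _ x1).
have -> : x^-1 = x `^ (- 1) by rewrite powR_inv1// ltW.
rewrite -powRrM (_ : x ^- 2 = x `^ (- 2%:R)); last by rewrite -powR_mulrn ?ltW// -powRN.
rewrite -powRD_gt0//; by congr powR; field.
Qed.

Lemma tr_delta_div r : 1 < r -> tr_delta r / r = r `^ (- 2^-1) * local_kernel 0 r.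
Proof.
move=> r1; have r0 : 0 < r by rewrite (lt_trans _ r1).
rewrite tr_delta_local// mulrAC -(powR_inv1 (ltW r0)) -powRD_gt0//.
by congr (_ `^ _ * _); field.
Qed.

(** The limit of the arc tangent part of the radial kernel when the cutoff
    is removed, and the density of the archimedean distribution. *)
Definition spectral_density r := (r - r^-1)^-1.

Lemma spectral_densityE r : 1 < r -> spectral_density r = r / ((r - 1) * (r + 1)).
Proof.
move=> r1; rewrite /spectral_density.
have h1 : r != 0 by rewrite gt_eqF// (lt_trans _ r1).
have h2 : (r - 1) * (r + 1) != 0 by rewrite gt_eqF// mulr_gt0//; clear -r1; lra.
rewrite (_ : r - r^-1 = (r - 1) * (r + 1) / r) ?invf_div//.
by move: h1; clear; move=> h1; field.
Qed.

Let atan_args e r : 0 < e -> 1 < r ->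
  [/\ 0 < 2 * pi * ((r - 1) / (r + 1)) / e, 0 < 2 * pi / e, 0 < r - 1 & 0 < r + 1].
Proof.
move=> e0 r1; have p0 := pi_gt0 R.
have a : 0 < r - 1 by rewrite subr_gt0.
have b : 0 < r + 1 by rewrite addr_gt0// (lt_trans _ r1).
have c : 0 < 2 * pi :> R by rewrite mulr_gt0.
by split=> //; rewrite ?divr_gt0// mulr_gt0// divr_gt0.
Qed.

Let half_turn_kernel r : 1 < r ->
  pi^-1 * (pi / 2 / (r - 1) + pi / 2 / (r + 1)) = spectral_density r.
Proof.
move=> r1; rewrite spectral_densityE//; genpi.
have a : r - 1 != 0 by rewrite subr_eq0 gt_eqF.
have b : r + 1 != 0 by rewrite gt_eqF// addr_gt0// (lt_trans _ r1).
by clear -a b p_gt0; field; rewrite a b gt_eqF.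
Qed.

(** The density is what replacing both arc tangents by pi / 2 gives. *)
Lemma atan_kernel_bound e r : 0 < e -> 1 < r -> 0 <= atan_kernel e r <= spectral_density r.
Proof.
move=> e0 r1; have [u0 v0 a0 b0] := atan_args e0 r1.
have p0 : 0 < pi^-1 :> R by rewrite invr_gt0 pi_gt0.
have hu := atan_ge0 (ltW u0); have hv := atan_ge0 (ltW v0).
rewrite /atan_kernel; apply/andP; split.
  by rewrite mulr_ge0 ?(ltW p0)// addr_ge0// divr_ge0// ltW.
rewrite -half_turn_kernel// ler_pM2l//.
by apply: lerD; rewrite ler_pM2r ?invr_gt0// ltW// atan_ltpi2.
Qed.

Lemma atan_kernel_limit r : 1 < r ->
  atan_kernel (harmonic n / 2) r @[n --> \oo] --> spectral_density r.
Proof.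
move=> r1; pose K := pi^-1 * ((2 * pi * ((r - 1) / (r + 1)))^-1 / (r - 1) + (2 * pi)^-1 / (r + 1)).
apply: cvg_of_sub; apply: (@cvg_to0 _ _ _ _ _ (fun n => K / 2 * harmonic n)); last first.
  by rewrite -[X in _ --> X](mulr0 (K / 2)); apply: cvgM; [exact: cvg_cst|exact: cvg_harmonic].
apply: nearW => n; have h0 : 0 < harmonic n / 2 :> R by rewrite divr_gt0// invr_gt0.
rewrite mulrAC -mulrA; move: (harmonic n / 2) h0 => e e0.
have [u0 v0 a0 b0] := atan_args e0 r1.
have p0 : 0 < pi^-1 :> R by rewrite invr_gt0 pi_gt0.
have E x : 0 < x -> pi / 2 - atan x = atan x^-1 by move=> /atan_inv <-; rewrite addrC addKr.
have L x : 0 < x -> 0 <= atan x^-1 <= x^-1.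
  by move=> x0; rewrite atan_ge0 ?atan_le_id ?invr_ge0 ?ltW.
rewrite distrC -half_turn_kernel// /atan_kernel -mulrBr opprD addrACA -!mulrBl !E//.
rewrite ger0_norm; last first.
  have /andP[hu _] := L _ u0; have /andP[hv _] := L _ v0.
  by rewrite mulr_ge0 ?(ltW p0)// addr_ge0// divr_ge0// ltW.
rewrite /K -[leRHS]mulrA ler_pM2l// [leRHS]mulrDl.
apply: lerD; rewrite [leRHS]mulrAC ler_pM2r ?invr_gt0//.
  by have /andP[_] := L _ u0; rewrite invf_div mulrC.
by have /andP[_] := L _ v0; rewrite invf_div mulrC.
Qed.

(** Near r = 1 the zero of X compensates the pole; for r > 2 the density is
    at most 2 / r. *)
Let regular_arith (X C M r : R) : 0 <= C -> 0 <= M -> 1 < r ->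
  X <= (C + M) * (r - 1) -> X <= 3 * M ->
  X * (r / ((r - 1) * (r + 1))) <= (2 * C + 8 * M) * r^-1.
Proof.
move=> C0 M0 r1 X1 X2; have r0 : 0 < r by rewrite (lt_trans _ r1).
have d0 : 0 < (r - 1) * (r + 1) by rewrite mulr_gt0//; clear -r1; lra.
rewrite mulrA ler_pdivrMr// mulrAC ler_pdivlMr//.
have [r2|r2] := lerP r 2.
  apply: (@le_trans _ _ ((C + M) * (r - 1) * r * r)).
    by rewrite !ler_wpM2r// ltW.
  rewrite (_ : _ * r * r = (r - 1) * ((C + M) * r * r)); last by ring.
  rewrite [leRHS]mulrCA ler_pM2l ?subr_gt0//.
  apply: (@le_trans _ _ ((C + M) * (2 * (r + 1)))); last first.
    rewrite (_ : (2 * C + 8 * M) * (r + 1) = (C + M) * (2 * (r + 1)) + 6 * M * (r + 1)); last by ring.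
    by rewrite lerDl !mulr_ge0// addr_ge0// ltW.
  rewrite -mulrA ler_wpM2l ?addr_ge0//; clear -r2 r0; nra.
apply: (@le_trans _ _ (3 * M * r * r)); first by rewrite !ler_wpM2r// ltW.
apply: (@le_trans _ _ (6 * M * ((r - 1) * (r + 1)))).
  rewrite (_ : 3 * M * r * r = M * (3 * r * r)); last by ring.
  rewrite (_ : 6 * M * _ = M * (6 * ((r - 1) * (r + 1)))); last by ring.
  rewrite ler_wpM2l//; clear -r2; nra.
rewrite ler_pM2r//; clear -M0 C0; lra.
Qed.

Section Fixed.
Variables (F : R -> R) (M C : R).
Hypotheses (M0 : 0 <= M) (C0 : 0 <= C) (mF : measurable_fun setT F).
Hypothesis FM : forall x, 0 < x -> `|F x| <= M.
Hypothesis Fsym : forall x, 0 < x -> F x^-1 = F x.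
Hypothesis Fcont : forall x, 0 < x -> {for x, continuous F}.
Hypothesis FC : forall x, 1 < x -> `|F x - F 1| <= C * (x - 1).

(** The value of the trace functional at a function invariant under
    inversion, as an integral over r > 1. *)
Definition trace_form := 2 * \int[mu]_(r in Iy) (F r * (tr_delta r / r)) -
  (ln (4 * pi) + euler_gamma R) * F 1 -
  2 * \int[mu]_(r in Iy) ((F r * r `^ (- 2^-1) - F 1 / r) * spectral_density r).

Lemma local_term_bound e r : 0 <= e -> 1 < r ->
  `|F r * r `^ (- 2^-1) * local_kernel e r| <= 16 * M * r `^ (- (5 / 4)).
Proof.
move=> e0 r1; have r0 : 0 < r by rewrite (lt_trans _ r1).
have -> : r `^ (- (5 / 4)) = r `^ (- 2^-1) * r `^ (- (3 / 4)).
  by rewrite -powRD_gt0//; congr powR; field.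
rewrite -mulrA normrM normrM (ger0_norm (powR_ge0 _ _)).
rewrite (_ : 16 * M * _ = M * (r `^ (- 2^-1) * (16 * r `^ (- (3 / 4))))); last by ring.
by rewrite ler_pM ?mulr_ge0 ?powR_ge0 ?FM// ler_wpM2l ?powR_ge0// local_kernel_le.
Qed.

Lemma local_term_L1 : L1 mu Iy (fun r => F r * (tr_delta r / r)).
Proof.
have i : L1 mu Iy (fun r => 16 * M * r `^ (- (5 / 4))) by apply: L1Z => //; exact: powR_54_L1.
have h r : Iy r -> F r * r `^ (- 2^-1) * local_kernel 0 r = F r * (tr_delta r / r).
  by move=> /Iy_gt1 r1; rewrite tr_delta_div// mulrA.
apply: (@eq_L1 _ _ _ mu Iy _ _ _ h) => //.
apply: dominated_L1 i _ => //; last by move=> r /Iy_gt1; exact: local_term_bound.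
apply: (continuous_exhausts_measurable (exhausts_oy 1)) => r /Iy_gt1 r1.
have r0 : 0 < r by rewrite (lt_trans _ r1).
apply: contM; last exact: local_kernel_continuous.
by apply: contM; [exact: Fcont|cont].
Qed.

(** Subtracting F(1)/r removes the pole of the density at r = 1; what is
    left decays like r^(-3/2). *)
Lemma regular_term_bound r : 1 < r ->
  `|F r * r `^ (- 2^-1) - F 1 / r| * spectral_density r <= (2 * C + 8 * M) * r `^ (- (5 / 4)).
Proof.
move=> r1; have r0 : 0 < r by rewrite (lt_trans _ r1).
have -> : r `^ (- (5 / 4)) = r `^ (- 2^-1) * r `^ (- (3 / 4)).
  by rewrite -powRD_gt0//; congr powR; field.
have s2 : r^-1 = r `^ (- 2^-1) * r `^ (- 2^-1).
  by rewrite -powRD_gt0// -(powR_inv1 (ltW r0)); congr powR; lra.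
have k1 : r^-1 <= r `^ (- (3 / 4)).
  by rewrite -(powR_inv1 (ltW r0)) ler_powR ?ltW//; lra.
have s0 : 0 < r `^ (- 2^-1) by rewrite powR_gt0.
have s1 : r^-1 <= r `^ (- 2^-1).
  by rewrite -(powR_inv1 (ltW r0)) ler_powR ?ltW//; lra.
have s3 : r `^ (- 2^-1) <= 1.
  by rewrite -[leRHS](powRr0 r) ler_powR ?ltW//; lra.
move: (r `^ (- 2^-1)) (r `^ (- (3 / 4))) s0 s1 s2 s3 k1 => s k s0 s1 s2 s3 k1.
have h1 := FC r1; have h2 := FM r0; have h3 := FM (@ltr01 R).
have -> : F r * s - F 1 / r = s * ((F r - F 1) + F 1 * (1 - s)) by rewrite s2; ring.
rewrite spectral_densityE// normrM (gtr0_norm s0) -mulrA [leRHS]mulrCA ler_pM2l//.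
have w0 : 0 <= 2 * C + 8 * M by rewrite addr_ge0// mulr_ge0.
apply: (@le_trans _ _ ((2 * C + 8 * M) * r^-1)); last by rewrite ler_wpM2l.
have X1 : `|F r - F 1 + F 1 * (1 - s)| <= (C + M) * (r - 1).
  apply: (le_trans (ler_normD _ _)); rewrite mulrDl lerD// normrM ler_pM//.
  rewrite ger0_norm ?subr_ge0//.
  have : 1 - r^-1 <= r - 1.
    rewrite -subr_ge0 (_ : _ - _ = (r - 1) ^+ 2 / r) ?divr_ge0 ?sqr_ge0 ?(ltW r0)//.
    by field; rewrite gt_eqF.
  by move: (r^-1) s1 => i s1; lra.
have X2 : `|F r - F 1 + F 1 * (1 - s)| <= 3 * M.
  apply: (le_trans (ler_normD _ _)); rewrite (_ : 3 * M = (M + M) + M); last by ring.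
  apply: lerD; first exact: (le_trans (ler_normB _ _) (lerD h2 h3)).
  rewrite normrM -[leRHS]mulr1 ler_pM// ger0_norm ?subr_ge0//.
  by rewrite gerBl ltW.
exact: regular_arith.
Qed.

Hypothesis Fpos : forall e, 0 < e ->
  \int[mu2]_(p in D2) cutoff_kernel F e p.1 p.2 <= F 1 * exp_integral (2 * e).

(** The hypothesis is passed to the limit e -> 0, along e = 1 / (2 (n + 1)),
    with the majorant r^(-5/4). *)
Lemma trace_form_ge0 : 0 <= trace_form.
Proof.
have iD : L1 mu Iy (fun r => (2 * C + 8 * M) * r `^ (- (5 / 4))).
  by apply: L1Z => //; exact: powR_54_L1.
have iE : L1 mu Iy (fun r => 16 * M * r `^ (- (5 / 4))) by apply: L1Z => //; exact: powR_54_L1.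
have h0 n : 0 < harmonic n / 2 :> R by rewrite divr_gt0// invr_gt0.
have gt0 r : 1 < r -> 0 < r by exact: lt_trans.
pose P r := F r * r `^ (- 2^-1) - F 1 / r.
have mP : measurable_fun Iy P.
  by apply: measurable_funTS; rewrite /P; meas.
have mak e : measurable_fun Iy (atan_kernel e).
  by apply: measurable_funTS; rewrite /atan_kernel; meas.
have mlk e : 0 <= e -> measurable_fun Iy (local_kernel e).
  move=> e0; apply: (continuous_exhausts_measurable (exhausts_oy 1)) => r /Iy_gt1 r1.
  exact: local_kernel_continuous.
have bP e r : 0 < e -> Iy r -> `|P r * atan_kernel e r| <= (2 * C + 8 * M) * r `^ (- (5 / 4)).
  move=> e0 /Iy_gt1 r1; apply: le_trans (regular_term_bound r1).
  have /andP[k0 k1] := atan_kernel_bound e0 r1.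
  by rewrite normrM (ger0_norm k0) ler_wpM2l.
have bL e r : 0 <= e -> Iy r -> `|F r * r `^ (- 2^-1) * local_kernel e r| <= 16 * M * r `^ (- (5 / 4)).
  by move=> e0 /Iy_gt1; exact: local_term_bound.
have mL e : 0 <= e -> measurable_fun Iy (fun r => F r * r `^ (- 2^-1) * local_kernel e r).
  by move=> e0; apply: measM; [apply: measurable_funTS; meas|exact: mlk].
have [||||_ c1] := @Rdominated_cvg _ _ _ mu Iy (fun n r => P r * atan_kernel (harmonic n / 2) r)
    (fun r => P r * spectral_density r) _ _ _ _ iD.
- by [].
- by move=> n; exact: (measM mP (mak _)).
- by move=> r /Iy_gt1 r1; apply: cvgM; [exact: cvg_cst|exact: atan_kernel_limit].
- by move=> n r; exact: bP.
have [||||_ c2] := @Rdominated_cvg _ _ _ mu Iy (fun n r => F r * r `^ (- 2^-1) * local_kernel (harmonic n / 2) r)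
    (fun r => F r * r `^ (- 2^-1) * local_kernel 0 r) _ _ _ _ iE.
- by [].
- by move=> n; apply: mL; exact: ltW.
- move=> r /Iy_gt1 r1; apply: cvgM; first exact: cvg_cst.
  apply: cvg_of_sub; apply: (@cvg_to0 _ _ _ _ _ (fun n => 2 * (r + 1) * harmonic n)); last first.
    by rewrite -[X in _ --> X](mulr0 (2 * (r + 1))); apply: cvgM; [exact: cvg_cst|exact: cvg_harmonic].
  apply: nearW => n.
  apply: (le_trans (local_kernel_lipschitz (ltW (h0 n)) (lexx 0) r1)).
  rewrite subr0 gtr0_norm// le_eqVlt; apply/orP; left; apply/eqP.
  by move: (harmonic n) => h; field.
- by move=> n r; apply: bL; exact: ltW.
have E n : \int[mu2]_(p in D2) cutoff_kernel F (harmonic n / 2) p.1 p.2 =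
   2 * \int[mu]_(r in Iy) (P r * atan_kernel (harmonic n / 2) r) +
   F 1 * (2 * \int[mu]_(r in Iy) (atan_kernel (harmonic n / 2) r / r)) -
   2 * \int[mu]_(r in Iy) (F r * r `^ (- 2^-1) * local_kernel (harmonic n / 2) r).
  move: (harmonic n / 2) (h0 n) => e e0.
  have [_ _ ->] := cutoff_form_fold M0 e0 mF FM Fsym Fcont.
  have i1 : L1 mu Iy (fun r => P r * atan_kernel e r).
    by apply: dominated_L1 iD _ => //; [exact: (measM mP (mak _))|move=> r; exact: bP].
  have i2 := (int_atan_kernel e0).1.
  have i2' : L1 mu Iy (fun r => F 1 * (atan_kernel e r / r)) by exact: L1Z.
  have i3 : L1 mu Iy (fun r => F r * r `^ (- 2^-1) * local_kernel e r).
    by apply: dominated_L1 iE _ => //; [exact: (mL _ (ltW e0))|move=> r; apply: bL; exact: ltW].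
  have h r : Iy r -> P r * atan_kernel e r + F 1 * (atan_kernel e r / r) -
       F r * r `^ (- 2^-1) * local_kernel e r = F r * r `^ (- 2^-1) * radial_kernel e r.
    by move=> /Iy_gt1 r1; rewrite radial_kernelE// /P; ring.
  rewrite -(eq_Rint mu h) RintegralB//; last exact: L1D.
  rewrite RintegralD// RintegralZl//; ring.
have E2 : trace_form = 2 * \int[mu]_(r in Iy) (F r * r `^ (- 2^-1) * local_kernel 0 r)
   + F 1 * - (ln (4 * pi) + euler_gamma R) - 2 * \int[mu]_(r in Iy) (P r * spectral_density r).
  rewrite /trace_form mulrN [F 1 * _]mulrC; congr (2 * _ - _ - _).
  by apply: (@eq_Rint _ _ _ mu) => r /Iy_gt1 r1; rewrite tr_delta_div// mulrA.
rewrite E2.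
apply: (@ler_cvg_to _ \oo _ _ (fun=> 0) (fun n =>
   2 * \int[mu]_(r in Iy) (F r * r `^ (- 2^-1) * local_kernel (harmonic n / 2) r) +
   F 1 * (exp_integral (harmonic n) -
     2 * \int[mu]_(r in Iy) (atan_kernel (harmonic n / 2) r / r)) -
   2 * \int[mu]_(r in Iy) (P r * atan_kernel (harmonic n / 2) r))).
- exact: cvg_cst.
- apply: cvgB; [apply: cvgD|].
  + by apply: cvgM; [exact: cvg_cst|exact: c2].
  + by apply: cvgM; [exact: cvg_cst|exact: int_atan_kernel_cvg].
  + by apply: cvgM; [exact: cvg_cst|exact: c1].
apply: nearW => n; have := Fpos (h0 n).
have -> : 2 * (harmonic n / 2) = harmonic n :> R by move: (harmonic n) => h; field.
rewrite E.
move: (exp_integral _) (Rintegral _ _ _) (Rintegral _ _ _) (Rintegral _ _ _) (F 1) => a b c d f.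
by lra.
Qed.

End Fixed.
End Limit.

(** * The Gamma function on the line Re z = 1/4 *)
Section GammaWeight.
Variable R : realType.
Notation mu := (@lebesgue_measure R).
Notation I0 := (`]0%R, +oo[%classic : set R).
Notation Iy := (`]1%R, +oo[%classic : set R).
Implicit Types (a b c p q s v x y : R).

Definition gamma_weight p x := x `^ p * expR (- x).

Lemma gamma_weight_ge0 p x : 0 <= gamma_weight p x.
Proof. by rewrite mulr_ge0 ?powR_ge0 ?expR_ge0. Qed.

Let cube_le_exp x : 0 <= x -> (1 + x) ^+ 3 * expR (- x) <= 27.
Proof.
move=> x0; have h := expR_ge1Dx (x / 3).
have e : expR (- x) * expR (x / 3) ^+ 3 = 1.
  by rewrite -expRM_natl (_ : 3%:R * (x / 3) = x) 1?mulrC ?expRxMexpNx_1//; field.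
have -> : 27 = 27 * (expR (- x) * expR (x / 3) ^+ 3) by rewrite e mulr1.
rewrite mulrCA mulrC ler_wpM2l ?expR_ge0//.
have -> : (1 + x) ^+ 3 = 27 * ((1 + x) / 3) ^+ 3 by field.
rewrite ler_pM2l// lerXn2r// ?nnegrE ?expR_ge0//; last by apply: le_trans h; lra.
by rewrite divr_ge0// addr_ge0.
Qed.

(** Since (1 + x)^3 e^(-x) is bounded, the weight is dominated by a multiple of
    the derivative of (x / (1 + x))^(p+1), whose limits at the ends are known. *)
Lemma gamma_weight_L1 p : -1 < p <= 1 -> L1 mu I0 (gamma_weight p).
Proof.
move=> /andP[p1 p2]; have q0 : 0 < p + 1 by rewrite -subr_gt0 opprK in p1.
have d x : 0 < x -> is_derive x 1 (fun x => (p + 1)^-1 * (x / (1 + x)) `^ (p + 1))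
    ((x / (1 + x)) `^ p * (1 + x) ^- 2).
  move=> x0; have x1 : 0 < 1 + x by rewrite addr_gt0.
  der; [by rewrite divr_gt0|by rewrite gt_eqF|].
  rewrite addrK; move: (_ `^ p) => r; field.
  by rewrite !gt_eqF.
have c x : 0 < x -> {for x, continuous (fun x => (x / (1 + x)) `^ p * (1 + x) ^- 2)}.
  move=> x0; have x1 : 0 < 1 + x by rewrite addr_gt0.
  by cont; rewrite ?divr_gt0 ?expf_neq0// gt_eqF.
have ratio : x / (1 + x) @[x --> +oo] --> (1 : R).
  apply: cvg_of_sub; apply: (@cvg_to0 _ _ _ _ _ (fun x => x^-1)); last exact: cvg_inv_y.
  near=> x; have x0 : 0 < x by near: x; apply: nbhs_pinfty_gt; exact: num_real.
  have x1 : 0 < 1 + x by rewrite addr_gt0.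
  have -> : x / (1 + x) - 1 = - (1 + x)^-1 by field; rewrite gt_eqF.
  by rewrite normrN gtr0_norm ?invr_gt0// lef_pV2 ?posrE// lerDr.
have [|||i _] := @ge0_FTC_oy R 0 _ _ 0 (p + 1)^-1 c d.
- by move=> x x0; rewrite mulr_ge0 ?powR_ge0// invr_ge0 exprn_ge0// addr_ge0// ltW.
- apply: (@cvg_to0 _ _ _ _ _ (fun x => (p + 1)^-1 * x `^ (p + 1))); last first.
    by rewrite -[X in _ --> X](mulr0 (p + 1)^-1); apply: cvgM; [exact: cvg_cst|exact: powR_cvg0].
  near=> x; have x0 : 0 < x by near: x; exact: nbhs_right_gt.
  rewrite ger0_norm ?mulr_ge0 ?powR_ge0 ?invr_ge0 ?(ltW q0)// ler_pM2l ?invr_gt0//.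
  rewrite ge0_ler_powR ?(ltW q0)// ?nnegrE ?divr_ge0 ?addr_ge0 ?(ltW x0)//.
  rewrite ler_pdivrMr ?addr_gt0// ler_peMr ?(ltW x0)//.
  by rewrite lerDl ltW.
- rewrite -[X in _ --> X]mulr1; apply: cvgM; first exact: cvg_cst.
  have e : 1 `^ (p + 1) = 1 :> R by rewrite powR1.
  rewrite -[X in _ --> X]e.
  have h : {for (1 : R), continuous (fun y : R => y `^ (p + 1))} by cont.
  exact: (cvg_comp _ _ ratio h).
have j : L1 mu I0 (fun x => 27 * ((x / (1 + x)) `^ p * (1 + x) ^- 2)) by apply: L1Z.
apply: dominated_L1 j _ => //; first by apply: measurable_funTS; rewrite /gamma_weight; meas.
move=> x /I0_gt0 x0; have x1 : 0 < 1 + x by rewrite addr_gt0.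
rewrite ger0_norm ?gamma_weight_ge0// /gamma_weight.
have -> : x `^ p = (x / (1 + x)) `^ p * (1 + x) `^ p.
  by rewrite -powRM ?divr_ge0 ?(ltW x0) ?(ltW x1)// divfK ?gt_eqF.
rewrite -[leLHS]mulrA [leRHS]mulrCA ler_wpM2l ?powR_ge0// ler_pdivlMr ?exprn_gt0//.
apply: le_trans (cube_le_exp (ltW x0)).
rewrite mulrAC [leLHS]mulrC [leRHS]mulrC ler_wpM2l ?expR_ge0//.
rewrite [(1 + x) ^+ 3]exprS ler_wpM2r ?exprn_ge0 ?(ltW x1)//.
by rewrite -[leRHS]powRr1 ?(ltW x1)// ler_powR// lerDl ltW.
Unshelve. all: end_near. Qed.

(** From ln y < y, applied to x and to x^(-1/8). *)
Lemma norm_ln_le x : 0 < x -> `|ln x| <= x + 8 * x `^ (- 8^-1).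
Proof.
move=> x0; have h1 := ln_sublinear x0.
have h2 : ln (x `^ (- 8^-1)) < x `^ (- 8^-1) by apply: ln_sublinear; rewrite powR_gt0.
rewrite ln_powR in h2.
have h3 : 0 < x `^ (- 8^-1) by rewrite powR_gt0.
rewrite ler_norml; move: (ln x) (x `^ _) h1 h2 h3 => l r h1 h2 h3.
by apply/andP; split; lra.
Qed.

Lemma expRN_le_powR y : 0 < y -> expR (- y) <= y `^ (- 8^-1).
Proof.
move=> y0; rewrite powRN expRN lef_pV2 ?posrE ?expR_gt0 ?powR_gt0//.
have [y1|y1] := lerP y 1.
  apply: (@le_trans _ _ 1); last by apply: le_trans (expR_ge1Dx y); rewrite lerDl ltW.
  have e : 1 `^ 8^-1 = 1 :> R by rewrite powR1.
  by rewrite -[leRHS]e ge0_ler_powR ?nnegrE ?(ltW y0)//.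
apply: (@le_trans _ _ y).
  by rewrite -[leRHS](powRr1 (ltW y0)) ler_powR ?(ltW y1)//; lra.
by apply: le_trans (expR_ge1Dx y); rewrite lerDr.
Qed.

Let cvg_powRN8 : x `^ (- 8^-1) @[x --> +oo] --> (0 : R).
Proof.
under eq_fun do rewrite powRN.
apply/gtr0_cvgV0; first by near=> x; rewrite powR_gt0//; near: x; apply: nbhs_pinfty_gt; exact: num_real.
apply/cvgryPge => A; near=> x.
have x0 : 0 < x by near: x; apply: nbhs_pinfty_gt; exact: num_real.
have xA : `|A| ^+ 8 <= x by near: x; apply: nbhs_pinfty_ge; exact: num_real.
apply: (le_trans (ler_norm _)).
have -> : `|A| = (`|A| ^+ 8) `^ 8^-1.
  by rewrite -powR_mulrn// -powRrM divff ?powRr1// pnatr_eq0.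
by rewrite ge0_ler_powR ?nnegrE ?exprn_ge0 ?(ltW x0).
Unshelve. all: end_near. Qed.

(** Integrable over v > 0, while the factor x^(-1/8) that it costs is
    integrable against x^(-3/4) e^(-x). *)
Definition frullani_decay v := 4 * (1 + v) `^ (- (9 / 8)).

Lemma frullani_decay_L1 : L1 mu I0 frullani_decay.
Proof.
have d x : 0 < x -> is_derive x 1 (fun x => - 32 * (1 + x) `^ (- 8^-1)) (frullani_decay x).
  move=> x0; have x1 : 0 < 1 + x by rewrite addr_gt0.
  der => //; rewrite /frullani_decay (_ : - 8^-1 - 1 = - (9 / 8)); last by field.
  by move: (_ `^ _) => r; field.
have [||||//] := @ge0_FTC_oy R 0 _ _ (- 32 * (1 + 0) `^ (- 8^-1)) (- 32 * 0) _ d.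
- by move=> x x0; rewrite /frullani_decay; cont; rewrite addr_gt0.
- by move=> x _; rewrite mulr_ge0 ?powR_ge0.
- have c : {for (0 : R), continuous (fun x => - 32 * (1 + x) `^ (- 8^-1))}.
    by cont; rewrite addr0.
  exact: cvg_at_right_filter c.
apply: cvgM; first exact: cvg_cst.
apply: (@cvg_to0 _ _ _ _ _ (fun x => x `^ (- 8^-1))); last exact: cvg_powRN8.
near=> x; have x0 : 0 < x by near: x; apply: nbhs_pinfty_gt; exact: num_real.
have x1 : 0 < 1 + x by rewrite addr_gt0.
rewrite ger0_norm ?powR_ge0//.
rewrite !powRN lef_pV2 ?posrE ?powR_gt0// ge0_ler_powR ?nnegrE ?invr_ge0 ?(ltW x0) ?(ltW x1)//.
by rewrite lerDr.
Unshelve. all: end_near. Qed.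

Let two_powR : 2 `^ (9 / 8) <= 4 :> R.
Proof.
have -> : 4 = 2 `^ 2%:R :> R by rewrite powR_mulrn//; ring.
by rewrite ler_powR ?ler1n//; lra.
Qed.

(** The difference of exponentials is at most (1 + x) v for v <= 1; for v >
    1 each exponential is bounded separately by e^(-y) <= y^(-1/8). *)
Lemma frullani_bound x v : 0 < x -> 0 < v ->
  `|(expR (- v) - expR (- (x * v))) / v| <= (x + 2 + x `^ (- 8^-1)) * frullani_decay v.
Proof.
move=> x0 v0; have r0 := powR_ge0 x (- 8^-1).
have k0 : 0 < (1 + v) `^ (- (9 / 8)) by rewrite powR_gt0// addr_gt0.
rewrite normrM normfV (gtr0_norm v0).
have [v1|v1] := lerP v 1.
  have k1 : 1 <= frullani_decay v.
    rewrite /frullani_decay powRN -ler_pdivrMr ?invr_gt0 ?powR_gt0 ?addr_gt0//.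
    rewrite invrK mul1r; apply: le_trans two_powR.
    by rewrite ge0_ler_powR ?nnegrE ?addr_ge0 ?(ltW v0)// -lerBrDl; lra.
  apply: (@le_trans _ _ (x + 2 + x `^ (- 8^-1))); last first.
    by rewrite ler_peMr// !addr_ge0// ltW.
  rewrite ler_pdivrMr//.
  apply: (le_trans (expRN_lipschitz (ltW v0) (mulr_ge0 (ltW x0) (ltW v0)))).
  rewrite -[X in `|X - _|]mul1r -mulrBl normrM (gtr0_norm v0) ler_pM2r//.
  apply: (le_trans (ler_normB _ _)); rewrite normr1 (gtr0_norm x0).
  by move: (_ `^ _) r0 => r r0; lra.
have E : v `^ (- 8^-1) / v = v `^ (- (9 / 8)).
  by rewrite -(powR_inv1 (ltW v0)) -powRD_gt0//; congr powR; field.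
apply: (@le_trans _ _ ((1 + x `^ (- 8^-1)) * v `^ (- (9 / 8)))).
  rewrite -E mulrA ler_pM2r ?invr_gt0//.
  apply: (le_trans (ler_normB _ _)); rewrite !ger0_norm ?expR_ge0// mulrDl mul1r.
  rewrite -powRM ?(ltW x0) ?(ltW v0)//.
  by apply: lerD; apply: expRN_le_powR => //; rewrite mulr_gt0.
apply: ler_pM; rewrite ?addr_ge0 ?powR_ge0//.
  by move: (_ `^ _) r0 => r r0; lra.
rewrite /frullani_decay !powRN -[leLHS]mul1r ler_pdivrMr ?powR_gt0// mulrAC.
rewrite ler_pdivlMr ?powR_gt0 ?addr_gt0// mul1r.
apply: (@le_trans _ _ ((2 * v) `^ (9 / 8))).
  by rewrite ge0_ler_powR ?nnegrE ?mulr_ge0 ?addr_ge0 ?(ltW v0)//; lra.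
by rewrite powRM ?(ltW v0)// ler_wpM2r ?powR_ge0// two_powR.
Qed.

End GammaWeight.

Section GammaLine.
Variable R : realType.
Notation mu := (@lebesgue_measure R).
Notation I0 := (`]0%R, +oo[%classic : set R).
Notation Iy := (`]1%R, +oo[%classic : set R).
Notation w := (gamma_weight (- (3 / 4))).
Implicit Types (a b c p q s v x y : R).

Let w_L1 : L1 mu I0 (w : R -> R).
Proof. by apply: gamma_weight_L1; apply/andP; split; lra. Qed.

Let w_shift x p : 0 < x -> w x * x `^ p = gamma_weight (p - 3 / 4) x.
Proof. by move=> x0; rewrite /gamma_weight mulrAC -powRD_gt0// addrC. Qed.

Let wln x := w x * (`|x| + 8 * x `^ (- 8^-1)).

Let wln_L1 : L1 mu I0 wln.
Proof.
have i1 : L1 mu I0 (@gamma_weight R (1 - 3 / 4)) by apply: gamma_weight_L1; apply/andP; split; lra.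
have i2 : L1 mu I0 (fun x => 8 * gamma_weight (- 8^-1 - 3 / 4) x).
  by apply: L1Z => //; apply: gamma_weight_L1; apply/andP; split; lra.
have h (x : R) : I0 x -> gamma_weight (1 - 3 / 4) x + 8 * gamma_weight (- 8^-1 - 3 / 4) x = wln x.
  move=> /I0_gt0 x0; rewrite -!w_shift// powRr1 ?(ltW x0)// /wln (gtr0_norm x0).
  by rewrite mulrDr mulrCA.
by apply: (@eq_L1 _ _ _ mu I0 _ _ _ h) => //; exact: L1D.
Qed.

Let wfru_L1 : L1 mu I0 (fun x => w x * (x + 2 + x `^ (- 8^-1))).
Proof.
have i1 : L1 mu I0 (@gamma_weight R (1 - 3 / 4)) by apply: gamma_weight_L1; apply/andP; split; lra.
have i2 : L1 mu I0 (@gamma_weight R (- 8^-1 - 3 / 4)).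
  by apply: gamma_weight_L1; apply/andP; split; lra.
have h (x : R) : I0 x -> gamma_weight (1 - 3 / 4) x + 2 * w x + gamma_weight (- 8^-1 - 3 / 4) x =
    w x * (x + 2 + x `^ (- 8^-1)).
  move=> /I0_gt0 x0; rewrite -!w_shift// powRr1 ?(ltW x0)//.
  by move: (w x) (_ `^ _) => u r; ring.
apply: (@eq_L1 _ _ _ mu I0 _ _ _ h) => //.
by apply: L1D => //; apply: L1D => //; exact: L1Z.
Qed.

Let mw : measurable_fun setT (w : R -> R).
Proof. by rewrite /gamma_weight; meas. Qed.

Let wb_L1 (c : R -> R) (K : R) : measurable_fun setT c -> (forall x, `|c x| <= K) ->
  L1 mu I0 (fun x => w x * c x).
Proof.
move=> mc cK; have j : L1 mu I0 (fun x => K * w x) by exact: L1Z.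
apply: dominated_L1 j _ => //; first by apply: measurable_funTS; exact: measM.
move=> x _; rewrite normrM ger0_norm ?gamma_weight_ge0// mulrC.
by rewrite ler_wpM2r ?gamma_weight_ge0.
Qed.

(** The logarithm is replaced by Frullani's integral, to be integrated over x
    first. *)
Lemma log_transform (c : R -> R) (K : R) : measurable_fun setT c -> (forall x, `|c x| <= K) ->
  L1 mu I0 (fun v => \int[mu]_(x in I0) (w x * c x * ((expR (- v) - expR (- (x * v))) / v))) /\
  \int[mu]_(x in I0) (w x * c x * ln x) =
  \int[mu]_(v in I0) \int[mu]_(x in I0) (w x * c x * ((expR (- v) - expR (- (x * v))) / v)).
Proof.
move=> mc cK; have K0 : 0 <= K by exact: le_trans (cK 0).
have iu : L1 mu I0 (fun x => K * (w x * (x + 2 + x `^ (- 8^-1)))) by exact: L1Z.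
have [] := @dominated_Fubini _ _ _ _ R mu mu I0 I0
  (fun x v => w x * c x * ((expR (- v) - expR (- (x * v))) / v)) _ _ _ _ _ iu
  (@frullani_decay_L1 R) _ => //.
- apply: measurable_funTS; apply: measM; last by meas.
  apply: measM; first exact: (measurableT_comp mw measurable_fst).
  exact: (measurableT_comp mc measurable_fst).
- move=> x v /I0_gt0 x0 /I0_gt0 v0.
  have := frullani_bound x0 v0; have := gamma_weight_ge0 (- (3 / 4)) x; have := cK x.
  move: (w x) (c x) ((expR (- v) - expR (- (x * v))) / v) (x + 2 + x `^ (- 8^-1)) (frullani_decay v) => u k q r t hc hu hq.
  rewrite normrM normrM (ger0_norm hu) (mulrC u) -!mulrA; apply: ler_pM => //.
    by rewrite mulr_ge0.
  by rewrite ler_wpM2l.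
move=> _ _ j E1 E2; split; first exact: j.
rewrite -E2 E1; apply: (@eq_Rint _ _ _ mu) => x /I0_gt0 x0.
have [i E] := Frullani x0.
by rewrite RintegralZl// E.
Qed.

(** Differentiation under the integral sign, with the majorant x^(-3/4)
    e^(-x) |ln x| of the derivative. *)
Lemma der_weighted (h dh : R -> R) s : (forall x, is_derive x 1 h (dh x)) ->
  (forall x, `|h x| <= 1) -> (forall x, `|dh x| <= 1) ->
  is_derive s 1 (fun s => \int[mu]_(x in I0) (w x * h (s * ln x)))
    (\int[mu]_(x in I0) (w x * (dh (s * ln x) * ln x))).
Proof.
move=> hd h1 dh1.
have mh : measurable_fun setT h.
  by apply: continuous_measurable_fun => x; exact: der_continuous (hd x).
pose f s x := w x * h (s * ln x).
have df s' x : is_derive s' 1 (f ^~ x) (w x * (dh (s' * ln x) * ln x)).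
  have dl : is_derive s' 1 (fun s => s * ln x) (ln x) by der; ring.
  have dhl := @der_comp R h (fun s => s * ln x) s' _ _ (hd (s' * ln x)) dl.
  by rewrite /f; der; rewrite mul0r add0r.
have i s' : `](s - 1), (s + 1)[%classic s' -> L1 mu I0 (f s').
  by move=> _; apply: (@wb_L1 _ 1) => //; apply: meas_comp mh _; meas.
have dP s' x : `](s - 1), (s + 1)[%classic s' -> I0 x -> derivable (f ^~ x) s' 1.
  by move=> _ _; exact: (@ex_derive _ _ _ _ _ _ _ (df s' x)).
have g0 x : 0 <= wln x.
  by rewrite mulr_ge0 ?gamma_weight_ge0// addr_ge0// mulr_ge0 ?powR_ge0.
have Is : `](s - 1), (s + 1)[%classic s by rewrite /= in_itv/=; apply/andP; split; lra.
have b s' x : `](s - 1), (s + 1)[%classic s' -> I0 x -> `|partial1of2 f s' x| <= wln x.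
  move=> _ /I0_gt0 x0; rewrite partial1of2E (@derive_val _ _ _ _ _ _ _ (df s' x)).
  rewrite normrM (ger0_norm (gamma_weight_ge0 _ _)) ler_wpM2l ?gamma_weight_ge0//.
  rewrite normrM (gtr0_norm x0) -[leRHS]mul1r ler_pM//.
  exact: norm_ln_le.
have m0 : measurable I0 by [].
have D1 := @derivable_under_integral R _ _ mu f I0 m0 s (s - 1) (s + 1) Is i dP wln g0 wln_L1 b.
have D2 := @differentiation_under_integral R _ _ mu f I0 m0 s (s - 1) (s + 1) Is i dP wln g0 wln_L1 b.
apply: DeriveDef; first exact: D1.
rewrite -derive1E D2; apply: (@eq_Rint _ _ _ mu) => x _.
by rewrite partial1of2E (@derive_val _ _ _ _ _ _ _ (df s x)).
Qed.

Definition gamma_re s := \int[mu]_(x in I0) (w x * cos (s * ln x)).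
Definition gamma_im s := \int[mu]_(x in I0) (w x * sin (s * ln x)).
Definition gamma_re' s := \int[mu]_(x in I0) (w x * (- sin (s * ln x) * ln x)).
Definition gamma_im' s := \int[mu]_(x in I0) (w x * (cos (s * ln x) * ln x)).

Lemma der_gamma_re s : is_derive s 1 gamma_re (gamma_re' s).
Proof.
apply: (@der_weighted (@cos R) (fun x => - sin x) s (@is_derive_cos R) (@norm_cos_le1 R)).
by move=> x; rewrite normrN norm_sin_le1.
Qed.

Lemma der_gamma_im s : is_derive s 1 gamma_im (gamma_im' s).
Proof.
exact: (@der_weighted (@sin R) (@cos R) s (@is_derive_sin R) (@norm_sin_le1 R) (@norm_cos_le1 R)).
Qed.

Let wcos_L1 s : L1 mu I0 (fun x => w x * cos (s * ln x)).
Proof. by apply: (@wb_L1 _ 1); [meas|move=> x; exact: norm_cos_le1]. Qed.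

Let wsin_L1 s : L1 mu I0 (fun x => w x * sin (s * ln x)).
Proof. by apply: (@wb_L1 _ 1); [meas|move=> x; exact: norm_sin_le1]. Qed.

Let int_comb s a b : \int[mu]_(x in I0) (w x * (a * cos (s * ln x) + b * sin (s * ln x))) =
  a * gamma_re s + b * gamma_im s.
Proof.
have h (x : R) : I0 x -> a * (w x * cos (s * ln x)) + b * (w x * sin (s * ln x)) =
    w x * (a * cos (s * ln x) + b * sin (s * ln x)).
  by move=> _; rewrite mulrDr mulrCA (mulrCA b).
by rewrite -(eq_Rint mu h) RintegralD ?RintegralZl//; exact: L1Z.
Qed.

Let wlnb_L1 (c : R -> R) : measurable_fun setT c -> (forall x, `|c x| <= 1) ->
  L1 mu I0 (fun x => w x * (c x * ln x)).
Proof.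
move=> mc c1; apply: dominated_L1 wln_L1 _ => //.
  by apply: measurable_funTS; apply: measM => //; apply: measM => //; meas.
move=> x /I0_gt0 x0; rewrite normrM (ger0_norm (gamma_weight_ge0 _ _)).
rewrite ler_wpM2l ?gamma_weight_ge0//.
by rewrite normrM (gtr0_norm x0) -[leRHS]mul1r ler_pM// norm_ln_le.
Qed.

(** Its integral is the real part of Gamma' / Gamma at 1/4 + i s, in Gauss's
    integral form. *)
Definition digamma_integrand s v := (expR (- v) - (1 + v) `^ (- 4^-1) * cos (s * ln (1 + v))) / v.

(** The numerator X Y' - Y X' is a single integral, of x^(-3/4) e^(-x) c(x)
    ln x with c(x) = X cos (s ln x) + Y sin (s ln x). After Frullani's
    formula, rescaling x by 1 + v rotates the angle by s ln (1 + v), and the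
    terms in sin (s ln (1 + v)) cancel. *)
Lemma log_derivative s :
  L1 mu I0 (fun v => (gamma_re s ^+ 2 + gamma_im s ^+ 2) * digamma_integrand s v) /\
  gamma_re s * gamma_im' s - gamma_im s * gamma_re' s =
  \int[mu]_(v in I0) ((gamma_re s ^+ 2 + gamma_im s ^+ 2) * digamma_integrand s v).
Proof.
pose X := gamma_re s; pose Y := gamma_im s; rewrite -/X -/Y.
pose c x := X * cos (s * ln x) + Y * sin (s * ln x).
have mc : measurable_fun setT c by rewrite /c; meas.
have cK x : `|c x| <= `|X| + `|Y|.
  apply: (le_trans (ler_normD _ _)); rewrite !normrM.
  by apply: lerD; rewrite ler_piMr// ?norm_cos_le1 ?norm_sin_le1.
have [j E] := log_transform mc cK.
have scaled v : 0 < v -> \int[mu]_(x in I0) (w x * c x * expR (- (x * v))) =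
    (1 + v) `^ (- 4^-1) * (cos (s * ln (1 + v)) * (X ^+ 2 + Y ^+ 2)).
  move=> v0; have v1 : 0 < 1 + v by rewrite addr_gt0.
  pose G y := w y * (X * cos (s * (ln y - ln (1 + v))) + Y * sin (s * (ln y - ln (1 + v)))).
  have [|_] := @scale_oy R (1 + v) 0 G v1.
    by rewrite mulr0 => y y0; rewrite /G /gamma_weight; cont.
  rewrite mulr0 => S.
  have S1 : \int[mu]_(y in I0) G y = cos (s * ln (1 + v)) * (X ^+ 2 + Y ^+ 2).
    pose a := X * cos (s * ln (1 + v)) - Y * sin (s * ln (1 + v)).
    pose b := X * sin (s * ln (1 + v)) + Y * cos (s * ln (1 + v)).
    have h (y : R) : I0 y -> w y * (a * cos (s * ln y) + b * sin (s * ln y)) = G y.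
      move=> _; rewrite /G mulrBr cosB sinB /a /b; congr (_ * _); ring.
    rewrite -(eq_Rint mu h) int_comb -/X -/Y /a /b; ring.
  have h (x : R) : I0 x -> (1 + v) `^ 4^-1 * (w x * c x * expR (- (x * v))) =
      G ((1 + v) * x) * (1 + v).
    move=> /I0_gt0 x0; have e : ln ((1 + v) * x) - ln (1 + v) = ln x by rewrite lnM ?posrE// addrC addKr.
    rewrite /G e -/(c x) /gamma_weight.
    rewrite powRM ?(ltW v1) ?(ltW x0)//.
    have -> : (1 + v) `^ 4^-1 = (1 + v) `^ (- (3 / 4)) * (1 + v).
      by rewrite -{3}(powRr1 (ltW v1)) -powRD_gt0//; congr powR; lra.
    have -> : expR (- ((1 + v) * x)) = expR (- x) * expR (- (x * v)).
      by rewrite -expRD; congr expR; ring.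
    move: (_ `^ _) (_ `^ _) (c x) (expR _) (expR _) => p q r t u; ring.
  have i : L1 mu I0 (fun x => w x * c x * expR (- (x * v))).
    apply: dominated_L1 (integrable_abse (@wb_L1 c _ mc cK)) _ => //.
      apply: measurable_funTS; apply: measM; first by apply: measM.
      by meas.
    move=> x /I0_gt0 x0; rewrite normrM ler_piMr// ger0_norm ?expR_ge0//.
    by rewrite -expR0 ler_expR oppr_le0 mulr_ge0// ltW.
  move: S; rewrite S1 -(eq_Rint mu h) RintegralZl// => ->.
  rewrite mulrA -powRD_gt0// addNr powRr0 mul1r; exact: erefl.
have total : \int[mu]_(x in I0) (w x * c x) = X ^+ 2 + Y ^+ 2 by rewrite int_comb -!expr2.
have inner (v : R) : I0 v ->
    \int[mu]_(x in I0) (w x * c x * ((expR (- v) - expR (- (x * v))) / v)) =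
    (X ^+ 2 + Y ^+ 2) * digamma_integrand s v.
  move=> /I0_gt0 v0.
  have i1 : L1 mu I0 (fun x => expR (- v) / v * (w x * c x)).
    by apply: L1Z => //; exact: wb_L1 mc cK.
  have i2 : L1 mu I0 (fun x => w x * c x * expR (- (x * v))).
    apply: dominated_L1 (integrable_abse (@wb_L1 c _ mc cK)) _ => //.
      apply: measurable_funTS; apply: measM; first by apply: measM.
      by meas.
    move=> x /I0_gt0 x0; rewrite normrM ler_piMr// ger0_norm ?expR_ge0//.
    by rewrite -expR0 ler_expR oppr_le0 mulr_ge0// ltW.
  have h (x : R) : I0 x -> expR (- v) / v * (w x * c x) - v^-1 * (w x * c x * expR (- (x * v))) =
     w x * c x * ((expR (- v) - expR (- (x * v))) / v).
    by move=> _; move: (w x) (c x) (expR _) (expR _) => p q r t; ring.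
  rewrite -(eq_Rint mu h) RintegralB//; last exact: L1Z.
  rewrite !RintegralZl//; last exact: wb_L1 mc cK.
  rewrite total scaled// /digamma_integrand; ring.
split; first exact: (@eq_L1 _ _ _ mu I0 _ _ _ inner j).
rewrite -(eq_Rint mu inner) -E.
have iy : L1 mu I0 (fun x => X * (w x * (cos (s * ln x) * ln x))).
  by apply: L1Z => //; apply: wlnb_L1; [meas|move=> x; exact: norm_cos_le1].
have ix : L1 mu I0 (fun x => Y * (w x * (- sin (s * ln x) * ln x))).
  apply: L1Z => //; apply: wlnb_L1; first by meas.
  by move=> x; rewrite normrN norm_sin_le1.
have h (x : R) : I0 x -> X * (w x * (cos (s * ln x) * ln x)) -
    Y * (w x * (- sin (s * ln x) * ln x)) = w x * c x * ln x.
  by move=> _; rewrite /c; ring.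
rewrite -(eq_Rint mu h) RintegralB// !RintegralZl//.
- by apply: wlnb_L1; [meas|move=> x; rewrite normrN norm_sin_le1].
- by apply: wlnb_L1; [meas|move=> x; exact: norm_cos_le1].
Qed.

End GammaLine.

(** * The angular function *)
Section Theta.
Variable R : realType.
Notation mu := (@lebesgue_measure R).
Notation I0 := (`]0%R, +oo[%classic : set R).
Notation Iy := (`]1%R, +oo[%classic : set R).
Implicit Types (s t u x : R).

Lemma cpow_expR x (a b : R) : cpow x (a +i* b) =
  (expR (a * ln x) * cos (b * ln x)) +i* (expR (a * ln x) * sin (b * ln x)).
Proof.
rewrite /cpow /cexp.
have -> : (a +i* b) * (ln x)%:C = (a * ln x) +i* (b * ln x).
  by apply/eqP; rewrite eq_complex /=; apply/andP; split; apply/eqP; ring.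
by apply/eqP; rewrite eq_complex /=; apply/andP; split; apply/eqP; ring.
Qed.

Lemma cGamma_line s : cGamma (4^-1 +i* s) = gamma_re s +i* gamma_im s.
Proof.
rewrite /cGamma /Cintegral /gamma_re /gamma_im.
have e x : I0 x -> cpow x (4^-1 +i* s - 1) * (expR (- x))%:C =
    (gamma_weight (- (3 / 4)) x * cos (s * ln x)) +i* (gamma_weight (- (3 / 4)) x * sin (s * ln x)).
  move=> /I0_gt0 x0.
  have -> : 4^-1 +i* s - 1 = (- (3 / 4)) +i* s :> R[i].
    by apply/eqP; rewrite eq_complex /=; apply/andP; split; apply/eqP; lra.
  have -> : gamma_weight (- (3 / 4)) x = expR (- (3 / 4) * ln x) * expR (- x).
    by rewrite /gamma_weight /powR gt_eqF.
  rewrite cpow_expR; apply/eqP; rewrite eq_complex /=.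
  by apply/andP; split; apply/eqP; ring.
by congr (_ +i* _); apply: (@eq_Rint _ _ _ mu) => x /e ->.
Qed.

(** Locally, an angle is recovered from its sine and cosine through the arc
    tangent of its increment. *)
Lemma argument_derivative (X Y rho phi : R -> R) s (X' Y' : R) :
  (forall u, 0 < rho u) -> (forall u, X u = rho u * cos (phi u)) ->
  (forall u, Y u = rho u * sin (phi u)) -> {for s, continuous phi} ->
  is_derive s 1 X X' -> is_derive s 1 Y Y' ->
  is_derive s 1 phi ((X s * Y' - Y s * X') / (X s ^+ 2 + Y s ^+ 2)).
Proof.
move=> r0 EX EY cphi dX dY.
have N0 : X s ^+ 2 + Y s ^+ 2 != 0.
  rewrite EX EY !exprMn -mulrDr cos2Dsin2 mulr1.
  by rewrite expf_neq0// gt_eqF.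
pose psi u := phi s + atan ((Y u * X s - X u * Y s) * (X u * X s + Y u * Y s)^-1).
apply: (@near_eq_is_derive _ _ _ psi).
  have p2 : 0 < pi / 2 :> R by rewrite divr_gt0// pi_gt0.
  have /cvgrPdist_lt/(_ _ p2) := cphi; apply: filterS => u.
  rewrite distrC => h; rewrite /psi !EX !EY.
  have -> : (rho u * sin (phi u) * (rho s * cos (phi s)) -
      rho u * cos (phi u) * (rho s * sin (phi s))) *
      (rho u * cos (phi u) * (rho s * cos (phi s)) +
       rho u * sin (phi u) * (rho s * sin (phi s)))^-1 = tan (phi u - phi s).
    rewrite /tan sinB cosB.
    have -> : rho u * sin (phi u) * (rho s * cos (phi s)) -
      rho u * cos (phi u) * (rho s * sin (phi s)) =
      rho u * rho s * (sin (phi u) * cos (phi s) - cos (phi u) * sin (phi s)) by ring.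
    have -> : rho u * cos (phi u) * (rho s * cos (phi s)) +
       rho u * sin (phi u) * (rho s * sin (phi s)) =
      rho u * rho s * (cos (phi u) * cos (phi s) + sin (phi u) * sin (phi s)) by ring.
    rewrite invfM mulrACA divff ?mul1r//.
    by rewrite mulf_neq0// gt_eqF.
  rewrite tanK; first by rewrite addrC subrK.
  by rewrite in_itv/= -ltr_norml.
have -> : (X s * Y' - Y s * X') / (X s ^+ 2 + Y s ^+ 2) =
  0 + (1 + ((Y s * X s - X s * Y s) * (X s * X s + Y s * Y s)^-1) ^+ 2)^-1 *
   ((Y' * X s + Y s * 0 - (X' * Y s + X s * 0)) * (X s * X s + Y s * Y s)^-1 +
    (Y s * X s - X s * Y s) * (- (X s * X s + Y s * Y s) ^- 2 *
    (X' * X s + X s * 0 + (Y' * Y s + Y s * 0)))).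
  move: N0; move: (X s) (Y s) => a b N0.
  rewrite (mulrC b a) subrr !mul0r expr0n /= addr0 invr1 !expr2 in N0 *.
  by field.
by rewrite /psi; der.
Qed.

Variable lg : R[i] -> R[i].
Hypothesis lgP : is_log_Gamma lg.

Let phi s := complex.Im (lg (4^-1 +i* s)).

Definition digamma_integral s := \int[mu]_(v in I0) digamma_integrand s v.

Let line_gt0 s : 0 < complex.Re (4^-1 +i* s : R[i]).
Proof. by rewrite /= invr_gt0. Qed.

(** A logarithm of Gamma is a polar decomposition of it; this is where the
    nonvanishing of Gamma comes from. *)
Let polar s : gamma_re s = expR (complex.Re (lg (4^-1 +i* s))) * cos (phi s) /\
  gamma_im s = expR (complex.Re (lg (4^-1 +i* s))) * sin (phi s).
Proof.
have [h _ _ _] := lgP; have := h _ (line_gt0 s).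
rewrite cGamma_line /phi; case: (lg _) => a b; rewrite /cexp => /eqP.
rewrite eq_complex /= => /andP[/eqP <- /eqP <-].
by split; ring.
Qed.

Let norm_gt0 s : 0 < gamma_re s ^+ 2 + gamma_im s ^+ 2.
Proof.
have [-> ->] := polar s; rewrite !exprMn -mulrDr cos2Dsin2 mulr1.
by rewrite exprn_gt0// expR_gt0.
Qed.

Let phi_continuous s : {for s, continuous phi}.
Proof.
have [_ _ h _] := lgP.
have p : 0 < 4^-1 :> R by rewrite invr_gt0.
have c := h ((4^-1 : R), s) p.
have d := @cvg_pair _ _ _ (nbhs s) (nbhs (4^-1 : R)) (nbhs s) _ _ _ (fun=> 4^-1) id
  (@cvg_cst _ (4^-1 : R) _ (nbhs s) _) (fun _ hA => hA).
by move=> A hA; exact: (d _ _ _ _ _ (c A hA)).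
Qed.

Lemma digamma_L1 s : L1 mu I0 (digamma_integrand s).
Proof.
have [j _] := log_derivative s.
have j' : L1 mu I0 (fun v => (gamma_re s ^+ 2 + gamma_im s ^+ 2)^-1 *
    ((gamma_re s ^+ 2 + gamma_im s ^+ 2) * digamma_integrand s v)) by exact: L1Z.
apply: (@eq_L1 _ _ _ mu I0 _ _ _ _ j') => // v _.
by rewrite mulrA mulVf ?mul1r// gt_eqF.
Qed.

Lemma der_phi s : is_derive s 1 phi (digamma_integral s).
Proof.
have [j E] := log_derivative s.
have -> : digamma_integral s = (gamma_re s * gamma_im' s - gamma_im s * gamma_re' s) /
    (gamma_re s ^+ 2 + gamma_im s ^+ 2).
  rewrite E RintegralZl//; last exact: digamma_L1.
  rewrite -/(digamma_integral s); move: (norm_gt0 s) (digamma_integral s).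
  by move: (_ + _) => N N0 I; rewrite mulrC mulKf// gt_eqF.
apply: (@argument_derivative (@gamma_re R) (@gamma_im R)
  (fun s => expR (complex.Re (lg (4^-1 +i* s)))) phi s) => //.
- by move=> u; exact: expR_gt0.
- by move=> u; have [] := polar u.
- by move=> u; have [] := polar u.
- exact: der_gamma_re.
- exact: der_gamma_im.
Qed.

Lemma der_RS_theta t : derive1 (RS_theta lg) t = - (ln pi / 2) + digamma_integral (t / 2) / 2.
Proof.
have d2 : is_derive t 1 (fun t => t / 2) (2^-1 : R) by der; field.
have d := @der_comp R phi (fun t => t / 2) t _ _ (der_phi (t / 2)) d2.
have D : is_derive t 1 (fun t => - (t / 2) * ln pi + phi (t / 2))
    (- (ln pi / 2) + digamma_integral (t / 2) / 2).
  by der; ring.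
by rewrite derive1E; exact: (@derive_val _ _ _ _ _ _ _ D).
Qed.

(** Accounts for the difference between r^(-1) and r^(-2) in the subtracted
    term, and for ln (4 pi) in place of ln pi. *)
Let int_inv_quadratic :
  L1 mu Iy (fun r => (r * (1 + r))^-1) /\ \int[mu]_(r in Iy) (r * (1 + r))^-1 = ln 2.
Proof.
have gt0 (r : R) : 1 < r -> 0 < r by exact: lt_trans.
have d (r : R) : 0 < r -> is_derive r 1 (fun r => ln r - ln (1 + r)) ((r * (1 + r))^-1).
  move=> r0; der => //; first by rewrite addr_gt0.
  by field; rewrite !gt_eqF// addr_gt0.
have d' (r : R) : 1 < r -> is_derive r 1 (fun r => ln r - ln (1 + r)) ((r * (1 + r))^-1).
  by move=> /gt0; exact: d.
have [||||i E] := @ge0_FTC_oy R 1 _ _ (ln 1 - ln (1 + 1)) 0 _ d'.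
- by move=> r /gt0 r0; cont; rewrite mulf_neq0// gt_eqF// addr_gt0.
- by move=> r /gt0 r0; rewrite invr_ge0 mulr_ge0 ?addr_ge0// ltW.
- exact: (der_cvg_right (d 1 ltr01)).
- exact: cvg_ln_ratio.
by split=> //; rewrite E ln1 !sub0r opprK.
Qed.

(** The substitution 1 + v = r^2 turns the digamma integral into the
    archimedean integral of the function cos (t ln r). *)
Lemma RS_theta_integral t : L1 mu Iy (fun r =>
     (cos (t * ln r) * r `^ (- 2^-1) - r^-1) * spectral_density r) /\
  2 * derive1 (RS_theta lg) t = - (ln (4 * pi) + euler_gamma R) -
  2 * \int[mu]_(r in Iy) ((cos (t * ln r) * r `^ (- 2^-1) - r^-1) * spectral_density r).
Proof.
pose K v := ((1 + v)^-1 - (1 + v) `^ (- 4^-1) * cos (t / 2 * ln (1 + v))) / v.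
have hK (v : R) : I0 v -> gamma_integrand v + digamma_integrand (t / 2) v = K v.
  by move=> _; rewrite /gamma_integrand /digamma_integrand /K -mulrDl addrA subrK.
have j1 := digamma_L1 (t / 2); have j2 := @gamma_integrand_L1 R.
have jK : L1 mu I0 K by apply: (@eq_L1 _ _ _ mu I0 _ _ _ hK) => //; exact: L1D.
have EK : \int[mu]_(v in I0) K v = euler_gamma R + digamma_integral (t / 2).
  by rewrite -(eq_Rint mu hK) RintegralD// int_gamma_integrand.
have [|S1 S2] := @square_shift R K.
  move=> v v0; have v1 : 0 < 1 + v by rewrite addr_gt0.
  by rewrite /K; cont; rewrite ?gt_eqF.
pose q r := (cos (t * ln r) * r `^ (- 2^-1) - r^-1) * spectral_density r.
have hS (r : R) : Iy r -> - 2^-1 * (K (r ^+ 2 - 1) * (2 * r)) - (r * (1 + r))^-1 = q r.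
  move=> /Iy_gt1 r1; have r0 : 0 < r by rewrite (lt_trans _ r1).
  have a1 : r != 0 by rewrite gt_eqF.
  have a2 : r - 1 != 0 by rewrite subr_eq0 gt_eqF.
  have a3 : r + 1 != 0 by rewrite gt_eqF// addr_gt0.
  have a4 : 1 + r != 0 by rewrite addrC.
  rewrite /q /K spectral_densityE// (_ : 1 + (r ^+ 2 - 1) = r ^+ 2); last by ring.
  have -> : t / 2 * ln (r ^+ 2) = t * ln r by rewrite lnXn// mulr2n; field.
  have -> : (r ^+ 2) `^ (- 4^-1) = r `^ (- 2^-1).
    by rewrite -powR_mulrn ?(ltW r0)// -powRrM; congr powR; lra.
  have -> : r ^+ 2 - 1 = (r - 1) * (r + 1) by ring.
  move: (cos _) (_ `^ _) => c p.
  by field; rewrite ?a1 ?a2 ?a3 ?a4.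
have [i2 E2] := int_inv_quadratic.
have i1 : L1 mu Iy (fun r => K (r ^+ 2 - 1) * (2 * r)) by exact/S1.
have i1' : L1 mu Iy (fun r => - 2^-1 * (K (r ^+ 2 - 1) * (2 * r))) by exact: L1Z.
have iq : L1 mu Iy q by apply: (@eq_L1 _ _ _ mu Iy _ _ _ hS) => //; exact: L1B.
split; first exact: iq.
have Eq : \int[mu]_(r in Iy) q r = - 2^-1 * (euler_gamma R + digamma_integral (t / 2)) - ln 2.
  by rewrite -(eq_Rint mu hS) RintegralB// RintegralZl// -S2 EK E2.
rewrite -/(q) Eq der_RS_theta.
have -> : ln (4 * pi) = ln 2 + ln 2 + ln pi :> R.
  rewrite -lnM ?posrE// -lnM ?posrE ?pi_gt0//; congr (ln (_ * _)); ring.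
move: (ln pi) (ln 2) (euler_gamma R) (digamma_integral _) => a b c d.
by field.
Qed.

End Theta.

(** * Inversion symmetry and the functions cos (t ln r) *)
Lemma L1_setU d (T : measurableType d) (R : realType) (mu : {measure set T -> \bar R})
    (A B : set T) (f : T -> R) : measurable A -> measurable B ->
  L1 mu A f -> L1 mu B f -> L1 mu (A `|` B) f.
Proof.
move=> mA mB iA iB; have mAB := measurableU _ _ mA mB.
have r (D : set T) : measurable D -> L1 mu D f -> L1 mu setT ((fun x => `|f x|) \_ D).
  move=> mD i; have /(integrable_mkcond _ mD) := integrable_abse i.
  by apply: eq_integrable => // y _; rewrite /= !patchE; case: ifP.
have j : L1 mu (A `|` B) (fun x => ((fun x => `|f x|) \_ A) x + ((fun x => `|f x|) \_ B) x).
  by apply: (@integrableS _ _ _ mu setT) => //; apply: L1D => //; exact: r.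
apply: dominated_L1 j _ => //.
  apply/measurable_funU => //; split; [exact: L1_measurable iA|exact: L1_measurable iB].
move=> x [Ax|Bx]; rewrite !patchE.
  by rewrite (mem_set Ax) lerDl; case: ifP.
by rewrite (mem_set Bx) lerDr; case: ifP.
Qed.

Section InversionSplit.
Variable R : realType.
Notation mu := (@lebesgue_measure R).
Notation I0 := (`]0%R, +oo[%classic : set R).
Notation I1 := (`]0%R, 1%R[%classic : set R).
Notation Iy := (`]1%R, +oo[%classic : set R).
Implicit Types (s t u x r : R) (f : R -> R).

(** The point 1 is negligible. *)
Lemma Rint_split1 f : L1 mu I1 f -> L1 mu Iy f ->
  \int[mu]_(x in I0) f x = \int[mu]_(x in I1) f x + \int[mu]_(x in Iy) f x.
Proof.
move=> i1 iy; have m1 : measurable I1 by []. have my : measurable Iy by [].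
have iU : L1 mu (I1 `|` Iy) f by apply: L1_setU.
have E : I0 `\` [set 1] = I1 `|` Iy.
  apply/seteqP; split=> x /=; rewrite !in_itv/= !andbT.
    by move=> [x0 /eqP x1]; have [|] := ltP x 1; [left; rewrite x0|right; rewrite lt_neqAle eq_sym x1].
  by move=> [/andP[x0 x1]|x1]; split; rewrite ?(lt_trans _ x1)// => e; rewrite e ltxx in x1.
have mf : measurable_fun I0 f.
  have -> : I0 = (I1 `|` Iy) `|` [set 1].
    by rewrite -E [RHS]setUC setDUK// => x ->; rewrite /= in_itv/= ltr01.
  apply/measurable_funU => //; first exact: measurableU.
  by split; [exact: (@L1_measurable _ _ _ mu _ _ iU)|exact: measurable_fun_set1].
have i0 : L1 mu I0 f.
  apply/(@negligible_integrable _ _ _ mu I0 [set 1]) => //; last by rewrite E.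
    exact/measurable_EFinP.
  exact: lebesgue_measure_set1.
have -> : \int[mu]_(x in I0) f x = \int[mu]_(x in I1 `|` Iy) f x.
  rewrite /Rintegral -E; congr fine; apply: negligible_integral => //.
  exact: lebesgue_measure_set1.
rewrite Rintegral_setU//; apply/disj_setPS => x [/=].
by rewrite !in_itv/= andbT => /andP[_ x1] /(lt_trans x1); rewrite ltxx.
Qed.

(** Since delta(1/u) = delta(u), the parts of the integral over (0, 1) and over
    (1, oo) are proportional, with factor the parity sg; even functions give
    twice the second one, and odd ones give zero. *)
Lemma inversion_parity (phi : R -> R) (M sg : R) :
  (forall x, 0 < x -> `|phi x| <= M) ->
  (forall x, 0 < x -> {for x, continuous phi}) ->
  (forall x, 0 < x -> phi x^-1 = sg * phi x) -> sg * sg = 1 ->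
  \int[mu]_(u in I0) (phi u * tr_delta u / u) =
  (1 + sg) * \int[mu]_(r in Iy) (phi r * (tr_delta r / r)).
Proof.
move=> pM cphi psym sg1.
have iy := local_term_L1 pM cphi.
pose G u := sg * (phi u^-1 * ((u^-1) `^ 2^-1 * local_kernel 0 u^-1) / u).
have GE (u : R) : I1 u -> G u = phi u * tr_delta u / u.
  rewrite /= in_itv/= => /andP[u0 u1].
  have v1 : 1 < u^-1 by rewrite invf_gt1.
  have -> : tr_delta u = tr_delta u^-1.
    by rewrite /tr_delta (leNgt 1 u) u1/= (ltW v1).
  rewrite tr_delta_local// /G psym// !mulrA sg1 mul1r.
  by [].
have [|H1 H2] := @inversion_01 R G.
  move=> y /andP[y0 y1]; have v1 : 1 < y^-1 by rewrite invf_gt1.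
  have v0 : 0 < y^-1 by rewrite invr_gt0.
  have yn : y != 0 by rewrite gt_eqF.
  have cv : {for y, continuous (fun y : R => y^-1)} by cont.
  rewrite /G; apply: contM; first exact: cont_cst.
  apply: contM; last exact: cv.
  apply: contM; first by apply: (@cont_comp R phi (fun y => y^-1)) => //; exact: cphi.
  apply: contM; first by cont.
  by apply: (@cont_comp R (local_kernel 0) (fun y => y^-1)) => //; exact: local_kernel_continuous.
have hy (x : R) : Iy x -> sg * (phi x * (tr_delta x / x)) = G x^-1 * x ^- 2.
  move=> /Iy_gt1 x1; have x0 : x != 0 by rewrite gt_eqF// (lt_trans _ x1).
  rewrite /G !invrK tr_delta_local//.
  by move: (phi x) (_ `^ _) (local_kernel _ _) => a b c; field.
have iG : L1 mu I1 G.
  by apply/H1; apply: (@eq_L1 _ _ _ mu Iy _ _ _ hy) => //; exact: L1Z.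
rewrite Rint_split1; last 2 first.
- exact: (@eq_L1 _ _ _ mu I1 _ _ _ GE iG).
- by apply: (@eq_L1 _ _ _ mu Iy _ _ _ _ iy) => // x _; rewrite mulrA.
rewrite -(eq_Rint mu GE) H2 -(eq_Rint mu hy) RintegralZl// addrC mulrDl mul1r; congr (_ + _).
by apply: (@eq_Rint _ _ _ mu) => x _; rewrite mulrA.
Qed.

End InversionSplit.

Section CriticalLine.
Variable R : realType.
Notation mu := (@lebesgue_measure R).
Notation mu2 := (mu \x mu)%E.
Notation Iy := (`]1%R, +oo[%classic : set R).
Notation D2 := (Iy `*` Iy).
Variable t : R.

Let F (x : R) := cos (t * ln x).
Let mF : measurable_fun setT F. Proof. by rewrite /F; meas. Qed.
Let FM (x : R) : 0 < x -> `|F x| <= 1. Proof. by move=> _; exact: norm_cos_le1. Qed.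
Let Fsym (x : R) : 0 < x -> F x^-1 = F x.
Proof. by move=> x0; rewrite /F lnV ?posrE// mulrN cosN. Qed.
Let Fcont (x : R) : 0 < x -> {for x, continuous F}.
Proof. by move=> x0; rewrite /F; cont. Qed.
Let F1 : F 1 = 1. Proof. by rewrite /F ln1 mulr0 cos0. Qed.
Let FC (x : R) : 1 < x -> `|F x - F 1| <= `|t| * (x - 1).
Proof.
move=> x1; rewrite /F; apply: (le_trans (cos_lipschitz _ _)).
rewrite ln1 mulr0 subr0 normrM ler_wpM2l// ger0_norm ?ln_ge0 ?(ltW x1)//.
have : ln (1 + (x - 1)) <= x - 1 by apply: le_ln1Dx; lra.
by rewrite addrC subrK.
Qed.

(** The kernel cos (t ln (x/y)) splits into two products, to each of which
    Bessel's inequality applies. *)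
Let Fpos e : 0 < e ->
  \int[mu2]_(p in D2) cutoff_kernel F e p.1 p.2 <= F 1 * exp_integral (2 * e).
Proof.
move=> e0.
have m1 : measurable_fun setT (fun x : R => cutoff e x * cos (t * ln x)) by rewrite /cutoff; meas.
have m2 : measurable_fun setT (fun x : R => cutoff e x * sin (t * ln x)) by rewrite /cutoff; meas.
have b1 (x : R) : 1 < x -> `|cutoff e x * cos (t * ln x)| <= 1 * expR (- (e * x)).
  move=> x1; rewrite normrM mulrC ler_pM ?norm_cos_le1//.
  by rewrite ger0_norm ?cutoff_ge0// cutoff_le.
have b2 (x : R) : 1 < x -> `|cutoff e x * sin (t * ln x)| <= 1 * expR (- (e * x)).
  move=> x1; rewrite normrM mulrC ler_pM ?norm_sin_le1//.
  by rewrite ger0_norm ?cutoff_ge0// cutoff_le.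
have [i1 l1] := band_energy_le ler01 e0 m1 b1.
have [i2 l2] := band_energy_le ler01 e0 m2 b2.
have h (p : R * R) : D2 p ->
   cutoff e p.1 * cos (t * ln p.1) * (cutoff e p.2 * cos (t * ln p.2)) * band_kernel p.1 p.2 +
   cutoff e p.1 * sin (t * ln p.1) * (cutoff e p.2 * sin (t * ln p.2)) * band_kernel p.1 p.2 =
   cutoff_kernel F e p.1 p.2.
  case: p => x y [/Iy_gt1/= x1 /Iy_gt1/= y1]; have x0 := lt_trans ltr01 x1.
  have y0 := lt_trans ltr01 y1.
  rewrite /cutoff_kernel /F ln_div ?posrE// mulrBr cosB.
  by move: (cutoff _ _) (cutoff _ _) (cos _) (cos _) (sin _) (sin _) (band_kernel _ _) => *; ring.
have mD : measurable D2 by exact: measurableX.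
have -> : \int[mu2]_(p in D2) cutoff_kernel F e p.1 p.2 = _ := esym (eq_Rint mu2 h).
rewrite RintegralD//; apply: (le_trans (lerD l1 l2)).
have q (x : R) : Iy x -> (cutoff e x * cos (t * ln x)) ^+ 2 + (cutoff e x * sin (t * ln x)) ^+ 2 =
    expR (- (2 * e * x)) / x.
  move=> /Iy_gt1 x1; have x0 := lt_trans ltr01 x1.
  rewrite !exprMn -mulrDr cos2Dsin2 mulr1 -expRM_natl.
  rewrite -powR_mulrn ?powR_ge0// -powRrM mulNr mulVf ?pnatr_eq0// powR_inv1 ?(ltW x0)//.
  by rewrite mulrC; congr (expR _ / _); ring.
have sq (xi : R -> R) : measurable_fun setT xi ->
    (forall x : R, 1 < x -> `|xi x| <= 1 * expR (- (e * x))) -> L1 mu Iy (fun x => xi x ^+ 2).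
  move=> m b; apply: dominated_L1 (expRN_L1 e0) _ => //.
    by apply: measurable_funTS; exact: measX.
  move=> x /Iy_gt1 x1; rewrite normrX; apply: (@le_trans _ _ (expR (- (e * x)) ^+ 2)).
    by rewrite lerXn2r ?nnegrE ?expR_ge0// -[leRHS]mul1r b.
  rewrite expr2 ler_piMl ?expR_ge0//.
  by rewrite -expR0 ler_expR oppr_le0 mulr_ge0 ?ltW// (lt_trans _ x1).
rewrite -RintegralD//; last 2 first.
- exact: sq m1 b1.
- exact: sq m2 b2.
by rewrite (eq_Rint mu q) F1 mul1r.
Qed.

Lemma trace_form_cos_ge0 : 0 <= trace_form F.
Proof. exact: (trace_form_ge0 ler01 (normr_ge0 t) mF FM Fsym Fcont FC Fpos). Qed.

Lemma tr_delta_hatE :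
  tr_delta_hat t = (2 * \int[mu]_(r in Iy) (F r * (tr_delta r / r)))%:C.
Proof.
rewrite /tr_delta_hat /haar_integral /Cintegral.
pose S (x : R) := - sin (t * ln x).
have e (x : R) : (tr_delta x)%:C * cpow x (0 -i* t) / x%:C =
    (F x * tr_delta x / x) +i* (S x * tr_delta x / x).
  rewrite -[0 -i* t]/(0 +i* (- t)) cpow_expR mul0r expR0 !mul1r mulNr cosN sinN.
  rewrite -fmorphV; apply/eqP; rewrite eq_complex /F /S /=.
  by apply/andP; split; apply/eqP; ring.
have -> : \int[mu]_(x in `]0, +oo[) complex.Re ((tr_delta x)%:C * cpow x (0 -i* t) / x%:C) =
    \int[mu]_(x in `]0, +oo[) (F x * tr_delta x / x).
  by apply: (@eq_Rint _ _ _ mu) => x _; rewrite e.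
have -> : \int[mu]_(x in `]0, +oo[) complex.Im ((tr_delta x)%:C * cpow x (0 -i* t) / x%:C) =
    \int[mu]_(x in `]0, +oo[) (S x * tr_delta x / x).
  by apply: (@eq_Rint _ _ _ mu) => x _; rewrite e.
rewrite (@inversion_parity R F 1 1) ?mulr1//; last first.
  by move=> x x0; rewrite mul1r Fsym.
rewrite (@inversion_parity R S 1 (-1)) ?mulrNN ?mulr1//.
- by rewrite subrr mul0r -(natrD _ 1 1).
- by move=> x _; rewrite normrN norm_sin_le1.
- by move=> x x0; rewrite /S; cont.
- by move=> x x0; rewrite /S lnV ?posrE// mulrN sinN mulN1r.
Qed.

Lemma RS_theta_trace (lg : R[i] -> R[i]) : is_log_Gamma lg ->
  (2 * derive1 (RS_theta lg) t)%:C + tr_delta_hat t = (trace_form F)%:C.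
Proof.
move=> lgP; have [i E] := RS_theta_integral lgP t.
rewrite tr_delta_hatE -rmorphD; congr (_%:C); rewrite E /trace_form.
have h (r : R) : Iy r -> (F r * r `^ (- 2^-1) - F 1 / r) * spectral_density r =
    (cos (t * ln r) * r `^ (- 2^-1) - r^-1) * spectral_density r by move=> _; rewrite F1 div1r.
rewrite (eq_Rint mu h) F1.
by move: (Rintegral _ _ _) (Rintegral _ _ _) (ln _) (euler_gamma R) => a b c d; ring.
Qed.

End CriticalLine.

(** * The trace functional on hermitian functions *)
Section TraceOfHermitian.
Variable R : realType.
Notation mu := (@lebesgue_measure R).
Notation Iy := (`]1%R, +oo[%classic : set R).
Implicit Types (x r : R).

Lemma regular_term_L1 (F : R -> R) (M C : R) : 0 <= M -> 0 <= C ->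
  (forall x, 0 < x -> `|F x| <= M) -> (forall x, 0 < x -> {for x, continuous F}) ->
  (forall x, 1 < x -> `|F x - F 1| <= C * (x - 1)) ->
  L1 mu Iy (fun r => (F r * r `^ (- 2^-1) - F 1 / r) * spectral_density r).
Proof.
move=> M0 C0 FM cF FC.
have i : L1 mu Iy (fun r => (2 * C + 8 * M) * r `^ (- (5 / 4))).
  by apply: L1Z => //; exact: powR_54_L1.
apply: dominated_L1 i _ => //.
  apply: (continuous_exhausts_measurable (exhausts_oy 1)) => r /Iy_gt1 r1.
  have r0 : 0 < r by rewrite (lt_trans _ r1).
  rewrite /spectral_density; apply: contM; last first.
    by cont; [rewrite gt_eqF// subr_gt0 (lt_trans _ r1)// invf_lt1|rewrite gt_eqF].
  apply: contD; last by cont; rewrite gt_eqF.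
  by apply: contM; [exact: cF|cont].
move=> r /Iy_gt1 r1; rewrite normrM [X in _ * X]ger0_norm; last first.
  have [a b] : 0 <= r /\ 0 <= r - 1 by split; lra.
  by rewrite spectral_densityE// divr_ge0// mulr_ge0// addr_ge0.
exact: (regular_term_bound M0 C0 FM FC).
Qed.

(** F is even and S is odd under inversion, so that only F contributes. *)
Lemma trace_L_hermitian (f : R -> R[i]) (F S : R -> R) (M C : R) :
  0 <= M -> 0 <= C -> (forall x, 1 < x -> `|F x - F 1| <= C * (x - 1)) ->
  (forall x, 0 < x -> f x = F x +i* S x) ->
  (forall x, 0 < x -> `|F x| <= M) -> (forall x, 0 < x -> `|S x| <= M) ->
  (forall x, 0 < x -> {for x, continuous F}) -> (forall x, 0 < x -> {for x, continuous S}) ->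
  (forall x, 0 < x -> F x^-1 = F x) -> (forall x, 0 < x -> S x^-1 = - S x) ->
  trace_L f = (trace_form F)%:C.
Proof.
move=> M0 C0 FC fE FM SM cF cS symF symS.
have S1 : S 1 = 0.
  have := symS 1 ltr01; rewrite invr1 => h.
  by move: (S 1) h => s h; lra.
pose N x := - S x.
have e (x : R) : `]0, +oo[%classic x -> f x^-1 * (tr_delta x)%:C / x%:C =
    (F x * tr_delta x / x) +i* (N x * tr_delta x / x).
  move=> /I0_gt0 x0; rewrite fE ?invr_gt0// symF// symS// -fmorphV.
  by apply/eqP; rewrite eq_complex /N /=; apply/andP; split; apply/eqP; ring.
have E1 : haar_integral (fun rho => f rho^-1 * (tr_delta rho)%:C) =
    (2 * \int[mu]_(r in Iy) (F r * (tr_delta r / r)))%:C.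
  rewrite /haar_integral /Cintegral.
  have -> : \int[mu]_(x in `]0, +oo[) complex.Re (f x^-1 * (tr_delta x)%:C / x%:C) =
      \int[mu]_(x in `]0, +oo[) (F x * tr_delta x / x).
    by apply: (@eq_Rint _ _ _ mu) => x /e ->.
  have -> : \int[mu]_(x in `]0, +oo[) complex.Im (f x^-1 * (tr_delta x)%:C / x%:C) =
      \int[mu]_(x in `]0, +oo[) (N x * tr_delta x / x).
    by apply: (@eq_Rint _ _ _ mu) => x /e ->.
  rewrite (@inversion_parity R F M 1 FM cF) ?mulr1//; last by move=> x x0; rewrite mul1r symF.
  rewrite (@inversion_parity R N M (-1)) ?mulrNN ?mulr1//.
  - by rewrite subrr mul0r -(natrD _ 1 1).
  - by move=> x x0; rewrite normrN SM.
  - by move=> x x0; apply: contN; exact: cS.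
  - by move=> x x0; rewrite /N symS// mulN1r.
have k1 : (1 `^ (- 2^-1))%:C * f 1 = (F 1)%:C.
  by rewrite powR1 mul1r fE// S1.
pose K (x : R) := ((x `^ (- 2^-1))%:C * f x + ksharp (fun x => (x `^ (- 2^-1))%:C * f x) x -
      (2 / x)%:C * ((1 `^ (- 2^-1))%:C * f 1)) / (x - x^-1)%:C.
have e2 (x : R) : Iy x -> K x =
    (2 * ((F x * x `^ (- 2^-1) - F 1 / x) * spectral_density x))%:C.
  move=> /Iy_gt1 x1; have x0 : 0 < x by rewrite (lt_trans _ x1).
  rewrite /K k1 /ksharp fE// fE ?invr_gt0// symF// symS// -fmorphV.
  have -> : x^-1%:C * ((x^-1 `^ (- 2^-1))%:C * (F x +i* - S x)) =
      (x `^ (- 2^-1))%:C * (F x +i* - S x).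
    rewrite mulrA -rmorphM; congr (_%:C * _).
    rewrite -(powR_inv1 (ltW x0)) -powRrM -powRD_gt0//; congr powR; lra.
  rewrite /spectral_density; apply/eqP; rewrite eq_complex /=.
  by apply/andP; split; apply/eqP; move: (x `^ _) (x - _)^-1 => p q; ring.
have E2 : Cintegral Iy K =
    (2 * \int[mu]_(r in Iy) ((F r * r `^ (- 2^-1) - F 1 / r) * spectral_density r))%:C.
  rewrite /Cintegral; congr (_ +i* _).
    transitivity (\int[mu]_(r in Iy) (2 * ((F r * r `^ (- 2^-1) - F 1 / r) * spectral_density r))).
      by apply: (@eq_Rint _ _ _ mu) => x /e2 ->.
    by rewrite RintegralZl//; exact: regular_term_L1 FM cF FC.
  transitivity (\int[mu]_(r in Iy) (0 : R)); last by rewrite Rintegral_cst// mul0r.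
  by apply: (@eq_Rint _ _ _ mu) => x /e2 ->.
transitivity (haar_integral (fun rho => f rho^-1 * (tr_delta rho)%:C) -
  ((ln (4 * pi) + euler_gamma R)%:C * ((1 `^ (- 2^-1))%:C * f 1) + Cintegral Iy K)); first by [].
by rewrite E1 k1 E2 -!(rmorphM, rmorphD, rmorphB) /trace_form opprD addrA.
Qed.

End TraceOfHermitian.

(** * Correlations of compactly supported functions *)
Section Correlation.
Variable R : realType.
Notation mu := (@lebesgue_measure R).
Notation mu2 := (mu \x mu)%E.
Notation I0 := (`]0%R, +oo[%classic : set R).
Notation Iy := (`]1%R, +oo[%classic : set R).
Notation D2 := (Iy `*` Iy).
Implicit Types (u v x y z : R) (h k : R -> R).

Variables (a b L : R).
Hypotheses (a0 : 0 < a) (L0 : 0 <= L).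

(** One Lipschitz constant and the support contain all that is used of a
    test function: they bound it too, since it vanishes at 0. *)
Definition bump h := [/\ forall x, x < a -> h x = 0, forall x, b < x -> h x = 0 &
  forall x y, `|h x - h y| <= L * `|x - y|].

Definition correlation h k u := \int[mu]_(v in I0) (h v * k (v / u) / v).

Let H := L * `|b|.
Let H0 : 0 <= H. Proof. by rewrite mulr_ge0. Qed.

Lemma bump_le h x : bump h -> `|h x| <= H.
Proof.
move=> [ha hb hL]; have [xa|xa] := ltP x a; first by rewrite ha// normr0.
have [xb|xb] := ltP b x; first by rewrite hb// normr0.
rewrite -[h x]subr0 -(ha 0 a0); apply: (le_trans (hL _ _)).
have x0 : 0 <= x by rewrite (le_trans (ltW a0)).
by rewrite subr0 ler_wpM2l// ger0_norm// (le_trans xb)// ler_norm.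
Qed.

Lemma meas_bump h : bump h -> measurable_fun setT h.
Proof.
move=> [_ _ hL]; apply: continuous_measurable_fun => x.
by apply: (@lipschitz_continuous _ _ L) => y; exact: hL.
Qed.

Lemma cont_bump h x : bump h -> {for x, continuous h}.
Proof. by move=> [_ _ hL]; apply: (@lipschitz_continuous _ _ L) => y; exact: hL. Qed.

Let He := H * expR b.
Let He0 : 0 <= He. Proof. by rewrite mulr_ge0 ?expR_ge0. Qed.
Let Q := He / a.
Let Q0 : 0 <= Q. Proof. by rewrite divr_ge0// ltW. Qed.

Let bump_expR h v : bump h -> `|h v| <= He * expR (- v).
Proof.
move=> hh; have [ha hb _] := hh; have [vb|vb] := ltP b v.
  by rewrite hb// normr0; apply: mulr_ge0 => //; exact: expR_ge0.
apply: (le_trans (bump_le v hh)); rewrite /He -mulrA -expRD ler_peMr//.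
by rewrite -expR0 ler_expR subr_ge0.
Qed.

(** On the support of h, a <= x z <= b, so that 1/z <= x/a and z <= b. *)
Let bump_scaled h x z : bump h -> 1 <= x -> 0 < z -> `|h (x * z)| / z <= Q * x * expR (- z).
Proof.
move=> hh x1 z0; have x0 : 0 < x by rewrite (lt_le_trans _ x1).
have [ha _ _] := hh; have [xa|xa] := ltP (x * z) a.
  rewrite ha// normr0 mul0r; apply: mulr_ge0; last exact: expR_ge0.
  by apply: mulr_ge0 => //; exact: ltW.
rewrite ler_pdivrMr//; apply: (le_trans (bump_expR _ hh)).
apply: (@le_trans _ _ (He * expR (- z))).
  by rewrite ler_wpM2l// ler_expR lerN2 ler_peMl// ltW.
rewrite /Q (_ : He / a * x * expR (- z) * z = He * expR (- z) * (x * z / a)); last by ring.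
rewrite ler_peMr//; first by apply: mulr_ge0 => //; exact: expR_ge0.
by rewrite ler_pdivlMr// mul1r.
Qed.

Let exp_L1 : L1 mu I0 (fun v => expR (- v)).
Proof.
have [i _] := int_expRN (@ltr01 R).
by apply: (@eq_L1 _ _ _ mu I0 _ _ _ _ i) => // v _; rewrite mul1r.
Qed.

Let corr_bound h k v w : bump h -> bump k -> 0 < v ->
  `|h v * k w / v| <= H * Q * expR (- v).
Proof.
move=> hh hk v0; rewrite mulrAC normrM normrM normfV (gtr0_norm v0) mulrC -mulrA.
apply: ler_pM; rewrite ?divr_ge0 ?(ltW v0)//; first exact: bump_le.
by have := bump_scaled hh (lexx 1) v0; rewrite mul1r mulr1.
Qed.

Lemma correlation_L1 h k u : bump h -> bump k -> L1 mu I0 (fun v => h v * k (v / u) / v).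
Proof.
move=> hh hk; have j : L1 mu I0 (fun v => H * Q * expR (- v)) by exact: L1Z.
apply: dominated_L1 j _ => //; last by move=> v /I0_gt0 v0; exact: corr_bound.
have mh := meas_bump hh; have mk := meas_bump hk.
apply: measurable_funTS; apply: measM; last by meas.
by apply: measM => //; apply: (meas_comp mk); meas.
Qed.

Lemma correlation_le h k u : bump h -> bump k -> `|correlation h k u| <= H * Q.
Proof.
move=> hh hk; have j : L1 mu I0 (fun v => H * Q * expR (- v)) by exact: L1Z.
have i := correlation_L1 u hh hk.
apply: (le_trans (le_normr_Rintegral _ i)) => //.
apply: (@le_trans _ _ (\int[mu]_(v in I0) (H * Q * expR (- v)))).
  apply: le_Rintegral => //; first exact: integrable_abse i.
  by move=> v /I0_gt0 v0; exact: corr_bound.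
rewrite RintegralZl//; have [_] := int_expRN (@ltr01 R).
have -> : \int[mu]_(v in I0) expR (- (1 * v)) = \int[mu]_(v in I0) expR (- v).
  by apply: (@eq_Rint _ _ _ mu) => v _; rewrite mul1r.
by move=> ->; rewrite invr1 mulr1.
Qed.

Lemma correlation_lipschitz h k u u' : bump h -> bump k ->
  `|correlation h k u - correlation h k u'| <= L * He * `|u^-1 - u'^-1|.
Proof.
move=> hh hk; have [_ _ kL] := hk.
have i := correlation_L1 u hh hk; have i' := correlation_L1 u' hh hk.
have iB : L1 mu I0 (fun v => h v * k (v / u) / v - h v * k (v / u') / v) by exact: L1B.
rewrite /correlation -RintegralB//; apply: (le_trans (le_normr_Rintegral _ iB)) => //.
have j : L1 mu I0 (fun v => L * He * `|u^-1 - u'^-1| * expR (- v)) by exact: L1Z.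
apply: (@le_trans _ _ (\int[mu]_(v in I0) (L * He * `|u^-1 - u'^-1| * expR (- v)))).
  apply: le_Rintegral => //; first exact: integrable_abse iB.
  move=> v /I0_gt0 v0; rewrite -mulrBl -mulrBr normrM normrM normfV (gtr0_norm v0).
  rewrite ler_pdivrMr//.
  apply: (@le_trans _ _ (He * expR (- v) * (L * (v * `|u^-1 - u'^-1|)))).
    apply: ler_pM => //; first exact: bump_expR.
    by apply: (le_trans (kL _ _)); rewrite -mulrBr normrM (gtr0_norm v0).
  by rewrite le_eqVlt; apply/orP; left; apply/eqP; ring.
rewrite RintegralZl//; have [_] := int_expRN (@ltr01 R).
have -> : \int[mu]_(v in I0) expR (- (1 * v)) = \int[mu]_(v in I0) expR (- v).
  by apply: (@eq_Rint _ _ _ mu) => v _; rewrite mul1r.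
by move=> ->; rewrite invr1 mulr1.
Qed.

Lemma correlation_continuous h k u : bump h -> bump k -> 0 < u ->
  {for u, continuous (correlation h k)}.
Proof.
move=> hh hk u0; rewrite /prop_for /=; apply: cvg_of_sub.
have c : {for u, continuous (fun y => L * He * `|y^-1 - u^-1|)}.
  by cont; rewrite gt_eqF.
apply: (@cvg_to0 _ _ _ _ _ (fun y => L * He * `|y^-1 - u^-1|)).
  by apply: nearW => y; exact: correlation_lipschitz.
by have := c; rewrite /prop_for /continuous_at subrr normr0 mulr0.
Qed.

Lemma correlation_near1 h k x : bump h -> bump k -> 1 < x ->
  `|correlation h k x - correlation h k 1| <= L * He * (x - 1).
Proof.
move=> hh hk x1; have x0 : 0 < x by rewrite (lt_trans _ x1).
apply: (le_trans (correlation_lipschitz _ _ hh hk)); rewrite ler_wpM2l ?mulr_ge0//.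
rewrite invr1 distrC ger0_norm; last by rewrite subr_ge0 invf_le1// ltW.
rewrite -subr_ge0 (_ : _ - _ = (x - 1) ^+ 2 / x) ?divr_ge0 ?sqr_ge0 ?(ltW x0)//.
by field; rewrite gt_eqF.
Qed.

Lemma correlation_npos h k u : bump h -> bump k -> u <= 0 -> correlation h k u = 0.
Proof.
move=> hh [ka _ _] u0; rewrite /correlation -[RHS](mul0r (fine (mu I0))) -Rintegral_cst//.
apply: (@eq_Rint _ _ _ mu) => v /I0_gt0 v0.
rewrite ka ?mulr0 ?mul0r//; apply: le_lt_trans a0.
by rewrite mulr_ge0_le0 ?invr_le0// ltW.
Qed.

Lemma meas_correlation h k : bump h -> bump k -> measurable_fun setT (correlation h k).
Proof.
move=> hh hk.
have -> : correlation h k = (correlation h k) \_ I0.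
  apply/funext => u; rewrite patchE; case: ifPn => //; rewrite notin_setE /= in_itv/= andbT.
  by move=> /negP; rewrite -leNgt; exact: correlation_npos.
apply/(measurable_restrictT (correlation h k)) => //.
apply: (continuous_exhausts_measurable (exhausts_oy 0)) => u /I0_gt0 u0.
exact: correlation_continuous.
Qed.

(** The correlation is a scalar product of dilates, for the Haar measure. *)
Lemma correlation_div h k x y : bump h -> bump k -> 0 < x -> 0 < y ->
  correlation h k (x / y) = \int[mu]_(z in I0) (h (x * z) * k (y * z) / z).
Proof.
move=> hh hk x0 y0; rewrite /correlation.
have [|_] := @scale_oy R x 0 (fun v => h v * k (v / (x / y)) / v) x0.
  rewrite mulr0 => v v0; apply: contM; last by cont; rewrite gt_eqF.
  apply: contM; first exact: cont_bump.
  by apply: (@cont_comp R k (fun v => v / (x / y))); [exact: cont_bump|cont].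
rewrite mulr0 => ->; apply: (@eq_Rint _ _ _ mu) => z /I0_gt0 z0.
have -> : x * z / (x / y) = y * z by field; rewrite !gt_eqF.
by move: (h _) (k _) => p q; field; rewrite !gt_eqF.
Qed.

Lemma correlation_inv h k x : bump h -> bump k -> 0 < x ->
  correlation h k x^-1 = correlation k h x.
Proof.
move=> hh hk x0; rewrite -[x^-1]div1r correlation_div// -[in RHS](divr1 x) correlation_div//.
by apply: (@eq_Rint _ _ _ mu) => z _; rewrite [h _ * _]mulrC.
Qed.

Section Energy.
Variables (h : R -> R) (e : R).
Hypotheses (hh : bump h) (e0 : 0 < e).

Let xi z x := cutoff e x * h (x * z).
Let mh : measurable_fun setT h. Proof. exact: meas_bump. Qed.

Let xi_le z x : 1 < x -> `|xi z x| <= H * expR (- (e * x)).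
Proof.
move=> x1; rewrite /xi normrM mulrC; apply: ler_pM => //; first exact: bump_le.
by rewrite ger0_norm ?cutoff_ge0// cutoff_le.
Qed.

Let mxi z : measurable_fun setT (xi z).
Proof.
by rewrite /xi /cutoff; apply: measM; [meas|apply: (meas_comp mh); meas].
Qed.

Let linear_exp_L1 : L1 mu Iy (fun x => x * expR (- (e * x))).
Proof.
have e2 : 0 < e / 2 by rewrite divr_gt0.
have j : L1 mu Iy (fun x => 2 / e * expR (- (e / 2 * x))) by apply: L1Z => //; exact: expRN_L1.
apply: dominated_L1 j _ => //; first by apply: measurable_funTS; meas.
move=> x /Iy_gt1 x1; have x0 : 0 < x by rewrite (lt_trans _ x1).
rewrite ger0_norm ?mulr_ge0 ?expR_ge0 ?(ltW x0)//.
have -> : expR (- (e * x)) = expR (- (e / 2 * x)) * expR (- (e / 2 * x)).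
  by rewrite -expRD; congr expR; field.
rewrite mulrA ler_wpM2r ?expR_ge0// [leRHS](_ : _ = (e / 2)^-1); last by rewrite invf_div.
rewrite -[leRHS]mul1r ler_pdivlMr// expRN mulrAC ler_pdivrMr ?expR_gt0// mul1r mulrC.
by apply: le_trans (expR_ge1Dx _); rewrite lerDr.
Qed.

Let energy z := \int[mu2]_(p in D2) (xi z p.1 * xi z p.2 * band_kernel p.1 p.2).

Let energy_le z : L1 mu2 D2 (fun p => xi z p.1 * xi z p.2 * band_kernel p.1 p.2) /\
  energy z <= \int[mu]_(x in Iy) xi z x ^+ 2.
Proof. exact: (band_energy_le H0 e0 (mxi z) (@xi_le z)). Qed.

(** The factor x / a bounds 1/z on the support of h(x z), and is absorbed by
    the exponential cutoff. *)
Let majorant (p : R * R) := 4 * H * Q * (p.1 * expR (- (e * p.1)) * expR (- (e * p.2))).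

Let majorant_L1 : L1 mu2 D2 majorant.
Proof.
have [] := @dominated_Fubini _ _ _ _ R mu mu Iy Iy
  (fun x y => x * expR (- (e * x)) * expR (- (e * y))) _ _ _ _ _ linear_exp_L1 (expRN_L1 e0) _ => //.
- by apply: measurable_funTS; meas.
- move=> x y /Iy_gt1 x1 _; rewrite ger0_norm// !mulr_ge0 ?expR_ge0// ltW// (lt_trans _ x1)//.
move=> i _ _ _ _; apply: L1Z => //; exact: measurableX.
Qed.

Let integrand_le p z : D2 p -> I0 z ->
  `|xi z p.1 * xi z p.2 * band_kernel p.1 p.2 / z| <= majorant p * expR (- z).
Proof.
case: p => x y [/Iy_gt1/= x1 /Iy_gt1/= y1] /I0_gt0 z0.
have b1 := bump_scaled hh (ltW x1) z0.
have b2 : `|cutoff e x| <= expR (- (e * x)) by rewrite ger0_norm ?cutoff_ge0// cutoff_le.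
have b3 := xi_le z y1; have b4 := band_kernel_le4 x y.
rewrite (_ : xi z x * xi z y * band_kernel x y / z =
   cutoff e x * (h (x * z) / z) * (xi z y * band_kernel x y)); last by rewrite {1}/xi; ring.
rewrite /majorant /= (_ : 4 * H * Q * _ * expR (- z) =
   expR (- (e * x)) * (Q * x * expR (- z)) * (H * expR (- (e * y)) * 4)); last by ring.
rewrite normrM [`|cutoff e x * _|]normrM [`|xi z y * _|]normrM [`|h (x * z) / z|]normrM normfV (gtr0_norm z0).
apply: ler_pM => //; first by rewrite mulr_ge0// divr_ge0// ltW.
  by apply: ler_pM => //; rewrite divr_ge0// ltW.
by apply: ler_pM.
Qed.

Let dilates_L1 x y : 1 < x -> L1 mu I0 (fun z => h (x * z) * h (y * z) / z).
Proof.
move=> x1; have j : L1 mu I0 (fun z => H * (Q * x) * expR (- z)) by exact: L1Z.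
apply: dominated_L1 j _ => //.
  apply: measurable_funTS; apply: measM; last by meas.
  by apply: measM; apply: (meas_comp mh); meas.
move=> z /I0_gt0 z0; rewrite mulrAC mulrC -mulrA normrM; apply: ler_pM => //.
  exact: bump_le.
by rewrite normrM normfV (gtr0_norm z0); apply: bump_scaled => //; exact: ltW.
Qed.

(** The correlation at x / y is an average over z of h(x z) h(y z); here
    this average is taken last. *)
Let fold_energy : L1 mu I0 (fun z => energy z / z) /\
  \int[mu2]_(p in D2) cutoff_kernel (correlation h h) e p.1 p.2 =
  \int[mu]_(z in I0) (energy z / z).
Proof.
have mD2 : measurable D2 by exact: measurableX.
have [] := @dominated_Fubini _ _ _ _ R (product_sigma_finite mu mu) mu D2 I0
  (fun p z => xi z p.1 * xi z p.2 * band_kernel p.1 p.2 / z) _ _ _ _ _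
  majorant_L1 exp_L1 integrand_le => //.
  apply: measurable_funTS.
  have mx (f : (R * R) * R -> R) : measurable_fun setT f ->
      measurable_fun setT (fun w => xi w.2 (f w)).
    move=> mf; rewrite /xi /cutoff; apply: measM; first by meas.
    by apply: (meas_comp mh); apply: measM => //; meas.
  apply: measM; last by meas.
  apply: measM; first by apply: measM; apply: mx; meas.
  by rewrite /band_kernel; apply: measM; [meas|apply: measD; apply: meas_sinc; meas].
move=> _ _ j E1 E2.
have inner (z : R) : I0 z ->
   \int[mu2]_(p in D2) (xi z p.1 * xi z p.2 * band_kernel p.1 p.2 / z) = energy z / z.
  move=> _; have [i _] := energy_le z; exact: RintegralZr.
split; first exact: (@eq_L1 _ _ _ mu I0 _ _ _ inner j).
rewrite -(eq_Rint mu inner) -[RHS]E2 E1.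
apply: (@eq_Rint _ _ _ mu2) => -[x y] [/Iy_gt1/= x1 /Iy_gt1/= y1].
have x0 := lt_trans ltr01 x1; have y0 := lt_trans ltr01 y1.
rewrite /cutoff_kernel correlation_div// -[LHS]mulrA [_ * band_kernel _ _]mulrC mulrA.
rewrite -RintegralZl//; last exact: dilates_L1.
by apply: (@eq_Rint _ _ _ mu) => z _; rewrite /xi /=; ring.
Qed.

(** On the diagonal the average over z does not depend on x, by invariance
    of the Haar measure. *)
Let diagonal_energy : L1 mu I0 (fun z => (\int[mu]_(x in Iy) xi z x ^+ 2) / z) /\
  \int[mu]_(z in I0) ((\int[mu]_(x in Iy) xi z x ^+ 2) / z) =
  correlation h h 1 * exp_integral (2 * e).
Proof.
have iu : L1 mu Iy (fun x => H * Q * (x * expR (- (e * x)))) by exact: L1Z.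
have sq_le z x : 1 < x -> 0 < z -> `|xi z x ^+ 2 / z| <= H * Q * (x * expR (- (e * x))) * expR (- z).
  move=> x1 z0; have b1 := bump_scaled hh (ltW x1) z0; have b2 := bump_le (x * z) hh.
  have x0 : 0 < x by rewrite (lt_trans _ x1).
  have b3 : `|cutoff e x| <= expR (- (e * x)) by rewrite ger0_norm ?cutoff_ge0// cutoff_le.
  have b4 : `|cutoff e x| <= 1.
    by apply: (le_trans b3); rewrite -expR0 ler_expR oppr_le0 mulr_ge0// ltW.
  rewrite (_ : xi z x ^+ 2 / z = cutoff e x * cutoff e x * (h (x * z) * (h (x * z) / z))); last first.
    by rewrite /xi; ring.
  rewrite (_ : H * Q * (x * expR (- (e * x))) * expR (- z) =
    1 * expR (- (e * x)) * (H * (Q * x * expR (- z)))); last by ring.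
  rewrite normrM [`|cutoff e x * _|]normrM [`|h (x * z) * _|]normrM [`|h (x * z) / z|]normrM normfV (gtr0_norm z0).
  apply: ler_pM.
  - exact: mulr_ge0.
  - by apply: mulr_ge0 => //; rewrite divr_ge0// ltW.
  - exact: ler_pM.
  - by apply: ler_pM => //; rewrite divr_ge0// ltW.
have [] := @dominated_Fubini _ _ _ _ R mu mu Iy I0 (fun x z => xi z x ^+ 2 / z) _ _ _ _ _
  iu exp_L1 _ => //.
- apply: measurable_funTS; rewrite /xi /cutoff; apply: measM; last by meas.
  apply: measX; apply: measM; first by meas.
  by apply: (meas_comp mh); meas.
- by move=> x z /Iy_gt1 x1 /I0_gt0 z0; exact: sq_le.
move=> _ _ j E1 E2.
have sq_L1 z : L1 mu Iy (fun x => xi z x ^+ 2).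
  have k : L1 mu Iy (fun x => H ^+ 2 * expR (- (e * x))) by apply: L1Z => //; exact: expRN_L1.
  apply: dominated_L1 k _ => //; first by apply: measurable_funTS; apply: measX; exact: mxi.
  move=> x /Iy_gt1 x1; rewrite normrX.
  apply: (@le_trans _ _ ((H * expR (- (e * x))) ^+ 2)).
    by rewrite lerXn2r ?nnegrE ?xi_le//; apply: mulr_ge0 => //; exact: expR_ge0.
  rewrite exprMn ler_wpM2l ?sqr_ge0// expr2 ler_piMl ?expR_ge0//.
  by rewrite -expR0 ler_expR oppr_le0 mulr_ge0 ?(ltW e0)// ltW// (lt_trans _ x1).
have inner (z : R) : I0 z ->
    \int[mu]_(x in Iy) (xi z x ^+ 2 / z) = (\int[mu]_(x in Iy) xi z x ^+ 2) / z.
  by move=> _; exact: RintegralZr.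
split; first exact: (@eq_L1 _ _ _ mu I0 _ _ _ inner j).
rewrite -(eq_Rint mu inner) -E2 E1 /exp_integral -RintegralZl//; last first.
  have e2 : 0 < 2 * e by rewrite mulr_gt0.
  apply: dominated_L1 (expRN_L1 e2) _ => //; first by apply: measurable_funTS; meas.
  move=> x /Iy_gt1 x1; have x0 : 0 < x by rewrite (lt_trans _ x1).
  by rewrite ger0_norm ?divr_ge0 ?expR_ge0 ?(ltW x0)// ler_pdivrMr// ler_peMr ?expR_ge0// ltW.
apply: (@eq_Rint _ _ _ mu) => x /Iy_gt1 x1; have x0 := lt_trans ltr01 x1.
have -> : correlation h h 1 = \int[mu]_(z in I0) (h (x * z) * h (x * z) / z).
  by rewrite -(divff (lt0r_neq0 x0)) correlation_div.
have -> : expR (- (2 * e * x)) / x = cutoff e x ^+ 2.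
  rewrite /cutoff exprMn -expRM_natl -powR_mulrn ?powR_ge0// -powRrM.
  rewrite mulNr mulVf ?pnatr_eq0// powR_inv1 ?(ltW x0)//.
  by rewrite mulrC; congr (_ * expR _); ring.
rewrite mulrC -RintegralZl//; last exact: dilates_L1.
by apply: (@eq_Rint _ _ _ mu) => z _; rewrite /xi; ring.
Qed.

(** Bessel's inequality for each dilate of h, averaged over the dilations. *)
Lemma correlation_energy_le :
  \int[mu2]_(p in D2) cutoff_kernel (correlation h h) e p.1 p.2 <=
  correlation h h 1 * exp_integral (2 * e).
Proof.
have [i1 ->] := fold_energy; have [i2 <-] := diagonal_energy.
apply: le_Rintegral => // z /I0_gt0 z0; rewrite ler_pM2r ?invr_gt0//.
by have [_] := energy_le z.
Qed.

End Energy.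

End Correlation.

(** * Positivity on the convolution algebra *)
Section Positivity.
Variable R : realType.
Notation mu := (@lebesgue_measure R).
Notation mu2 := (mu \x mu)%E.
Notation I0 := (`]0%R, +oo[%classic : set R).
Notation Iy := (`]1%R, +oo[%classic : set R).
Notation D2 := (Iy `*` Iy).
Implicit Types (u v x y z : R) (h k : R -> R).

Definition zero_extension (f : R -> R) x := if 0 < x then f x else 0.

(** The derivative is continuous, hence bounded on the compact support and
    zero outside; the extension by zero is Lipschitz across 0 because the
    support stays away from it. *)
Lemma smooth_bump (f : R -> R) (a b : R) : 0 < a -> smooth_pos f ->
  (forall x, 0 < x -> (x < a) || (b < x) -> f x = 0) ->
  exists2 L, 0 <= L & bump a b L (zero_extension f).
Proof.
move=> a0 sf f0.
have df x : 0 < x -> is_derive x 1 f (derive1 f x).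
  by move=> x0; apply: DeriveDef; [exact: (sf 0%N)|rewrite derive1E].
have cf' x : 0 < x -> {for x, continuous (derive1 f)}.
  move=> x0; apply: differentiable_continuous; apply/derivable1_diffP.
  exact: (sf 1%N).
(* b may be smaller than a, in which case f vanishes *)
pose B := Num.max a b.
have aB : a <= B by rewrite le_max lexx.
have cN : {within `[a, B], continuous (fun x => `|derive1 f x|)}.
  apply: continuous_itv_within => x; rewrite /= in_itv/= => /andP[xa _].
  by apply: cont_norm; apply: cf'; exact: lt_le_trans xa.
have [c _ cM] := EVT_max aB cN.
pose L := `|derive1 f c|; have L0 : 0 <= L by exact: normr_ge0.
have dL x : 0 < x -> `|derive1 f x| <= L.
  move=> x0; have [xin|] := boolP (x \in `[a, B]); first exact: cM.
  rewrite in_itv/= negb_and -!ltNge => out.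
  have -> : derive1 f x = 0; last by rewrite normr0; exact: normr_ge0.
  rewrite derive1E; have d0 := der_cst x (0 : R).
  suff h : \forall y \near x, 0 = f y.
    exact: (@derive_val _ _ _ _ _ _ _ (near_eq_is_derive h d0)).
  have [xa|xB] := orP out.
    near=> y; rewrite f0//; first by near: y; exact: lt_nbhsr.
    by apply/orP; left; near: y; exact: lt_nbhsl.
  near=> y; have By : B < y by near: y; exact: lt_nbhsr.
  rewrite f0//; first by rewrite (lt_trans _ By)// (lt_le_trans a0).
  by apply/orP; right; apply: le_lt_trans By; rewrite le_max lexx orbT.
have mono x y : 0 < x -> x <= y -> `|f y - f x| <= L * (y - x).
  move=> x0 xy; apply: (@mean_value_bound R f (derive1 f)) => // z /andP[xz _].
    by apply: df; exact: lt_le_trans xz.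
  by apply: dL; exact: lt_le_trans xz.
have ordered x y : x <= y -> `|zero_extension f y - zero_extension f x| <= L * (y - x).
  move=> xy; rewrite /zero_extension; case: ltP => y0; last first.
    by rewrite ltNge (le_trans xy y0)/= subrr normr0 mulr_ge0// subr_ge0.
  case: ltP => x0; first exact: mono.
  have [ya|ya] := ltP y a.
    by rewrite f0 ?ya// subrr normr0 mulr_ge0// subr_ge0.
  (* a / 2 is a point between x and y where f vanishes *)
  have z0 : 0 < a / 2 by rewrite divr_gt0.
  have za : a / 2 < a by rewrite ltr_pdivrMr// mulr_natr mulr2n ltrDl.
  rewrite -(f0 _ z0); last by rewrite za.
  apply: (le_trans (mono _ _ z0 (le_trans (ltW za) ya))); rewrite ler_wpM2l//.
  by rewrite lerD2l lerN2 (le_trans x0)// ltW.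
exists L => //; split=> [x xa|x xb|x y].
- by rewrite /zero_extension; case: ltP => // x0; rewrite f0// xa.
- by rewrite /zero_extension; case: ltP => // x0; rewrite f0// xb orbT.
have [xy|yx] := leP x y.
  by rewrite distrC [`|x - y|]distrC [`|y - x|]ger0_norm ?subr_ge0//; exact: ordered.
by rewrite [`|x - y|]ger0_norm ?subr_ge0 ?(ltW yx)//; exact: (ordered _ _ (ltW yx)).
Unshelve. all: end_near. Qed.

Lemma haar_conv_star (g : R -> R[i]) (h k : R -> R) u : 0 < u ->
  (forall x, 0 < x -> g x = h x +i* k x) ->
  L1 mu I0 (fun v => h v * h (v / u) / v) -> L1 mu I0 (fun v => k v * k (v / u) / v) ->
  L1 mu I0 (fun v => k v * h (v / u) / v) -> L1 mu I0 (fun v => h v * k (v / u) / v) ->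
  haar_conv g (haar_star g) u =
  (correlation h h u + correlation k k u) +i* (correlation k h u - correlation h k u).
Proof.
move=> u0 gE i1 i2 i3 i4; rewrite /haar_conv /haar_integral /Cintegral /correlation.
rewrite -RintegralD// -RintegralB//.
have e (v : R) : I0 v -> g v * haar_star g (u / v) / v%:C =
    (h v * h (v / u) / v + k v * k (v / u) / v) +i*
    (k v * h (v / u) / v - h v * k (v / u) / v).
  move=> /I0_gt0 v0; rewrite /haar_star invf_div !gE ?divr_gt0// -fmorphV.
  by apply/eqP; rewrite eq_complex /=; apply/andP; split; apply/eqP; ring.
by congr (_ +i* _); apply: (@eq_Rint _ _ _ mu) => v /e ->.
Qed.

Section Bumps.
Variables (a b L : R) (h k : R -> R).
Hypotheses (a0 : 0 < a) (L0 : 0 <= L) (hh : bump a b L h) (hk : bump a b L k).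

Let F u := correlation h h u + correlation k k u.
Let S u := correlation k h u - correlation h k u.
Let Hb := L * `|b| * (L * `|b| * expR b / a).
Let Lc := L * (L * `|b| * expR b).

Let Hb0 : 0 <= Hb + Hb.
Proof. by rewrite addr_ge0// !mulr_ge0 ?invr_ge0 ?expR_ge0// ltW. Qed.

Let Lc0 : 0 <= Lc + Lc.
Proof. by rewrite addr_ge0// !mulr_ge0 ?expR_ge0. Qed.

Let Fle u : 0 < u -> `|F u| <= Hb + Hb.
Proof.
by move=> _; apply: (le_trans (ler_normD _ _)); apply: lerD; exact: correlation_le.
Qed.

Let Sle u : 0 < u -> `|S u| <= Hb + Hb.
Proof.
by move=> _; apply: (le_trans (ler_normB _ _)); apply: lerD; exact: correlation_le.
Qed.

Let Fcont u : 0 < u -> {for u, continuous F}.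
Proof. by move=> u0; apply: contD; exact: (@correlation_continuous R a b L). Qed.

Let Scont u : 0 < u -> {for u, continuous S}.
Proof.
move=> u0; apply: contD; first exact: (@correlation_continuous R a b L).
by apply: contN; exact: (@correlation_continuous R a b L).
Qed.

Let Fsym u : 0 < u -> F u^-1 = F u.
Proof. by move=> u0; rewrite /F !(@correlation_inv R a b L). Qed.

Let Ssym u : 0 < u -> S u^-1 = - S u.
Proof. by move=> u0; rewrite /S !(@correlation_inv R a b L)// opprB. Qed.

Let Fnear x : 1 < x -> `|F x - F 1| <= (Lc + Lc) * (x - 1).
Proof.
move=> x1; rewrite /F opprD addrACA; apply: (le_trans (ler_normD _ _)).
by rewrite [leRHS]mulrDl; apply: lerD; exact: (correlation_near1 a0 L0).
Qed.

Let Fmeas : measurable_fun setT F.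
Proof. by apply: measD; exact: (@meas_correlation R a b L). Qed.

Let form_L1 (q : R -> R) e : bump a b L q -> 0 < e ->
  L1 mu2 D2 (fun p => cutoff_kernel (correlation q q) e p.1 p.2).
Proof.
move=> hq e0; have Hb1 : 0 <= Hb by rewrite !mulr_ge0 ?invr_ge0 ?expR_ge0// ltW.
have [] // := @cutoff_form_fold R (correlation q q) Hb e Hb1 e0.
- exact: (@meas_correlation R a b L).
- by move=> x _; exact: correlation_le.
- by move=> x x0; rewrite (@correlation_inv R a b L).
- by move=> x x0; exact: (@correlation_continuous R a b L).
Qed.

Let Fpos e : 0 < e ->
  \int[mu2]_(p in D2) cutoff_kernel F e p.1 p.2 <= F 1 * exp_integral (2 * e).
Proof.
move=> e0; have mD2 : measurable D2 by exact: measurableX.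
have i1 := form_L1 hh e0; have i2 := form_L1 hk e0.
have E (p : R * R) : D2 p -> cutoff_kernel (correlation h h) e p.1 p.2 +
   cutoff_kernel (correlation k k) e p.1 p.2 = cutoff_kernel F e p.1 p.2.
  by move=> _; rewrite /cutoff_kernel /F; ring.
have -> : \int[mu2]_(p in D2) cutoff_kernel F e p.1 p.2 = _ := esym (eq_Rint mu2 E).
rewrite RintegralD// /F mulrDl.
by apply: lerD; exact: (@correlation_energy_le R a b L).
Qed.

Lemma trace_L_conv_star (g : R -> R[i]) : (forall x, 0 < x -> g x = h x +i* k x) ->
  0 <= trace_L (haar_conv g (haar_star g)).
Proof.
move=> gE; rewrite (@trace_L_hermitian R _ F S (Hb + Hb) (Lc + Lc))//.
  by rewrite lecR; exact: (trace_form_ge0 Hb0 Lc0 Fmeas Fle Fsym Fcont Fnear Fpos).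
move=> u u0; apply: haar_conv_star => //; exact: (@correlation_L1 R a b L).
Qed.

End Bumps.
End Positivity.

Theorem corollary2p3 (R : realType) :
  (forall g : R -> R[i], Ccoo g -> 0 <= trace_L (haar_conv g (haar_star g))) /\
  (forall lg : R[i] -> R[i], is_log_Gamma lg ->
   forall t : R, 0 <= (2 * derive1 (RS_theta lg) t)%:C + tr_delta_hat t).
Proof.
split=> [g [sre sim [a [b [a0 g0]]]]|lg lgP t]; last first.
  by rewrite RS_theta_trace// lecR; exact: trace_form_cos_ge0.
have [|L1 L10 b1] := smooth_bump a0 sre (b := b).
  by move=> x x0 /(g0 x x0) ->.
have [|L2 L20 b2] := smooth_bump a0 sim (b := b).
  by move=> x x0 /(g0 x x0) ->.
have widen (L : R) h : L <= L1 + L2 -> bump a b L h -> bump a b (L1 + L2) h.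
  move=> LL [h1 h2 h3]; split=> // x y; apply: (le_trans (h3 x y)).
  by rewrite ler_wpM2r.
have w1 := widen _ _ (ler_wpDr L20 (lexx L1)) b1.
have w2 := widen _ _ (ler_wpDl L10 (lexx L2)) b2.
apply: (trace_L_conv_star a0 (addr_ge0 L10 L20) w1 w2) => x x0.
by rewrite /zero_extension x0; case: (g x).
Qed.
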